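(* Let $\lambda>0$. For all $\mu,\nu\in L^2(\Omega;V)$, the problem $$\mathcal{T}_{1,2}^\lambda(\mu,\nu):=\inf_{\delta\in L^2(\Omega;V)}W_1^V(\mu+\delta,\nu)+\frac{\lambda}{2}\int_\Omega|\delta|_V^2$$ admits a minimizer $\delta\in L^2(\Omega;V)$, and it holds $$\mathcal{T}_{1,2}^\lambda(\mu,\nu)=\max_{\phi\in C(\Omega;V)}\left\{\int_\Omega\langle\phi,\nu-\mu\rangle_V-\frac{1}{2\lambda}\int_\Omega|\phi|_V^2,\ |\nabla\phi|_{V^d,\infty}\le1\right\}$$ $$=\min_{\sigma\in\mathcal{M}(\Omega;V^d),\,\delta\in L^2(\Omega;V)}\left\{\int_\Omega|\sigma|_{V^d}+\frac{\lambda}{2}\int_\Omega|\delta|_V^2,\ \operatorname{div}(\sigma)=\mu-\nu+\delta\right\}.$$ Furthermore, the optimal potential $\phi$ of the maximization problem is unique.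
   Context: $\Omega\subset\mathbb{R}^d$ is compact and convex with non-empty interior $\mathrm{int}(\Omega)$. $V$ is a real vector space of finite dimension $n$ with scalar product $\langle\cdot,\cdot\rangle_V$ and norm $|\cdot|_V$. $V^d$ carries the scalar product $\langle w,z\rangle_{V^d}=\sum_{l=1}^d\langle w_l,z_l\rangle_V$ and the associated norm $|\cdot|_{V^d}$. $C(\Omega;V)$, $C(\Omega;V^d)$ are spaces of continuous functions with sup norms. $\mathcal{M}(\Omega;V)$, $\mathcal{M}(\Omega;V^d)$ are the spaces of finite vector-valued measures on $\Omega$, dual to these via $\int_\Omega\langle\phi,\mu\rangle_V$ and $\int_\Omega\langle\psi,\sigma\rangle_{V^d}$. $\int_\Omega|\sigma|_{V^d}=\sup\{\int_\Omega\langle\psi,\sigma\rangle_{V^d}:\psi\in C(\Omega;V^d),\sup_\Omega|\psi|_{V^d}\le1\}$ is the total variation norm. Elements of $L^2(\Omega;V)$ (with respect to Lebesgue measure) are identified with the absolutely continuous measures having them as densities. Gradient and divergence act componentwise in an orthonormal basis of $V$. For $\phi\in C(\Omega;V)$, $$|\nabla\phi|_{V^d,\infty}:=\sup\Big\{\int_\Omega\langle\phi,\operatorname{div}\psi\rangle_V:\ \psi\in C_c^\infty(\mathrm{int}(\Omega);V^d),\ \int_\Omega|\psi|_{V^d}\le1\Big\}\in[0,+\infty].$$ For $\sigma\in\mathcal{M}(\Omega;V^d)$ and $\rho\in\mathcal{M}(\Omega;V)$, $\operatorname{div}(\sigma)=\rho$ is meant in the weak sense with zero flux boundary conditions: $-\int_\Omega\langle\nabla\phi,\sigma\rangle_{V^d}=\int_\Omega\langle\phi,\rho\rangle_V$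 for all $\phi\in C^1(\Omega;V)$. For $\mu,\nu\in\mathcal{M}(\Omega;V)$, $$W_1^V(\mu,\nu):=\sup_{\phi\in C(\Omega;V)}\Big\{\int_\Omega\langle\phi,\nu-\mu\rangle_V,\ |\nabla\phi|_{V^d,\infty}\le1\Big\}\in[0,+\infty],$$ which is $+\infty$ if $\int_\Omega\mu\ne\int_\Omega\nu$ (as vectors of $V$). *)

(* Defs.v *)
From HB Require Import structures.
From mathcomp Require Import all_boot all_order all_algebra.
From mathcomp Require Import all_classical all_reals all_analysis.
From mathcomp Require Import measurable_realfun.

Set Implicit Arguments.
Unset Strict Implicit.
Unset Printing Implicit Defensive.

Import Order.TTheory GRing.Theory Num.Theory.
Import numFieldNormedType.Exports.

Local Open Scope classical_set_scope.
Local Open Scope ring_scope.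

(* R^d is 'rV[R]_d with its Borel sigma-algebra.  The library's norm on
   'rV[R]_d is the sup norm; it is only used for its topology. *)
Section borel_rV.
Variables (R : realType) (d : nat).
Let G := @open 'rV[R]_d.
HB.instance Definition _ := @isMeasurable.Build (sigma_display G) 'rV[R]_d
  <<s G >> (@sigma_algebra0 _ setT G) (@sigma_algebraC _ G)
  (@sigma_algebra_bigcup _ setT G).
End borel_rV.

(* Lebesgue measure on R^d: the d-fold product of the one-dimensional Lebesgue
   measure, built by recursion on tuples and carried over to row vectors. *)
Section lebesgue_tuple.
Variable R : realType.
Local Notation rT := (measurableTypeR R).

Definition tcons (n : nat) (p : rT * n.-tuple rT) : n.+1.-tuple rT :=
  [tuple of p.1 :: p.2].

Lemma measurable_tcons n : measurable_fun setT (@tcons n).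
Proof. exact: measurable_cons. Qed.

Definition lebesgue_tuple_step (n : nat)
    (m : {sigma_finite_measure set (n.-tuple rT) -> \bar R}) :=
  pushforward (@lebesgue_measure R \x m)%E (@tcons n).

Section step.
Variables (n : nat) (m : {sigma_finite_measure set (n.-tuple rT) -> \bar R}).

Let q : {measure set (rT * n.-tuple rT)%type -> \bar R} :=
  (@lebesgue_measure R \x m)%E.

Let p : {measure set (n.+1.-tuple rT) -> \bar R} :=
  measure_function_pushforward__canonical__measure_function_Measure
    q (@measurable_tcons n).

HB.instance Definition _ := isMeasure.Build _ _ _ (lebesgue_tuple_step m)
  (measure0 p) (measure_ge0 p) (@measure_semi_sigma_additive _ _ _ p).

Let sigma_finite_step : sigma_finite setT (lebesgue_tuple_step m).
Proof.
have /sigma_finiteP[F [FT ndF Foo]] := sigma_finiteT (@lebesgue_measure R).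
have /sigma_finiteP[G [GT ndG Goo]] := sigma_finiteT m.
pose h (t : n.+1.-tuple rT) : (rT * n.-tuple rT)%type :=
  (thead t, [tuple of behead t]).
have mh : measurable_fun setT h.
  apply/measurable_fun_pair; last exact: measurable_behead.
  exact: measurable_tnth.
exists (fun k => h @^-1` (F k `*` G k)).
  rewrite -preimage_bigcup (_ : \bigcup_k _ = setT) ?preimage_setT//.
  rewrite -subTset => -[x y] _.
  have [i _ Fx] : (\bigcup_k F k) x by rewrite -FT.
  have [j _ Gy] : (\bigcup_k G k) y by rewrite -GT.
  exists (maxn i j) => //; split => /=.
  - by move: x Fx; exact/subsetPset/ndF/leq_maxl.
  - by move: y Gy; exact/subsetPset/ndG/leq_maxr.
move=> k; have [mF oF] := Foo k; have [mG oG] := Goo k.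
have mFG : measurable (F k `*` G k) by exact: measurableX.
split; first by rewrite -[X in measurable X]setTI; exact: mh.
rewrite /lebesgue_tuple_step /pushforward -comp_preimage.
rewrite (_ : h \o _ = id) ?preimage_id.
  by rewrite product_measure1E// lte_mul_pinfty// ge0_fin_numE.
apply/funext => -[x t] /=; rewrite /h /tcons /=; congr pair.
exact/val_inj.
Qed.

HB.instance Definition _ := Measure_isSigmaFinite.Build _ _ _
  (lebesgue_tuple_step m) sigma_finite_step.

End step.

Fixpoint lebesgue_tuple (n : nat) :
    {sigma_finite_measure set (n.-tuple rT) -> \bar R} :=
  if n is n'.+1 then lebesgue_tuple_step (lebesgue_tuple n')
  else \d_([tuple] : 0.-tuple rT).

Definition rV_of_tuple (d : nat) (t : d.-tuple rT) : 'rV[R]_d :=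
  \row_i tnth t i.

Lemma measurable_rV_of_tuple d : measurable_fun setT (@rV_of_tuple d).
Proof.
apply: (@measurability _ _ _ _ _ _ (@open 'rV[R]_d)) => //.
move=> _ [U oU <-]; rewrite setTI.
pose box (a : 'rV[rat]_d * nat) :=
  [set v : 'rV[R]_d | forall i, `|v ord0 i - ratr (a.1 ord0 i)| < a.2.+1%:R^-1].
pose B k := if @unpickle ('rV[rat]_d * nat)%type k is Some a then
  if `[< box a `<=` U >] then box a else set0 else set0.
have -> : U = \bigcup_k B k.
  apply/seteqP; split => [v Uv|v [k _]]; last first.
    by rewrite /B; case: unpickle => // a; case: asboolP => // + bv; exact.
  have /nbhs_ballP[e/= e0 eU] : nbhs v U by exact: open_nbhs_nbhs.
  have [k ke] : exists k, k.+1%:R^-1 < e / 2 :> R.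
    have := @near_infty_natSinv_lt R (PosNum (divr_gt0 e0 (@ltr0n R 2))).
    by move=> [k _ /(_ k (leqnn k))]; exists k.
  have /choice[q qP] (i : 'I_d) :
      exists q : rat, `|v ord0 i - ratr q| < k.+1%:R^-1.
    have k0 : 0 < k.+1%:R^-1 :> R by rewrite invr_gt0.
    have [|r] := @rat_in_itvoo R (v ord0 i) (v ord0 i + k.+1%:R^-1).
      by rewrite ltrDl.
    rewrite in_itv/= => /andP[vr rv]; exists r.
    by rewrite distrC gtr0_norm ?subr_gt0// ltrBlDl.
  exists (pickle (\row_i q i, k)) => //; rewrite /B pickleK.
  have bv : box (\row_i q i, k) v by move=> i; rewrite /= mxE.
  case: asboolP => // -[] w bw; apply: eU; split => // i j.
  rewrite (ord1 i) /ball /=; have := bw j; have := bv j; rewrite /= mxE => vq wq.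
  rewrite (splitr e) (le_lt_trans (ler_distD (ratr (q j)) _ _))//.
  by rewrite ltrD// ?(distrC _ (w _ _)); exact: lt_trans ke.
rewrite preimage_bigcup; apply: bigcupT_measurable => k; rewrite /B.
case: unpickle => [a|]; last by rewrite preimage_set0.
case: asboolP => _; last by rewrite preimage_set0.
rewrite (_ : _ @^-1` _ = \bigcap_(i in [set: 'I_d])
    ((fun t : d.-tuple rT => tnth t i) @^-1`
       [set x : rT | `|x - ratr (a.1 ord0 i)| < a.2.+1%:R^-1])); last first.
  by apply/seteqP; split => [t ta i _|t ta i]; have := ta i; rewrite /= mxE//; exact.
apply: fin_bigcap_measurable => // i _.
rewrite -[X in measurable X]setTI; apply: measurable_tnth => //.
apply: open_measurable.
rewrite (_ : [set _ | _] = ball (ratr (a.1 ord0 i) : R) a.2.+1%:R^-1); last first.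
  by apply/seteqP; split => x; rewrite /ball/= distrC.
exact: ball_open.
Qed.

Definition lebesgue_rV (d : nat) :=
  pushforward (lebesgue_tuple d) (@rV_of_tuple d).

Section instance.
Variable d : nat.

Let p : {measure set 'rV[R]_d -> \bar R} :=
  measure_function_pushforward__canonical__measure_function_Measure
    (lebesgue_tuple d) (@measurable_rV_of_tuple d).

HB.instance Definition _ := isMeasure.Build _ _ _ (@lebesgue_rV d)
  (measure0 p) (measure_ge0 p) (@measure_semi_sigma_additive _ _ _ p).

End instance.
End lebesgue_tuple.
Arguments lebesgue_rV {R d}.

Section euclidean.
Variables (R : realType) (V : normedModType R).
Implicit Types (dot : {dot V for idfun}).

Definition norm_of_dot dot := forall v, `|v| ^+ 2 = dot v v.

Definition orthonormal_basis dot n (e : 'I_n -> V) :=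
  (forall i j, dot (e i) (e j) = (i == j)%:R) /\
  (forall v, v = \sum_i dot v (e i) *: e i).

(* V^d is the type 'I_d -> V. *)
Definition vdot d dot (w z : 'I_d -> V) : R := \sum_l dot (w l) (z l).

Definition vnorm d dot (w : 'I_d -> V) : R := Num.sqrt (vdot dot w w).

End euclidean.

(* Integral of f over D against a signed measure nu, through its Jordan
   decomposition; the value does not depend on the Hahn decomposition. *)
Definition charge_integral dsp (T : measurableType dsp) (R : realType)
    (nu : {charge set T -> \bar R}) (D : set T) (f : T -> R) : R :=
  let P := cid (Hahn_decomposition nu) in
  let N := cid (projT2 P) in
  let nuPN : hahn_decomposition nu (projT1 P) (projT1 N) := projT2 N in
  \int[jordan_pos nuPN]_(x in D) f x - \int[jordan_neg nuPN]_(x in D) f x.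

Section transport.
Variables (R : realType) (d n : nat) (V : normedModType R).
Variables (dot : {dot V for idfun}) (e : 'I_n -> V) (Omega : set 'rV[R]_d).
Local Notation Rd := 'rV[R]_d.
Local Notation leb := (@lebesgue_rV R d).
Local Notation "'d_ l" := (delta_mx 0 l : Rd) (at level 8, l at level 2).

(* Functions on Omega are represented by functions on R^d, whose values outside
   Omega never matter. *)

Definition continuous_on (phi : Rd -> V) := {within Omega, continuous phi}.

(* A finite V-valued Borel measure mu on R^d is given by its components
   mu i = <mu, e i>, which are finite signed measures.  A V^d-valued measure is
   a family 'I_d -> vmeasure. *)
Definition vmeasure := 'I_n -> {charge set Rd -> \bar R}.

Definition on_Omega (mu : vmeasure) :=
  forall i A, measurable A -> A `&` Omega = set0 -> mu i A = 0%E.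

Definition vmeasure_sub (nu mu : vmeasure) : vmeasure :=
  fun i => cadd (nu i) (copp (mu i)).

Definition pairing (phi : Rd -> V) (mu : vmeasure) : R :=
  \sum_i charge_integral (mu i) Omega (fun x => dot (phi x) (e i)).

Definition vpairing (psi : 'I_d -> Rd -> V) (sigma : 'I_d -> vmeasure) : R :=
  \sum_l pairing (psi l) (sigma l).

Definition total_variation (sigma : 'I_d -> vmeasure) : \bar R :=
  ereal_sup [set (vpairing psi sigma)%:E | psi in [set psi : 'I_d -> Rd -> V |
    (forall l, continuous_on (psi l)) /\
    (forall x, Omega x -> vnorm dot (psi ^~ x) <= 1)]].

Definition L2_energy (f : Rd -> V) : \bar R :=
  (\int[leb]_(x in Omega) (`|f x| ^+ 2)%:E)%E.

Definition L2 (f : Rd -> V) :=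
  (forall i, measurable_fun Omega (fun x => dot (f x) (e i))) /\
  (L2_energy f < +oo)%E.

(* The measure with density f on Omega.  The default czero is not reached when
   f is in L2, since Omega then has finite measure. *)
Definition density (f : Rd -> V) : vmeasure := fun i =>
  match pselect (leb.-integrable [set: Rd]
                   ((fun x => (dot (f x) (e i))%:E) \_ Omega)) with
  | left intf => induced_charge intf
  | right _ => czero
  end.

Definition smooth (f : Rd -> V) := forall s : seq 'I_d,
  let g := foldr (fun l h x => 'D_('d_ l) h x) f s in
  continuous g /\ forall l x, derivable g x ('d_ l).

Definition test_field (psi : 'I_d -> Rd -> V) :=
  (forall l, smooth (psi l)) /\
  exists K : set Rd, [/\ compact K, K `<=` Omega° &
    forall l x, ~ K x -> psi l x = 0].

Definition divergence (psi : 'I_d -> Rd -> V) (x : Rd) : V :=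
  \sum_l 'D_('d_ l) (psi l) x.

(* |nabla phi|_{V^d, oo} *)
Definition grad_norm (phi : Rd -> V) : \bar R :=
  ereal_sup [set (\int[leb]_(x in Omega) dot (phi x) (divergence psi x))%:E |
    psi in [set psi | test_field psi /\
      (\int[leb]_(x in Omega) (vnorm dot (psi ^~ x))%:E <= 1)%E]].

(* phi is in C^1(Omega; V): C^1 inside, with a gradient G extending continuously
   up to the boundary.  G is determined on Omega by phi when Omega is the
   closure of its interior, e.g. for a convex body. *)
Definition C1_with_gradient (phi : Rd -> V) (G : 'I_d -> Rd -> V) :=
  continuous_on phi /\
  forall l, continuous_on (G l) /\
    forall x, Omega° x -> is_derive x ('d_ l) phi (G l x).

(* div sigma = rho, with zero flux at the boundary *)
Definition div_eq (sigma : 'I_d -> vmeasure) (rho : vmeasure) :=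
  forall phi G, C1_with_gradient phi G -> - vpairing G sigma = pairing phi rho.

Definition admissible (phi : Rd -> V) :=
  continuous_on phi /\ (grad_norm phi <= 1)%E.

Definition W1 (mu nu : vmeasure) : \bar R :=
  ereal_sup [set (pairing phi (vmeasure_sub nu mu))%:E | phi in admissible].

Variables (lambda : R) (mu nu : Rd -> V).

Definition primal_cost (delta : Rd -> V) : \bar R :=
  (W1 (density (fun x => mu x + delta x)%R) (density nu)
   + (lambda / 2)%:E * L2_energy delta)%E.

Definition T12 : \bar R := ereal_inf [set primal_cost delta | delta in L2].

Definition dual_cost (phi : Rd -> V) : R :=
  pairing phi (density (fun x => nu x - mu x))
  - (2 * lambda)^-1 * \int[leb]_(x in Omega) `|phi x| ^+ 2.

Definition flow_cost (p : ('I_d -> vmeasure) * (Rd -> V)) : \bar R :=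
  (total_variation p.1 + (lambda / 2)%:E * L2_energy p.2)%E.

Definition flow_admissible (p : ('I_d -> vmeasure) * (Rd -> V)) :=
  [/\ forall l, on_Omega (p.1 l), L2 p.2 &
    div_eq p.1 (density (fun x => mu x - nu x + p.2 x))].

End transport.

(* m is attained on S, and is the largest, resp. smallest, value there *)
Definition is_max (R : realType) (S : set (\bar R)) m := S m /\ ubound S m.
Definition is_min (R : realType) (S : set (\bar R)) m := S m /\ lbound S m.

(* Main.v *)
Require Import Defs.
From HB Require Import structures.
From mathcomp Require Import all_boot all_order all_algebra.
From mathcomp Require Import all_classical all_reals all_analysis.
From mathcomp Require Import measurable_realfun.
From mathcomp Require Import ring lra.
Set Implicit Arguments.
Unset Strict Implicit.
Unset Printing Implicit Defensive.
Import Order.TTheory GRing.Theory Num.Theory.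
Import numFieldNormedType.Exports.
Local Open Scope classical_set_scope.
Local Open Scope ring_scope.

(* A potential is admissible exactly when it is a uniform limit of C^1 functions
   with gradient bounded by 1, up to contracting the convex set Omega.  Hence the
   admissible potentials are equi-Lipschitz, and a sequence of them that is Cauchy
   in L^2 is uniformly Cauchy.  The dual objective D is strictly concave: by the
   parallelogram identity a maximizing sequence is Cauchy in L^2, so a maximizer
   phi exists and is unique on Omega.

   With delta = phi / lambda, the first-order condition at phi says that phi also
   maximizes <., nu - mu - delta> among admissible potentials.  This computes
   W_1(mu + delta, nu) and gives the primal cost of delta the value D(phi), which
   is a lower bound for all primal costs by Young's inequality.

   For the flows, G |-> <psi, nu - mu - delta>, where G is the gradient of psi, is
   dominated by W_1(mu + delta, nu) sup |G|.  The Hahn-Banach and Riesz theorems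
   extend it to a vector measure sigma of total variation at most that W_1.
   Conversely testing the divergence constraint with C^1 approximations of an
   admissible potential bounds the total variation from below. *)

(** * Smooth bump functions on the line *)

(** The two sides of the duality use different notions of regularity: [grad_norm] tests a merely
    continuous potential against fields supported in the interior, while [div_eq] quantifies over
    functions that are C^1 up to the boundary. Contraction followed by mollification is the bridge.
    After contracting by [1 - t], every point has around it a ball of radius comparable to [t]
    inside [Omega], so nothing is extended beyond the boundary, and the chain rule multiplies the
    gradient by [1 - t], so the bound 1 survives. The same balls turn smallness in L^2 into
    smallness in sup norm; this is why completeness replaces Arzela-Ascoli. The additive constant of
    a potential needs no normalisation, because the quadratic term controls it. Neither minimisation
    uses weak compactness: both minimisers come from the dual maximiser. The Lipschitz constants
    contain [n * d], since ['rV[R]_d] carries the sup norm and components are estimated one by one.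
    Only equicontinuity is drawn from them; the gradient bound itself stays Euclidean with constant
    exactly 1. *)

Section flat_function.
Variable R : realType.
Implicit Types (p : {poly R}) (t u : R).

(** Each multiplication by ['X] spends half of the rate, as [u <= 2 / a * expR (a / 2 * u)], and
    leaves the other half to the induction hypothesis. Hence the induction treats all rates [a] at
    once. *)
Lemma horner_le_expR p (a : R) : 0 < a ->
  exists2 C, 0 <= C & forall u, 0 <= u -> `|p.[u]| <= C * expR (a * u).
Proof.
elim/poly_ind: p a => [|p c IH] a a0.
  by exists 0 => // u _; rewrite horner0 normr0 mul0r.
have a20 : 0 < a / 2 by rewrite divr_gt0.
have [C C0 pC] := IH _ a20; exists (C * (2 / a) + `|c|).
  by rewrite addr_ge0// mulr_ge0// divr_ge0// ltW.
move=> u u0; rewrite hornerMXaddC (le_trans (ler_normD _ _))// mulrDl lerD//.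
  rewrite normrM (ger0_norm u0).
  rewrite [a * u](_ : _ = a / 2 * u + a / 2 * u); last by field.
  rewrite expRD mulrACA ler_pM//; first exact: pC.
  rewrite -ler_pdivrMl ?divr_gt0// invf_div.
  by apply: (le_trans _ (expR_ge1Dx _)); rewrite lerDr.
rewrite ler_peMr// -expR0 ler_expR mulr_ge0//.
exact: ltW.
Qed.

(* A polynomial in [1/t] times [exp (-1/t)]: this class is stable under
   differentiation, so all its members are smooth. *)
Definition flat p t : R := if 0 < t then p.[t^-1] * expR (- t^-1) else 0.

Lemma flat_ge0 t : 0 <= flat 1 t.
Proof. by rewrite /flat; case: ifP => // _; rewrite hornerC mul1r expR_ge0. Qed.

Lemma flat_gt0 t : 0 < t -> 0 < flat 1 t.
Proof. by rewrite /flat => ->; rewrite hornerC mul1r expR_gt0. Qed.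

Lemma flat_le0 p t : t <= 0 -> flat p t = 0.
Proof. by rewrite /flat leNgt => /negbTE ->. Qed.

(** The exponential bound is applied to [p * 'X^2] at [t^-1] with rate 1/2, which [expR (- t^-1)]
    absorbs. Order 2 makes the difference quotient at 0 vanish in the limit. *)
Lemma flat_bound p : exists2 C, 0 <= C &
  forall t, 0 < t -> `|flat p t| <= C * t ^+ 2.
Proof.
have h0 : 0 < 2^-1 :> R by rewrite invr_gt0.
have [C C0 pC] := horner_le_expR (p * 'X^2) h0.
exists C => // t t0; rewrite /flat t0 normrM (ger0_norm (expR_ge0 _)).
have := pC t^-1; rewrite invr_ge0 (ltW t0) => /(_ isT).
rewrite hornerM hornerXn normrM => pt.
have t2 : 0 < t^-1 ^+ 2 by rewrite exprn_gt0// invr_gt0.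
rewrite (ger0_norm (ltW t2)) in pt.
have -> : t ^+ 2 = (t^-1 ^+ 2)^-1 by rewrite exprVn invrK.
rewrite ler_pdivlMr// mulrAC (le_trans (ler_wpM2r (expR_ge0 _) pt))//.
rewrite -mulrA -expRD ler_piMr// -[leRHS]expR0 ler_expR.
have : 0 < t^-1 by rewrite invr_gt0.
set u := t^-1; lra.
Qed.

(** For positive [t] the factor ['X^2] is the derivative of [- t^-1], written in [t^-1]. At 0 the
    difference quotient is at most [C * h] from the right, by [flat_bound], and zero from the
    left. *)
Lemma is_derive_flat p t :
  is_derive t 1 (flat p) (flat ('X^2 * (p - p^`())) t).
Proof.
have [t0|t0|->] := ltgtP t 0.
- rewrite (@flat_le0 _ t)//; last exact: ltW.
  apply: near_eq_is_derive (is_derive_cst 0 t 1).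
  near=> x; rewrite flat_le0//; apply/ltW; near: x; exact: lt_nbhsl.
- have -> : flat ('X^2 * (p - p^`())) t =
     p.[t^-1] *: (expR (- t^-1) * (t ^- 2)) + expR (- t^-1) *: (p^`().[t^-1] * - t^-2).
    rewrite /flat t0 hornerM hornerXn hornerD hornerN /GRing.scale/= exprVn; ring.
  apply: (@near_eq_is_derive _ _ _
    (fun x : R => p.[x^-1] * expR (- x^-1) : R)).
    near=> x; have x0 : 0 < x by near: x; exact: (lt_nbhsr t0).
    by rewrite /flat ifT.
  have tn0 : t != 0 by rewrite gt_eqF.
  have dV : is_derive t 1 (@GRing.inv R) (- t ^- 2).
    have := @is_deriveV R id t 1 1 tn0 (is_derive_id _ _).
    by rewrite /GRing.scale/= mulr1.
  apply: (@is_deriveM _ _ (horner p \o GRing.inv)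
    (expR \o (fun x : R => - x^-1))); apply: is_derive1_comp.
  have -> : t ^- 2 = - (- t ^- 2) by rewrite opprK.
  exact: (is_deriveN dV).
- rewrite (@flat_le0 _ 0)//; have [C C0 pC] := flat_bound p.
  suff : h^-1 *: ((flat p \o shift 0) (h *: 1) - flat p 0) @[h --> 0^'] --> (0 : R).
    move=> dp; split; first by apply/cvg_ex; exists 0.
    exact: (cvg_lim _ dp).
  rewrite flat_le0//.
  apply/cvgrPdist_le => /= e e0.
  have Ce : 0 < e / (C + 1) by rewrite divr_gt0// ltr_wpDl.
  near=> h.
  have hn0 : h != 0 by near: h; exact: nbhs_dnbhs_neq.
  have he : `|h| <= e / (C + 1).
    near: h; apply: dnbhs0_le; exact: Ce.
  rewrite sub0r normrN subr0 addr0 normrM normfV /GRing.scale/= mulr1.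
  have [h0|h0] := ltP 0 h; last by rewrite flat_le0// normr0 mulr0 ltW.
  rewrite ler_pdivrMl ?normr_gt0// (le_trans (pC _ h0))//.
  rewrite (ger0_norm (ltW h0)) in he *.
  have : C * h <= e.
    rewrite (@le_trans _ _ ((C + 1) * h))// ?ler_pM2r// ?lerDl//.
    by rewrite mulrC -ler_pdivlMr// ltr_wpDl.
  by move=> ?; rewrite expr2 mulrCA ler_pM2l.
Unshelve. all: by end_near. Qed.

End flat_function.

Section smooth_real_functions.
Variable R : realType.
Implicit Types f g : R -> R.

(** Derivatives are only asserted to exist, so that sums, products and affine substitutions go by
    induction on [k], without Leibniz formulas for iterated derivatives. *)
Fixpoint differentiable_upto k f : Prop :=
  if k is k'.+1 then
    exists2 f', (forall t, is_derive (t : R) (1 : R) f (f' t)) & differentiable_upto k' f'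
  else True.

Lemma differentiable_uptoS k f :
  differentiable_upto k.+1 f -> differentiable_upto k f.
Proof.
elim: k f => // k IH f [f' ff' df']; exists f' => //; exact: IH.
Qed.

Lemma differentiable_uptoD k f g : differentiable_upto k f ->
  differentiable_upto k g -> differentiable_upto k (f \+ g).
Proof.
elim: k f g => // k IH f g [f' ff' df'] [g' gg' dg'].
by exists (f' \+ g'); [move=> t; exact: is_deriveD|exact: IH].
Qed.

Lemma differentiable_uptoM k f g : differentiable_upto k f ->
  differentiable_upto k g -> differentiable_upto k (f \* g).
Proof.
elim: k f g => // k IH f g df dg.
have [[f' ff' df'] [g' gg' dg']] := (df, dg).
exists ((f \* g') \+ (g \* f')).
  by move=> t; exact: (is_deriveM (ff' t) (gg' t)).
apply: differentiable_uptoD; apply: IH => //; exact: differentiable_uptoS.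
Qed.

Lemma differentiable_upto_cst k (c : R) : differentiable_upto k (cst c).
Proof.
elim: k c => // k IH c; exists (cst 0); last exact: IH.
by move=> t; exact: is_derive_cst.
Qed.

Lemma differentiable_upto_affine k f (a b : R) : differentiable_upto k f ->
  differentiable_upto k (fun t => f (a + b * t)).
Proof.
elim: k f => // k IH f [f' ff' df'].
exists (fun t => f' (a + b * t) * b).
  move=> t; have dab : is_derive t 1 (fun t : R => a + b * t) b.
    have := is_deriveD (is_derive_cst a t 1) (is_deriveZ b (is_derive_id t 1)).
    by rewrite add0r /GRing.scale/= mulr1.
  exact: (is_derive1_comp (ff' _) dab).
apply: differentiable_uptoM; first exact: IH.
exact: differentiable_upto_cst.
Qed.

Lemma differentiable_upto_flat k p : differentiable_upto k (flat (R:=R) p).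
Proof.
elim: k p => // k IH p; exists (flat ('X^2 * (p - p^`()))); last exact: IH.
by move=> t; exact: is_derive_flat.
Qed.

Definition derivatives f k : R -> R := iter k (@derive1 R R) f.

(** Uniqueness of derivatives identifies the existential witnesses with the iterates of [derive1];
    the [k]-th one uses differentiability to order [k + 1]. *)
Lemma is_derive_derivatives f : (forall k, differentiable_upto k f) ->
  forall k t, is_derive (t : R) (1 : R) (derivatives f k) (derivatives f k.+1 t).
Proof.
move=> df k t.
have : differentiable_upto 1 (derivatives f k).
  move: (df (k + 1)%N); elim: k f {df} => // k IH f [f' ff' df'].
  rewrite /derivatives iterSr (_ : derive1 f = f'); last first.
    by apply/funext => x; rewrite derive1E; have [] := ff' x.
  exact: IH.
move=> [g' gg' _]; split; first by have [] := gg' t.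
by rewrite /derivatives iterS derive1E.
Qed.

(** The strict inequality [s < |t|] is an open condition, so the previous derivative vanishes on a
    whole neighbourhood of [t]. *)
Lemma derivatives_eq0 f (s : R) k t : (forall k, differentiable_upto k f) ->
  (forall t, s <= `|t| -> f t = 0) -> s < `|t| -> derivatives f k t = 0.
Proof.
move=> df f0; elim: k t => [|k IH] t st; first by apply: f0; exact: ltW.
have [_ <-] := is_derive_derivatives df k t.
have [_ <-] := is_derive_cst (0 : R) t (1 : R).
apply: near_eq_derive.
have ct : {for t, continuous (fun x : R => `|x|)} by exact: norm_continuous.
near=> x; apply: IH; near: x.
exact: (@cvgr_gt _ R _ _ (fun x : R => `|x|) `|t| ct _ st).
Unshelve. all: by end_near. Qed.

End smooth_real_functions.

Section bump.
Variable R : realType.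
Local Notation mu := (@lebesgue_measure R).

Lemma lebesgue_measure_reflect (a : R) (A : set R) : measurable A ->
  pushforward mu (fun x : measurableTypeR R => a - x) A = mu A.
Proof.
move=> mA; have ma : measurable_fun [set: measurableTypeR R]
    (fun x : measurableTypeR R => a - x : measurableTypeR R).
  exact: measurable_funB.
apply/esym; apply: (@lebesgue_measure_unique _
  (measure_function_pushforward__canonical__measure_function_Measure
    mu ma)) => //= _ [[x y]] _ <-.
rewrite /pushforward (_ : _ @^-1` _ = `[a - y, a - x[%classic).
  rewrite !lebesgue_measure_itv/= !lte_fin ltrD2l ltrN2; case: ifPn => // _.
  by rewrite -!EFinD; congr EFin; ring.
by apply/seteqP; split => z /=; rewrite !in_itv/= => /andP[? ?];
  apply/andP; split; lra.
Qed.

Lemma ge0_integral_reflect (a : R) (f : R -> R) : measurable_fun setT f ->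
  (forall x, 0 <= f x) ->
  (\int[mu]_t (f (a - t))%:E = \int[mu]_t (f t)%:E)%E.
Proof.
move=> mf f0; have ma : measurable_fun [set: measurableTypeR R]
    (fun x : measurableTypeR R => a - x : measurableTypeR R).
  exact: measurable_funB.
transitivity (\int[pushforward mu (fun x : measurableTypeR R =>
    (a - x)%R : measurableTypeR R)]_t (f t)%:E)%E.
  rewrite ge0_integral_pushforward//; first exact/measurable_EFinP.
  by move=> x _; rewrite lee_fin.
by apply: eq_measure_integral => //= A mA _; exact: lebesgue_measure_reflect.
Qed.

(** The integral is stated for [f (a - t)] because the mollifier is a product of such reflected
    translates. *)
Lemma bump_exists (s : R) : 0 < s -> exists f : R -> R,
  [/\ forall k, differentiable_upto k f, forall t, 0 <= f t,
      forall t, s <= `|t| -> f t = 0 &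
      forall a, (\int[mu]_t (f (a - t))%:E = 1)%E].
Proof.
(* Each factor vanishes beyond one endpoint, so [g] is positive exactly on []-s, s[]. The
   coefficients 1 and -1 are written out to fit [differentiable_upto_affine]. *)
move=> s0; pose g t := flat 1 (s + 1 * t) * flat 1 (s + (-1) * t).
have dg k : differentiable_upto k g.
  by apply: differentiable_uptoM; apply: differentiable_upto_affine;
    exact: differentiable_upto_flat.
have g0 t : 0 <= g t by rewrite mulr_ge0// flat_ge0.
have gs t : s <= `|t| -> g t = 0.
  rewrite ler_normr /g mul1r mulN1r => /orP[st|st].
    by rewrite [X in _ * X]flat_le0 ?mulr0// subr_le0.
  by rewrite flat_le0 ?mul0r//; lra.
have cg : continuous g.
  move=> t; apply: differentiable_continuous; apply/derivable1_diffP.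
  by have [g' gg' _] := dg 1%N; have [] := gg' t.
have mg : measurable_fun setT g by exact: continuous_measurable_fun.
have gitv x : `[- s, s]%classic x \/ g x = 0.
  have [xs|xs] := leP `|x| s; last by right; apply: gs; exact: ltW.
  by left; rewrite /= in_itv/= -ler_norml.
have gE : (\int[mu]_t (g t)%:E = \int[mu]_(t in `[(- s)%R, s]) (g t)%:E)%E.
  rewrite [RHS]integral_mkcond; apply: eq_integral => x _; rewrite patchE.
  by case: ifPn => // /negP; rewrite inE => nx; case: (gitv x) => // ->.
have gfin : (\int[mu]_t (g t)%:E < +oo)%E.
  rewrite gE; have : mu.-integrable `[- s, s] (EFin \o g).
    by apply: continuous_compact_integrable;
      [exact: segment_compact|exact: continuous_subspaceT].
  move=> /integrableP[_]; under eq_integral do rewrite /= ger0_norm//.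
  by [].
have gpos : (0 < \int[mu]_t (g t)%:E)%E.
  have g00 : 0 < g 0 by rewrite /g !mulr0 !addr0 mulr_gt0 ?flat_gt0.
  have g02 : 0 < g 0 / 2 by rewrite divr_gt0.
  have /cvgrPdist_lt/(_ _ g02)/nbhs_ballP[e/= e0 eg] := cg 0.
  have e2 : 0 < e / 2 by rewrite divr_gt0.
  apply: (@lt_le_trans _ _ (\int[mu]_(t in `[0%R, (e / 2)%R]) (g 0 / 2)%:E)%E).
    rewrite integral_cst//= lebesgue_measure_itv/= lte_fin e2.
    by rewrite sube0 -EFinM lte_fin mulr_gt0.
  apply: (@le_trans _ _ (\int[mu]_(t in `[0%R, (e / 2)%R]) (g t)%:E)%E).
    apply: ge0_le_integral => //=.
    - by move=> x _; rewrite lee_fin ltW.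
    - exact/measurable_EFinP/measurable_funTS.
    - move=> x; rewrite in_itv/= => /andP[x0 xe]; rewrite lee_fin.
      have /eg : ball (0 : R) e x.
        by rewrite /ball/= sub0r normrN ger0_norm//; lra.
      by rewrite /= ltr_distlC {1}[g 0]splitr addrK => /andP[/ltW].
  apply: ge0_subset_integral => //; first exact/measurable_EFinP.
  by move=> x _; rewrite lee_fin.
set I : \bar R := (\int[mu]_t (g t)%:E)%E in gfin gpos.
have Ifin : I \is a fin_num by rewrite ge0_fin_numE// ltW.
have I0 : 0 < fine I by rewrite fine_gt0// gpos.
exists ((fun t => (fine I)^-1 * g t)); split.
- by move=> k; apply: differentiable_uptoM => //; exact: differentiable_upto_cst.
- by move=> t; rewrite mulr_ge0// invr_ge0 ltW.
- by move=> t st; rewrite gs// mulr0.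
- move=> a; rewrite (ge0_integral_reflect a (f := fun t => (fine I)^-1 * g t)).
  + under eq_integral do rewrite EFinM.
    rewrite ge0_integralZl//; last 3 first.
      exact/measurable_EFinP.
      by move=> x _; rewrite lee_fin.
      by rewrite lee_fin invr_ge0 ltW.
    by rewrite -/I -(fineK Ifin) -EFinM mulVf// gt_eqF.
  + exact: measurable_funM.
  + by move=> x; rewrite mulr_ge0// invr_ge0 ltW.
Qed.

End bump.

(** * Lebesgue measure on row vectors *)

Section row_vectors.
Variables (R : realType) (d : nat).
Implicit Types (x y : 'rV[R]_d).

Lemma coord_le_norm x i : `|x 0 i| <= `|x|.
Proof.
by rewrite [leRHS]/Num.norm /= mx_normrE; apply/bigmax_geP; right => /=; exists (0, i).
Qed.

Lemma norm_le_coord x r : 0 <= r -> (forall i, `|x 0 i| <= r) -> `|x| <= r.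
Proof.
move=> r0 xr; rewrite [leLHS]/Num.norm /= mx_normrE.
by apply/bigmax_leP; split => // -[i j] _ /=; rewrite (ord1 i).
Qed.

Lemma open_measurable_rV (A : set 'rV[R]_d) : open A -> measurable A.
Proof. by move=> oA; exact: sub_sigma_algebra. Qed.

Lemma closed_measurable_rV (A : set 'rV[R]_d) : closed A -> measurable A.
Proof.
move=> cA; rewrite -[A]setCK; apply: measurableC.
by apply: open_measurable_rV; exact: closed_openC.
Qed.

Lemma compact_measurable_rV (A : set 'rV[R]_d) : compact A -> measurable A.
Proof.
move=> cA; apply: closed_measurable_rV.
by apply: compact_closed => //; exact: norm_hausdorff.
Qed.

Lemma within_continuous_measurable_rV (A : set 'rV[R]_d) (f : 'rV[R]_d -> R) :
  measurable A -> {within A, continuous f} -> measurable_fun A f.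
Proof.
move=> mA /continuousP cf; apply: (measurability _ (RGenOpens.measurableE R)).
move=> _ [_ [a [b ->] <-]].
have [V oV VE] := (open_subspaceP _ _).1
  (cf `]a, b[%classic (@interval_open R (BRight a) (BLeft b) isT isT)).
rewrite setIC -VE; apply: measurableI => //; exact: open_measurable_rV.
Qed.

Lemma continuous_measurable_rV (f : 'rV[R]_d -> R) :
  continuous f -> measurable_fun setT f.
Proof.
move=> cf; apply: within_continuous_measurable_rV => //.
exact: continuous_subspaceT.
Qed.

(** A directional derivative and the derivative along the line have the same difference quotient as
    functions of [h]. This lets one-variable calculus serve on row vectors. *)
Lemma is_derive_line (W : normedModType R) (f : 'rV[R]_d -> W) a v t df :
  is_derive (a + t *: v) v f df -> is_derive (t : R) (1 : R) (fun t : R => f (a + t *: v)) df.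
Proof.
have E : (fun h : R => h^-1 *: ((f \o shift (a + t *: v)) (h *: v) - f (a + t *: v)))
  = (fun h : R => h^-1 *: (((fun t : R => f (a + t *: v)) \o shift t) (h *: (1 : R)) -
     f (a + t *: v))).
  apply/funext => h; rewrite /= scaler1.
  by congr (_ *: (f _ - _)); rewrite scalerDl addrCA.
case => fd fE; split; first by rewrite /derivable -E.
by rewrite -fE /derive -E.
Qed.

Lemma line_is_derive (W : normedModType R) (f : 'rV[R]_d -> W) a v df :
  is_derive (0 : R) (1 : R) (fun t : R => f (a + t *: v)) df -> is_derive a v f df.
Proof.
have E : (fun h : R => h^-1 *: ((f \o shift a) (h *: v) - f a))
  = (fun h : R => h^-1 *: (((fun t : R => f (a + t *: v)) \o shift 0) (h *: (1 : R)) -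
     f (a + 0 *: v))).
  apply/funext => h; rewrite /= scaler1.
  by rewrite addr0 scale0r addr0 (addrC (h *: v)).
case=> fd fE; split; first by rewrite /derivable E; exact: fd.
by rewrite -fE /derive E.
Qed.

End row_vectors.

Section tuple_integral.
Variable R : realType.
Local Notation rT := (measurableTypeR R).
Local Notation mu := (@lebesgue_measure R).

Lemma ge0_integral_tupleS n (F : n.+1.-tuple rT -> \bar R) :
  measurable_fun setT F -> (forall t, 0 <= F t)%E ->
  (\int[lebesgue_tuple R n.+1]_t F t =
   \int[mu]_x \int[lebesgue_tuple R n]_t F (tcons (x, t)))%E.
Proof.
move=> mF F0; rewrite /= /lebesgue_tuple_step.
rewrite ge0_integral_pushforward//; last exact: measurable_tcons.
rewrite preimage_setT (fubini_tonelli1 (F \o @tcons R n))//.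
  by apply: measurableT_comp => //; exact: measurable_tcons.
by move=> ?; exact: F0.
Qed.

(** The product form of the indicator of a cube lets [ge0_integral_prod_tuple] compute its
    integral. *)
Definition indic_box N n (t : n.-tuple rT) : R :=
  \prod_(i < n) \1_(`[(- N)%R, N]%classic : set R) (tnth t i).

Lemma ge0_integral_prod_tuple n (g : 'I_n -> R -> R) (c : 'I_n -> R) :
  (forall i, measurable_fun setT (g i)) -> (forall i x, 0 <= g i x) ->
  (forall i, \int[mu]_x (g i x)%:E = (c i)%:E)%E ->
  (\int[lebesgue_tuple R n]_t (\prod_(i < n) g i (tnth t i))%:E =
   (\prod_(i < n) c i)%:E)%E.
Proof.
have mprod (m : nat) (k : 'I_m -> R -> R) : (forall i, measurable_fun setT (k i)) ->
    measurable_fun setT (fun t : m.-tuple rT => \prod_(i < m) k i (tnth t i)).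
  move=> mk; apply: measurable_prod => i _.
  by apply: measurableT_comp; [exact: mk|exact: measurable_tnth].
elim: n g c => [|n IH] g c mg g0 gc.
  rewrite integral_dirac//= ?diracE ?mem_set ?mul1e ?big_ord0//.
  by apply/measurable_EFinP; exact: mprod.
rewrite ge0_integral_tupleS; last 2 first.
  by apply/measurable_EFinP; exact: mprod.
  by move=> t; rewrite lee_fin prodr_ge0.
have c0 i : 0 <= c i.
  by rewrite -lee_fin -gc; apply: integral_ge0 => x _; rewrite lee_fin.
transitivity (\int[mu]_x ((g ord0 x)%:E * (\prod_(i < n) c (lift ord0 i))%:E))%E.
  apply: eq_integral => x _.
  transitivity (\int[lebesgue_tuple R n]_t ((g ord0 x)%:E *
      (\prod_(i < n) g (lift ord0 i) (tnth t i))%:E))%E.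
    apply: eq_integral => t _; rewrite -EFinM big_ord_recl tnth0.
    by under eq_bigr do rewrite tnthS.
  rewrite ge0_integralZl//; last 3 first.
    by apply/measurable_EFinP; exact: (mprod n (fun i => g (lift ord0 i))).
    by move=> t _; rewrite lee_fin prodr_ge0.
    by rewrite lee_fin.
  by congr (_ * _)%E; apply: (IH (fun i => g (lift ord0 i))).
rewrite ge0_integralZr//; last 3 first.
  by apply/measurable_EFinP; exact: mg.
  by move=> x _; rewrite lee_fin.
  by rewrite lee_fin prodr_ge0.
by rewrite gc big_ord_recl EFinM.
Qed.

Lemma integrable_bounded_tuple n (F : n.-tuple rT -> R) M N :
  measurable_fun setT F -> 0 <= M -> (forall t, `|F t| <= M * indic_box N t) ->
  (lebesgue_tuple R n).-integrable setT (EFin \o F).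
Proof.
move=> mF M0 FM.
have m1 : measurable_fun setT (fun t : n.-tuple rT => indic_box N t).
  apply: measurable_prod => i _.
  by apply: measurableT_comp; [exact: measurable_indic|exact: measurable_tnth].
have b0 t : 0 <= indic_box N t :> R by apply: prodr_ge0 => i _.
apply: (@le_integrable _ _ _ _ _ measurableT _ (fun t => (M * indic_box N t)%:E)).
- exact/measurable_EFinP.
- by move=> t _; rewrite /= lee_fin (le_trans (FM t))// ler_norm.
- apply/integrableP; split; first by apply/measurable_EFinP; exact: measurable_funM.
  under eq_integral => t _ do rewrite gee0_abs ?lee_fin ?mulr_ge0// EFinM.
  rewrite ge0_integralZl//; last 2 first.
    exact/measurable_EFinP.
    by move=> t _; rewrite lee_fin.
  pose c := fine (mu (`[(- N)%R, N]%classic : set R)).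
  rewrite (@ge0_integral_prod_tuple n (fun _ => \1_(`[(- N)%R, N]%classic : set R))
    (fun=> c)) ?ltry//.
  move=> i; rewrite integral_indic//= setIT fineK//.
  by rewrite lebesgue_measure_itv/=; case: ifP.
Qed.

(** Fubini with the [l]-th integral innermost. If [l] is not the head, the head is integrated last
    and induction applies to the tail; if it is, the order of integration is exchanged. *)
Lemma integral_tuple_slice0 n (l : 'I_n) (F : n.-tuple rT -> R) M N :
  measurable_fun setT F -> 0 <= M -> (forall t, `|F t| <= M * indic_box N t) ->
  (forall t : n.-tuple rT, \int[mu]_x
    (F [tuple if i == l then x else tnth t i | i < n])%:E = 0)%E ->
  (\int[lebesgue_tuple R n]_t (F t)%:E = 0)%E.
Proof.
elim: n l F => [[]//|n IH l F mF M0 FM F0].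
have mFt : measurable_fun setT (EFin \o F \o @tcons R n).
  by apply: measurableT_comp; [exact/measurable_EFinP|exact: measurable_tcons].
have iF := integrable_bounded_tuple mF M0 FM.
have iFt : (mu \x lebesgue_tuple R n)%E.-integrable setT (EFin \o F \o @tcons R n).
  apply/integrableP; split => //.
  move/integrableP: iF => [_]; rewrite /= /lebesgue_tuple_step.
  rewrite ge0_integral_pushforward//; last 2 first.
    exact: measurable_tcons.
    by apply/measurable_EFinP; exact: measurableT_comp.
have -> : (\int[lebesgue_tuple R n.+1]_t (F t)%:E =
    \int[mu \x lebesgue_tuple R n]_z (EFin \o F \o @tcons R n) z)%E.
  rewrite /= /lebesgue_tuple_step integral_pushforward ?preimage_setT//.
  - exact: measurable_tcons.
  - exact/measurable_EFinP.
have tconsE x (t : n.-tuple rT) : tcons (x, t) = [tuple of x :: t] by [].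
case: (unliftP ord0 l) F0 => [l' ->|->] F0.
- rewrite -integral12_prod_meas1//; apply: integral0_eq => x _ /=.
  apply: (IH l' (fun t => F (tcons (x, t)))) => //.
  + apply: measurableT_comp => //; apply: measurableT_comp => //.
    exact: measurable_tcons.
  + move=> t; rewrite (le_trans (FM _))// ler_wpM2l// /indic_box big_ord_recl.
    under eq_bigr do rewrite tconsE tnthS.
    by rewrite ler_piMl ?prodr_ge0// indicE lern1 leq_b1.
  + move=> t; rewrite -[RHS](F0 (tcons (x, t))); apply: eq_integral => y _.
    congr (F _)%:E; apply: eq_from_tnth => i; rewrite tnth_mktuple.
    by case: (unliftP ord0 i) => [j ->|->]; rewrite tconsE ?tnthS ?tnth0// tnth_mktuple (inj_eq lift_inj).
- rewrite -integral21_prod_meas1//; apply: integral0_eq => t _ /=.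
  (* The head 0 is a placeholder: the slice overwrites it with [y]. *)
  rewrite -[RHS](F0 (tcons (0 : R, t))); apply: eq_integral => y _.
  congr (F _)%:E; apply: eq_from_tnth => i; rewrite tnth_mktuple.
  by case: (unliftP ord0 i) => [j ->|->]; rewrite tconsE ?tnthS ?tnth0 ?eqxx.
Qed.

End tuple_integral.

Section integral_rV.
Variables (R : realType) (d : nat).
Local Notation mu := (@lebesgue_measure R).
Local Notation leb := (@lebesgue_rV R d).
Implicit Types (x y : 'rV[R]_d).

Lemma ge0_integral_prod_rV (g : 'I_d -> R -> R) (c : 'I_d -> R) :
  (forall i, measurable_fun setT (g i)) -> (forall i (t : R), 0 <= g i t) ->
  (forall i, \int[mu]_t (g i t)%:E = (c i)%:E)%E ->
  (\int[leb]_y (\prod_(i < d) g i (y 0 i))%:E = (\prod_(i < d) c i)%:E)%E.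
Proof.
move=> mg g0 gc; rewrite -(ge0_integral_prod_tuple mg g0 gc) /lebesgue_rV.
rewrite ge0_integral_pushforward//.
- by rewrite preimage_setT; apply: eq_integral => t _ /=; under eq_bigr do rewrite mxE.
- exact: measurable_rV_of_tuple.
- apply/measurable_EFinP; apply: measurable_prod => i _.
  apply: measurableT_comp; first exact: mg.
  apply: continuous_measurable_rV; exact: coord_continuous.
- by move=> y _; rewrite lee_fin prodr_ge0.
Qed.

Lemma bounded_lebesgue_fin (A : set 'rV[R]_d) N : measurable A ->
  (forall x, A x -> `|x| <= N) -> (leb A < +oo)%E.
Proof.
move=> mA AN; pose c := fine (mu (`[(- N)%R, N]%classic : set R)).
rewrite (@le_lt_trans _ _ (\prod_(i < d) c)%:E) ?ltry//.
rewrite -(@ge0_integral_prod_rV (fun _ => \1_(`[(- N)%R, N]%classic : set R)))//; last first.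
  move=> i; rewrite integral_indic//= setIT fineK//.
  by rewrite lebesgue_measure_itv/=; case: ifP.
rewrite (_ : leb A = \int[leb]_x (\1_A x)%:E)%E; last by rewrite integral_indic// setIT.
rewrite ge0_le_integral//.
- by apply/measurable_EFinP; exact: measurable_indic.
- apply/measurable_EFinP; apply: measurable_prod => i _.
  apply: measurableT_comp; first exact: measurable_indic.
  apply: continuous_measurable_rV; exact: coord_continuous.
- move=> x _; rewrite lee_fin indicE; case: (boolP (x \in A)) => xA.
    rewrite big1// => i _; rewrite indicE mem_set//= in_itv/= -ler_norml.
    by rewrite (le_trans (coord_le_norm _ _))// AN//; exact: set_mem.
  by rewrite prodr_ge0.
Qed.

Lemma compact_norm_bounded (A : set 'rV[R]_d) : compact A ->
  exists2 N, 0 < N & forall x, A x -> `|x| <= N.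
Proof.
move=> /compact_bounded[M [Mreal AM]]; exists (`|M| + 1); first by rewrite ltr_pwDr.
by move=> x Ax; apply: AM => //; rewrite (le_lt_trans (ler_norm _))// ltrDl.
Qed.

Lemma compact_lebesgue_fin (A : set 'rV[R]_d) : compact A -> (leb A < +oo)%E.
Proof.
move=> cA; have [N _ AN] := compact_norm_bounded cA.
exact: bounded_lebesgue_fin (compact_measurable_rV cA) AN.
Qed.

(** On each line in direction [l] the fundamental theorem of calculus gives a difference of two
    values of [h] outside its support. *)
Lemma integral_partial_derivative0 (h F : 'rV[R]_d -> R) (l : 'I_d) M N :
  (forall y, is_derive y (delta_mx 0 l : 'rV[R]_d) h (F y)) -> continuous F ->
  (forall y, `|F y| <= M) -> 0 < N ->
  (forall y, N < `|y| -> F y = 0 /\ h y = 0) ->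
  (\int[leb]_y (F y)%:E = 0)%E.
Proof.
move=> hF cF FM N0 FN.
have mF : measurable_fun setT F by exact: continuous_measurable_rV.
have mFt : measurable_fun setT (F \o @rV_of_tuple R d).
  by apply: measurableT_comp => //; exact: measurable_rV_of_tuple.
have M0 : 0 <= M by rewrite (le_trans _ (FM 0)).
have FtM t : `|(F \o @rV_of_tuple R d) t| <= M * indic_box N t.
  rewrite /= /indic_box.
  have [tN|tN] := leP `|rV_of_tuple t| N.
    rewrite big1 ?mulr1// => i _; rewrite indicE mem_set//= in_itv/= -ler_norml.
    by have := coord_le_norm (rV_of_tuple t) i; rewrite mxE => /le_trans; apply.
  by have [-> _] := FN _ tN; rewrite normr0 mulr_ge0// prodr_ge0.
have iF := integrable_bounded_tuple mFt M0 FtM.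
rewrite /lebesgue_rV integral_pushforward//; last 2 first.
  exact: measurable_rV_of_tuple.
  exact/measurable_EFinP.
rewrite preimage_setT.
apply: (integral_tuple_slice0 (l := l) mFt M0 FtM) => t.
pose v : 'rV[R]_d := delta_mx 0 l.
(* With this base point the parameter of the line is the [l]-th coordinate itself. *)
pose a : 'rV[R]_d := \row_i (if i == l then 0 else tnth t i).
have aE (x : R) : rV_of_tuple [tuple if i == l then x else tnth t i | i < d] = a + x *: v.
  apply/rowP => i; rewrite !mxE tnth_mktuple eqxx/=; case: eqP => _.
    by rewrite add0r mulr1.
  by rewrite mulr0 addr0.
under eq_integral do rewrite /= aE.
have lineN (x : R) : N < `|x| -> N < `|a + x *: v|.
  move=> xN; rewrite (lt_le_trans xN)// (le_trans _ (coord_le_norm _ l))//.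
  by rewrite !mxE !eqxx/= add0r mulr1.
have duF (x : R) : is_derive x (1 : R) (fun x : R => h (a + x *: v)) (F (a + x *: v)).
  by apply: is_derive_line; exact: hF.
have caF : continuous (fun x : R => F (a + x *: v)).
  move=> x; apply: continuous_comp; last exact: cF.
  apply: continuousD; first exact: cvg_cst.
  exact: scalel_continuous.
(* Vanishing is known only for [N < |y|], so the endpoints are moved to [N + 1]. *)
have NN : - (N + 1) < N + 1 by lra.
rewrite (_ : \int[mu]_x _ = \int[mu]_(x in `[(- (N + 1))%R, (N + 1)%R]) (F (a + x *: v)%R)%:E)%E; last first.
  rewrite [RHS]integral_mkcond; apply: eq_integral => x _; rewrite patchE.
  case: ifPn => // /negP; rewrite inE/= in_itv/= -ler_norml => /negP; rewrite -ltNge => xN.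
  by have [|-> _] := FN (a + x *: v); first by apply: lineN; lra.
rewrite (continuous_FTC2 (F := fun x : R => h (a + x *: v)) NN).
- have [|_ ->] := FN (a + (N + 1) *: v).
    by apply: lineN; rewrite ger0_norm//; lra.
  have [|_ ->] := FN (a + (- (N + 1)) *: v).
    by apply: lineN; rewrite normrN ger0_norm//; lra.
  by rewrite subee.
- exact: continuous_subspaceT.
- have cu : continuous (fun x : R => h (a + x *: v)).
    move=> x; apply: differentiable_continuous; apply/derivable1_diffP.
    by have [] := duF x.
  split.
  + by move=> x _; have [] := duF x.
  + exact: (cvg_at_right_filter (cu _)).
  + exact: (cvg_at_left_filter (cu _)).
- by move=> x _; rewrite derive1E; have [] := duF x.
Qed.

End integral_rV.

(** * Hahn-Banach extension *)

Section hahn_banach.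
Variables (R : realType) (E : lmodType R) (S : set E) (p : E -> R).
Hypotheses (SD : forall x y, S x -> S y -> S (x + y))
  (SZ : forall (a : R) x, S x -> S (a *: x)).
Hypotheses (pD : forall x y, S x -> S y -> p (x + y) <= p x + p y)
  (pZ : forall (a : R) x, 0 < a -> S x -> p (a *: x) = a * p x).
Implicit Types G : set (E * R).

(* Partial linear functionals are represented by their graphs, so that Zorn's
   lemma applies to inclusion of sets. *)
Definition dominated_graph G :=
  [/\ G (0, 0), forall u v, G u -> G v -> G (u.1 + v.1, u.2 + v.2),
    forall a u, G u -> G (a *: u.1, a * u.2) &
    forall u, G u -> S u.1 /\ u.2 <= p u.1].

(** The value [a] at [y] must lie above every [u.2 - p (u.1 - y)] and below every
    [p (v.1 + y) - v.2]. Subadditivity separates the two families ([key]), and the supremum of the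
    first one is chosen. *)
Lemma dominated_graph_extension G y : dominated_graph G -> S y ->
  exists a : R, dominated_graph
    [set u | exists2 v, G v & exists t : R, u = (v.1 + t *: y, v.2 + t * a)].
Proof.
move=> [G0 GD GZ Gp] Sy; have SN x : S x -> S (- x).
  by move=> Sx; rewrite -scaleN1r; exact: SZ.
have key u v : G u -> G v -> u.2 - p (u.1 - y) <= p (v.1 + y) - v.2.
  move=> Gu Gv; have [_ uv] := Gp _ (GD _ _ Gu Gv).
  rewrite /= in uv; rewrite lerBlDr addrAC lerBrDr (le_trans uv)//.
  have -> : u.1 + v.1 = (v.1 + y) + (u.1 - y) by rewrite addrACA subrr addr0 addrC.
  by apply: pD; apply: SD => //; [have [] := Gp _ Gv|have [] := Gp _ Gu|exact: SN].
pose A := [set u.2 - p (u.1 - y) | u in G].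
have A0 : A !=set0 by exists (0 - p (0 - y)); exists (0, 0).
have Aub v : G v -> ubound A (p (v.1 + y) - v.2).
  by move=> Gv _ [u Gu <-]; exact: key.
have Asup : has_sup A by split => //; exists (p (0 + y) - 0); exact: (Aub (0, 0)).
have aA u : G u -> u.2 - p (u.1 - y) <= sup A.
  by move=> Gu; apply: ub_le_sup; [case: Asup|exists u].
have Aa v : G v -> sup A <= p (v.1 + y) - v.2.
  by move=> Gv; apply: ge_sup => //; exact: Aub.
exists (sup A); split.
- by exists (0, 0) => //; exists 0; rewrite /= scale0r mul0r !addr0.
- move=> _ _ [u Gu [s ->]] [v Gv [t ->]]; exists (u.1 + v.1, u.2 + v.2).
    exact: GD.
  by exists (s + t); congr pair; rewrite /= ?scalerDl ?mulrDl addrACA.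
- move=> a _ [u Gu [s ->]]; exists (a *: u.1, a * u.2); first exact: GZ.
  by exists (a * s); congr pair; rewrite /= ?scalerDr ?scalerA ?mulrDr ?mulrA.
- move=> _ [u Gu [t ->]] /=; have [Su up] := Gp _ Gu.
  split; first by apply: SD => //; exact: SZ.
  (* Homogeneity leaves only the sign of [t]: dividing by [- t] gives the lower constraint on [a],
     dividing by [t] the upper one. *)
  have [t0|t0|->] := ltgtP t 0.
  + have s0 : 0 < - t by rewrite oppr_gt0.
    have := aA _ (GZ (- t)^-1 _ Gu).
    rewrite /= lerBlDr -(ler_pM2l s0) mulrDr !mulVKf ?gt_eqF// -pZ//; last first.
      by apply: SD; [exact: SZ|exact: SN].
    rewrite scalerBr scalerA divff ?gt_eqF// scale1r scaleNr opprK mulNr.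
    lra.
  + have := Aa _ (GZ t^-1 _ Gu).
    rewrite /= lerBrDr -(ler_pM2l t0) mulrDr !mulVKf ?gt_eqF// -pZ//; last first.
      by apply: SD => //; exact: SZ.
    rewrite scalerDr scalerA divff ?gt_eqF// scale1r.
    lra.
  + by rewrite scale0r mul0r !addr0.
Qed.

(** [S] is a subset because in the application [E] consists of all fields and [S] of those
    continuous on [Omega]. [G0] is not assumed to be the graph of a function: domination by [p]
    forces it. *)
Theorem hahn_banach_graph G0 : dominated_graph G0 -> exists L : E -> R,
  [/\ forall x y, S x -> S y -> L (x + y) = L x + L y,
    forall (a : R) x, S x -> L (a *: x) = a * L x,
    forall x, S x -> L x <= p x & forall u, G0 u -> L u.1 = u.2].
Proof.
(* Uniting each member with [G0] takes care of the empty chain and makes the maximal graph contain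
   [G0]. *)
move=> dG0; have [|A [dA maxA]] := @Zorn_bigcup _ (fun A => dominated_graph (G0 `|` A)).
  move=> F FP Ftot.
  have pick2 u v : (G0 `|` \bigcup_(X in F) X) u -> (G0 `|` \bigcup_(X in F) X) v ->
      exists B, [/\ B `<=` G0 `|` \bigcup_(X in F) X, dominated_graph B, B u & B v].
    have sub X : F X -> G0 `|` X `<=` G0 `|` \bigcup_(X in F) X.
      by move=> FX; apply: setUS; exact: bigcup_sup.
    have dX X : F X -> dominated_graph (G0 `|` X) by exact: FP.
    move=> [u0|[X FX Xu]] [v0|[Y FY Yv]].
    - by exists G0; split => //; exact: subsetUl.
    - by exists (G0 `|` Y); split; [exact: sub|exact: dX|left|right].
    - by exists (G0 `|` X); split; [exact: sub|exact: dX|right|left].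
    - have [XY|YX] := Ftot _ _ FX FY.
      + by exists (G0 `|` Y); split; [exact: sub|exact: dX|right; exact: XY|right].
      + by exists (G0 `|` X); split; [exact: sub|exact: dX|right|right; exact: YX].
  split.
  - by left; case: dG0.
  - move=> u v Gu Gv; have [B [Bsub [_ BD _ _] Bu Bv]] := pick2 _ _ Gu Gv.
    by apply: Bsub; exact: BD.
  - move=> a u Gu; have [B [Bsub [_ _ BZ _] Bu _]] := pick2 _ _ Gu Gu.
    by apply: Bsub; exact: BZ.
  - move=> u Gu; have [B [_ [_ _ _ Bp] Bu _]] := pick2 _ _ Gu Gu.
    exact: Bp.
set G := G0 `|` A in dA; have [G00 GD GZ Gp] := dA.
have Guniq x r r' : G (x, r) -> G (x, r') -> r <= r'.
  move=> Gr Gr'; have := GD _ _ Gr (GZ (-1) _ Gr').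
  rewrite /= scaleN1r subrr mulN1r => /Gp/= [S0 +].
  (* Homogeneity with factor 2 gives [p 0 = 0], and the difference of two values over one point is
     dominated by [p 0]. *)
  have /eqP := pZ (ltr0n R 2) S0.
  rewrite scaler0 mulr_natl mulr2n -subr_eq0 opprD addrA subrr sub0r oppr_eq0.
  by move=> /eqP ->; rewrite subr_le0.
have Gdom x : S x -> exists r, G (x, r).
  move=> Sx; apply: contrapT => /forallNP nG.
  have [a] := dominated_graph_extension dA Sx.
  set G' := (X in dominated_graph X) => dG'.
  have GG' : G `<=` G'.
    by move=> [u r] Gu; exists (u, r) => //; exists 0; rewrite scale0r mul0r !addr0.
  have G'E : G0 `|` G' = G' by apply/setUidPr => u ?; apply: GG'; left.
  apply: (maxA G'); last by rewrite G'E.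
  split; first by move=> u ?; apply: GG'; right.
  move=> /(_ (x, a)) G'A; apply: (nG a); right; apply: G'A.
  by exists (0, 0) => //; exists 1; rewrite /= scale1r mul1r !add0r.
have /choice[L LP] x : exists r, S x -> G (x, r).
  by have [/Gdom[r Gr]|nS] := pselect (S x); [exists r|exists 0].
have LE x r : S x -> G (x, r) -> L x = r.
  by move=> Sx Gr; apply/eqP; rewrite eq_le; apply/andP; split;
    apply: (@Guniq x) => //; exact: LP.
exists L; split.
- by move=> x y Sx Sy; apply: LE; [exact: SD|apply: (GD (x, L x) (y, L y)); exact: LP].
- by move=> a x Sx; apply: LE; [exact: SZ|apply: (GZ a (x, L x)); exact: LP].
- by move=> x Sx; have [] := Gp _ (LP _ Sx).
- by move=> [x r] G0x; apply: LE; [have [] := Gp (x, r) (or_introl G0x)|left].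
Qed.

End hahn_banach.

(** * Integration against charges and against measures with a density *)

Section charge_integral_theory.
Local Open Scope ereal_scope.
Context dsp (T : measurableType dsp) (R : realType).

(** Two decompositions of [nu] are compared crosswise: [jordan_pos + m2] and [jordan_neg + m1] agree
    as measures, hence have equal integrals. Finite measures and a bounded [f] make the
    rearrangement legitimate. *)
Lemma charge_integralE (nu : {charge set T -> \bar R})
    (m1 m2 : {measure set T -> \bar R}) (D : set T) (f : T -> R) (M : R) :
  measurable D -> measurable_fun D f -> (forall x, D x -> `|f x| <= M)%R ->
  m1 setT < +oo -> m2 setT < +oo ->
  (forall A, measurable A -> nu A = m1 A - m2 A) ->
  charge_integral nu D f =
  (\int[m1]_(x in D) f x - \int[m2]_(x in D) f x)%R.
Proof.
move=> mD mf fM m1T m2T nuE; rewrite /charge_integral.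
set P := cid _; set N := cid _; set nuPN : hahn_decomposition _ _ _ := projT2 N.
have bint (m : {measure set T -> \bar R}) : m setT < +oo -> m.-integrable D (EFin \o f).
  move=> mT; apply: measurable_bounded_integrable => //.
    by rewrite (le_lt_trans _ mT)// le_measure ?inE.
  by exists M; split; rewrite ?num_real// => x Mx y Dy /=; exact: le_trans (fM _ Dy) (ltW Mx).
have fin (m : {measure set T -> \bar R}) A : m setT < +oo -> measurable A -> m A \is a fin_num.
  by move=> mT mA; rewrite ge0_fin_numE// (le_lt_trans _ mT)// le_measure ?inE.
have jpT : jordan_pos nuPN setT < +oo by rewrite -ge0_fin_numE// fin_num_measure.
have jnT : jordan_neg nuPN setT < +oo by rewrite -ge0_fin_numE// fin_num_measure.
have E : \int[measure_add (jordan_pos nuPN) m2]_(x in D) (f x)%:E =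
    \int[measure_add (jordan_neg nuPN) m1]_(x in D) (f x)%:E.
  apply: eq_measure_integral => A mA _; 
  suff : jordan_pos nuPN A + m2 A = jordan_neg nuPN A + m1 A.
    by move=> H; rewrite [LHS]measure_addE [RHS]measure_addE.
  have cross (a b c e : \bar R) : a \is a fin_num -> b \is a fin_num ->
      c \is a fin_num -> e \is a fin_num -> c - e = a - b -> a + e = b + c.
    by case: a b c e => [a| |] [b| |] [c| |] [e| |]//= _ _ _ _ [H]; congr EFin; lra.
  apply: cross; [exact: fin jpT mA|exact: fin jnT mA|exact: fin|exact: fin|].
  by rewrite -nuE// (jordan_decomp nuPN mA) /cadd/= cscaleN1.
have addE (a b : {measure set T -> \bar R}) : a setT < +oo -> b setT < +oo ->
    \int[measure_add a b]_(x in D) (f x)%:E =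
    \int[a]_(x in D) (f x)%:E + \int[b]_(x in D) (f x)%:E.
  by move=> aT bT; apply: integral_measure_add => //; exact: bint.
move: E; rewrite !addE// /Rintegral.
have fint (m : {measure set T -> \bar R}) : m setT < +oo ->
    \int[m]_(x in D) (f x)%:E \is a fin_num.
  by move=> mT; apply: integrable_fin_num => //; exact: bint.
have cross (a b c e : \bar R) : a \is a fin_num -> b \is a fin_num ->
    c \is a fin_num -> e \is a fin_num -> a + e = b + c ->
    (fine a - fine b = fine c - fine e)%R.
  by case: a b c e => [a| |] [b| |] [c| |] [e| |]//= _ _ _ _ [H]; lra.
by apply: cross; exact: fint.
Qed.

Import HBNNSimple.

(** For indicator functions this is the hypothesis on [m]. Linearity gives simple functions, and
    monotone convergence along [nnsfun_approx] on both sides gives [g]. *)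
Lemma ge0_integral_density (mu m : {measure set T -> \bar R}) (D : set T)
    (f g : T -> R) :
  measurable D -> measurable_fun D f -> measurable_fun D g ->
  (forall x, D x -> 0 <= f x)%R -> (forall x, D x -> 0 <= g x)%R ->
  (forall A, measurable A -> A `<=` D -> m A = \int[mu]_(x in A) (f x)%:E) ->
  \int[m]_(x in D) (g x)%:E = \int[mu]_(x in D) (g x * f x)%:E.
Proof.
move=> mD mf mg f0 g0 mE.
have mg' : measurable_fun D (EFin \o g) by exact/measurable_EFinP.
pose g_ := nnsfun_approx mD mg'.
have gcvg x : D x -> EFin \o g_ ^~ x @ \oo --> (g x)%:E.
  by move=> Dx; apply: cvg_nnsfun_approx => // *; rewrite lee_fin g0.
transitivity (limn (fun n => \int[m]_(x in D) (g_ n x)%:E)).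
  rewrite -monotone_convergence//.
  - by apply: eq_integral => x /[!inE] xD; apply/esym/cvg_lim => //; exact: gcvg.
  - by move=> n; exact/measurable_EFinP/measurable_funTS.
  - by move=> n x _; rewrite lee_fin.
  - by move=> x _ a b ab; rewrite lee_fin; exact/lefP/nd_nnsfun_approx.
rewrite [X in limn X](_ : _ = (fun n => \int[mu]_(x in D) (g_ n x * f x)%:E)).
  rewrite -monotone_convergence//.
  - apply: eq_integral => x /[!inE] xD; apply/cvg_lim => //.
    rewrite (_ : (fun n => _) = fun n => (g_ n x)%:E * (f x)%:E)//.
    by rewrite EFinM; apply: cvgeZr => //; exact: gcvg.
  - by move=> n; apply/measurable_EFinP/measurable_funM => //; exact: measurable_funTS.
  - by move=> n x Dx; rewrite lee_fin mulr_ge0// f0.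
  - move=> x Dx a b ab; rewrite lee_fin ler_wpM2r ?f0//.
    exact/lefP/nd_nnsfun_approx.
apply/funext => n.
have mk r : measurable (g_ n @^-1` [set r]) by [].
transitivity (\sum_(k \in range (g_ n))
    \int[m]_(x in D) (k * \1_(g_ n @^-1` [set k]) x)%:E).
  under eq_integral do rewrite fimfunE -fsumEFin//.
  rewrite ge0_integral_fsum//.
  - by move=> y; apply/measurable_EFinP/measurable_funM => //; exact: measurable_indic.
  - by move=> y x _; rewrite nnfun_muleindic_ge0.
under [RHS]eq_integral => x _.
  rewrite fimfunE mulr_fsuml// -fsumEFin//; over.
rewrite [RHS]ge0_integral_fsum//; last 2 first.
- move=> r; apply/measurable_EFinP/measurable_funM => //.
  by apply: measurable_funM => //; exact: measurable_indic.
- move=> r x Dx; have := nnfun_muleindic_ge0 (g_ n) r x; rewrite -EFinM lee_fin => ?.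
  by rewrite lee_fin mulr_ge0// f0.
apply: eq_fsbigr => r /[!inE] -[x0 _ rE].
have r0 : (0 <= r)%R by rewrite -rE.
under [RHS]eq_integral do rewrite -mulrA EFinM.
rewrite [RHS]ge0_integralZl//; last 2 first.
- by apply/measurable_EFinP/measurable_funM => //; exact: measurable_indic.
- by move=> x Dx; rewrite lee_fin mulr_ge0// ?indicE// f0.
under [LHS]eq_integral do rewrite EFinM.
rewrite [LHS]ge0_integralZl//; last first.
  by apply/measurable_EFinP; exact: measurable_indic.
congr (_ * _); rewrite integral_indic// mE; [|exact: measurableI|exact: subIsetr].
rewrite setIC integral_mkcondr; apply: eq_integral => x _.
by rewrite patchE indicE; case: ifPn => _; rewrite ?mul1r ?mul0r.
Qed.

End charge_integral_theory.

(** * Riesz representation on a compact set *)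

Section within_continuity.
Variables (R : realType) (T : topologicalType) (A : set T).
Implicit Types f g : T -> R.

Lemma within_cst (c : R) : {within A, continuous (fun=> c)}.
Proof. by move=> x; exact: cvg_cst. Qed.

Lemma within_add f g : {within A, continuous f} -> {within A, continuous g} ->
  {within A, continuous (f \+ g)}.
Proof. by move=> cf cg x; apply: cvgD; [exact: cf|exact: cg]. Qed.

Lemma within_sub f g : {within A, continuous f} -> {within A, continuous g} ->
  {within A, continuous (f \- g)}.
Proof. by move=> cf cg x; apply: cvgB; [exact: cf|exact: cg]. Qed.

Lemma within_mul f g : {within A, continuous f} -> {within A, continuous g} ->
  {within A, continuous (f \* g)}.
Proof. by move=> cf cg x; apply: cvgM; [exact: cf|exact: cg]. Qed.

Lemma within_min f g : {within A, continuous f} -> {within A, continuous g} ->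
  {within A, continuous (f \min g)}.
Proof. by move=> cf cg x; apply: continuous_min; [exact: cf|exact: cg]. Qed.

Lemma within_continuous_bounded f : compact A -> {within A, continuous f} ->
  exists2 M, 0 <= M & forall x, A x -> `|f x| <= M.
Proof.
move=> cA cf; have [M [Mreal fM]] := compact_bounded (continuous_compact cf cA).
exists (`|M| + 1); first by rewrite addr_ge0.
move=> x Ax; apply: fM; last by exists x.
by rewrite (le_lt_trans (ler_norm _))// ltrDl.
Qed.

End within_continuity.

Lemma within_continuousP (R : realType) (U W : normedModType R) (A : set U)
    (f : U -> W) : {within A, continuous f} <->
  forall x, A x -> forall e, 0 < e -> exists2 r : R, 0 < r &
    forall y, A y -> `|x - y| < r -> `|f x - f y| < e.
Proof.
split=> [/subspace_continuousP cf x Ax e e0|H].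
  have /cvgrPdist_lt/(_ _ e0) := cf x Ax.
  rewrite near_withinE => /nbhs_ballP[r/= r0 rf]; exists r => // y Ay xy.
  by apply: rf => //; rewrite -ball_normE.
apply/subspace_continuousP => x Ax; apply/cvgrPdist_lt => e e0.
rewrite near_withinE; have [r r0 rf] := H x Ax e e0.
by apply/nbhs_ballP; exists r => // y; rewrite -ball_normE/= => xy Ay; exact: rf.
Qed.

Section distance.
Variables (R : realType) (V : normedModType R) (A : set V).
Hypothesis A0 : A !=set0.

Definition dist_to (x : V) : R := inf [set `|x - a| | a in A].

Lemma dist_to_has_inf x : has_inf [set `|x - a| | a in A].
Proof.
case: A0 => a Aa; split; first by exists `|x - a|, a.
by exists 0 => _ [b _ <-].
Qed.

Lemma dist_to_ge0 x : 0 <= dist_to x.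
Proof. by apply: lb_le_inf; [case: (dist_to_has_inf x)|move=> _ [b _ <-]]. Qed.

Lemma dist_to_le x a : A a -> dist_to x <= `|x - a|.
Proof. by move=> Aa; apply: ge_inf; [case: (dist_to_has_inf x)|exists a]. Qed.

Lemma dist_to_lipschitz x y : dist_to x <= `|x - y| + dist_to y.
Proof.
rewrite -lerBlDl; apply: lb_le_inf; first by case: (dist_to_has_inf y).
move=> _ [a Aa <-]; rewrite lerBlDl (le_trans (dist_to_le x Aa))//.
exact: ler_distD.
Qed.

Lemma dist_to_continuous : continuous dist_to.
Proof.
move=> x; apply/cvgrPdist_le => /= e e0; near=> y.
have xy : `|x - y| <= e.
  by near: y; exact: (@cvgr_dist_le _ _ _ _ _ id x cvg_id _ e0).
rewrite ler_norml; apply/andP; split.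
  by have := dist_to_lipschitz y x; rewrite distrC; lra.
by rewrite lerBlDr (le_trans (dist_to_lipschitz x y))// lerD2r.
Unshelve. all: by end_near. Qed.

Lemma dist_to_gt0 x : open (~` A) -> ~ A x -> 0 < dist_to x.
Proof.
move=> oA nAx; have /nbhs_ballP[e/= e0 eA] : nbhs x (~` A).
  exact: open_nbhs_nbhs.
rewrite (lt_le_trans e0)//; apply: lb_le_inf; first by case: (dist_to_has_inf x).
move=> _ [a Aa <-]; rewrite leNgt; apply/negP => xa; apply: (eA a) => //.
by rewrite -ball_normE.
Qed.

End distance.

Section riesz_representation.
Variables (R : realType) (d : nat) (Omega : set 'rV[R]_d).
Hypothesis cOmega : compact Omega.
Local Notation Rd := 'rV[R]_d.

(** Positive functionals are treated on this cone only, since [positive_part] below is additive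
    there and not on all continuous functions. *)
Definition continuous_ge0 (f : Rd -> R) :=
  {within Omega, continuous f} /\ forall x, Omega x -> 0 <= f x.

Lemma continuous_ge0D f g : continuous_ge0 f -> continuous_ge0 g ->
  continuous_ge0 (f \+ g).
Proof.
move=> [cf f0] [cg g0]; split; first exact: within_add.
by move=> x Ox; rewrite addr_ge0 ?f0 ?g0.
Qed.

Lemma continuous_ge0M f g : continuous_ge0 f -> continuous_ge0 g ->
  continuous_ge0 (f \* g).
Proof.
move=> [cf f0] [cg g0]; split; first exact: within_mul.
by move=> x Ox; rewrite mulr_ge0 ?f0 ?g0.
Qed.

Lemma continuous_ge0_cst (c : R) : 0 <= c -> continuous_ge0 (fun=> c).
Proof. by move=> c0; split => //; exact: within_cst. Qed.

Section positive_functional.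
Variable Lam : (Rd -> R) -> R.
Hypotheses (LamD : forall f g, continuous_ge0 f -> continuous_ge0 g ->
    Lam (f \+ g) = Lam f + Lam g)
  (LamZ : forall (a : R) f, 0 <= a -> continuous_ge0 f ->
    Lam (fun x => a * f x) = a * Lam f)
  (Lam_ge0 : forall f, continuous_ge0 f -> 0 <= Lam f).

Lemma le_functional f g : continuous_ge0 f -> continuous_ge0 g ->
  (forall x, Omega x -> f x <= g x) -> Lam f <= Lam g.
Proof.
move=> Cf Cg fg; have Cgf : continuous_ge0 (g \- f).
  split; first by apply: within_sub; [case: Cg|case: Cf].
  by move=> x Ox; rewrite subr_ge0 fg.
have -> : g = f \+ (g \- f) by apply/funext => x /=; rewrite addrC subrK.
by rewrite LamD// lerDl Lam_ge0.
Qed.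

(* The increasing sequence [g] stands for the lower semicontinuous function
   [sup_N g N], on which [Lam] takes the value [sup_N Lam (g N)]. *)
Definition covered (A : set Rd) (c : R) :=
  exists g : nat -> Rd -> R, [/\ forall N, continuous_ge0 (g N),
    forall N x, Omega x -> g N x <= g N.+1 x, forall N, Lam (g N) <= c &
    forall x, Omega x -> A x -> exists N, 1 <= g N x].

(** Daniell's upper integral of the indicator function of [A]. *)
Definition outer_content (A : set Rd) : R := inf [set c | covered A c].

Lemma covered_const A f : continuous_ge0 f ->
  (forall x, Omega x -> A x -> 1 <= f x) -> covered A (Lam f).
Proof. by move=> Cf f1; exists (fun=> f); split => // x Ox Ax; exists 0%N; exact: f1. Qed.

Lemma covered_ge0 A c : covered A c -> 0 <= c.
Proof. by move=> [g [Cg _ gc _]]; rewrite (le_trans _ (gc 0%N))// Lam_ge0. Qed.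

Lemma outer_content_has_inf A : has_inf [set c | covered A c].
Proof.
split; last by exists 0 => c; exact: covered_ge0.
by exists (Lam (fun=> 1)); apply: covered_const => //; exact: continuous_ge0_cst.
Qed.

Lemma outer_content_le A c : covered A c -> outer_content A <= c.
Proof. by move=> Ac; apply: ge_inf => //; have [] := outer_content_has_inf A. Qed.

Lemma outer_content_ge A c : (forall c', covered A c' -> c <= c') -> c <= outer_content A.
Proof. by move=> Ac; apply: lb_le_inf => //; have [] := outer_content_has_inf A. Qed.

Lemma outer_content_lt A e : 0 < e -> exists2 c, covered A c & c < outer_content A + e.
Proof. by move=> e0; apply: inf_adherent => //; exact: outer_content_has_inf. Qed.

Lemma nd_cover (g : nat -> Rd -> R) x (M N : nat) :
  (forall N x, Omega x -> g N x <= g N.+1 x) ->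
  Omega x -> (M <= N)%N -> g M x <= g N x.
Proof.
move=> g_nd Ox; elim: N => [|N IH]; first by rewrite leqn0 => /eqP ->.
rewrite leq_eqVlt => /predU1P[->//|/IH] /le_trans; apply; exact: g_nd.
Qed.

Lemma outer_content0 (A : set Rd) : A `&` Omega = set0 -> outer_content A = 0.
Proof.
move=> AO; apply/eqP; rewrite eq_le; apply/andP; split; last first.
  by apply: outer_content_ge => c; exact: covered_ge0.
have C0 := continuous_ge0_cst (lexx 0).
rewrite -[0](_ : Lam (fun=> 0) = 0); last first.
  by have := LamZ (lexx 0) C0; rewrite !mul0r.
apply: outer_content_le; apply: covered_const => // x Ox Ax.
by have : (A `&` Omega) x by []; rewrite AO.
Qed.

Lemma covered_subset A B c : A `<=` B -> covered B c -> covered A c.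
Proof. by move=> AB [g [Cg g_nd gc g1]]; exists g; split => // x Ox /AB; exact: g1. Qed.

Lemma functional_sum (f : nat -> Rd -> R) N : (forall k, continuous_ge0 (f k)) ->
  continuous_ge0 (fun x => \sum_(k < N) f k x) /\
  Lam (fun x => \sum_(k < N) f k x) = \sum_(k < N) Lam (f k).
Proof.
move=> Cf; elim: N => [|N [IH1 IH2]].
  have E : (fun x => \sum_(k < 0) f k x) = fun=> 0 by apply/funext => x; rewrite big_ord0.
  rewrite E big_ord0; split; first exact: continuous_ge0_cst.
  have := LamZ (lexx 0) (continuous_ge0_cst (lexx 0)).
  by rewrite !mul0r.
have E : (fun x => \sum_(k < N.+1) f k x) = (fun x => \sum_(k < N) f k x) \+ f N.
  by apply/funext => x; rewrite big_ord_recr.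
by rewrite E big_ord_recr/= LamD// IH2; split => //; exact: continuous_ge0D.
Qed.

(** Covers of the [F k], each optimal up to [e / 2 ^ k.+1], are added; countably many increasing
    sequences have to be merged into one. *)
Lemma outer_content_subadditive (F : (set Rd)^nat) :
  ((outer_content (\bigcup_n F n))%:E <= \sum_(i <oo) (outer_content (F i))%:E)%E.
Proof.
have oc0 A : 0 <= outer_content A by apply: outer_content_ge => c; exact: covered_ge0.
set S := (X in (_ <= X)%E).
have S0 : (0 <= S)%E by apply: nneseries_ge0 => i _ _; rewrite lee_fin.
have [Sfin|] := boolP (S \is a fin_num); last first.
  by rewrite ge0_fin_numE// -leNgt leye_eq => /eqP ->; rewrite leey.
rewrite -(fineK Sfin) lee_fin; apply/ler_addgt0Pr => e e0.
have ek k : 0 < e / (2 ^ k.+1)%:R by rewrite divr_gt0// ltr0n expn_gt0.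
have /choice[c cP] k : exists c, covered (F k) c /\ c <= outer_content (F k) + e / (2 ^ k.+1)%:R.
  by have [c ? ?] := outer_content_lt (F k) (ek k); exists c; split => //; exact: ltW.
have /choice[g gP] k : exists g : nat -> Rd -> R, [/\ forall N, continuous_ge0 (g N),
    forall N x, Omega x -> g N x <= g N.+1 x, forall N, Lam (g N) <= c k &
    forall x, Omega x -> F k x -> exists N, 1 <= g N x].
  by have [[g ?] _] := cP k; exists g.
(* Diagonal choice: stage [N] uses the first [N] covers, each at its own stage [N]. The result still
   increases, and finite additivity of [Lam] suffices. *)
apply: outer_content_le; exists (fun N x => \sum_(k < N) g k N x); split.
- by move=> N; apply: (functional_sum (f := fun k => g k N) N _).1 => k; have [] := gP k.
- move=> N x Ox; rewrite big_ord_recr/= -[leLHS]addr0 lerD//.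
    by apply: ler_sum => k _; have [_ + _ _] := gP k; exact.
  by have [/(_ N.+1)[_ +] _ _ _] := gP N; exact.
- move=> N; rewrite (functional_sum (f := fun k => g k N) N _).2; last first.
    by move=> k; have [] := gP k.
  rewrite (@le_trans _ _ (\sum_(k < N) (outer_content (F k) + e / (2 ^ k.+1)%:R)))//.
    apply: ler_sum => k _; have [_ _ /(_ N) + _] := gP k.
    by move=> /le_trans; apply; have [] := cP k.
  rewrite -lee_fin EFinD (fineK Sfin) (le_trans _ (epsilon_trick _ _ (ltW e0)))//; last first.
    by move=> k; rewrite lee_fin.
  rewrite -sumEFin; under eq_bigr do rewrite EFinD.
  rewrite -(big_mkord xpredT (fun k => (outer_content (F k))%:E + (e / (2 ^ k.+1)%:R)%:E)%E).
  apply: nneseries_lim_ge => k _ _.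
  by rewrite -EFinD lee_fin addr_ge0// ltW.
- move=> x Ox [k _ Fx]; have [Cg g_nd _ /(_ x Ox Fx)[N g1]] := gP k.
  (* Stage [N] makes the [k]-th function at least 1, and stage [k.+1] brings it into the sum. *)
  exists (maxn N k.+1); rewrite (bigD1 (Ordinal (leq_maxr N k.+1)))//= -[1]addr0 lerD//.
    by rewrite (le_trans g1)//; apply: nd_cover => //; exact: leq_maxl.
  by apply: sumr_ge0 => j _; have [/(_ (maxn N k.+1))[_ +] _ _ _] := gP j; exact.
Qed.

(* A cover [g] of [X] splits into the covers [g N * chi N] of [X `&` U] and
   [g N * (1 - chi M)] of [X `\` U], where [chi N] increases to the indicator
   function of [U]. *)
Lemma open_outer_content_split (U X : set Rd) : open U ->
  outer_content (X `&` U) + outer_content (X `&` ~` U) <= outer_content X.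
Proof.
(* The distance to the complement makes sense only if the complement is nonempty. *)
move=> oU; have [CU0|/set0P CU0] := eqVneq (~` U) set0.
  rewrite CU0 setI0 (outer_content0 (set0I _)) addr0.
  by apply: outer_content_ge => c /(covered_subset (@subIsetl _ X U))/outer_content_le.
pose chi (N : nat) x := Num.min 1 (N%:R * dist_to (~` U) x).
have Cchi N : continuous_ge0 (chi N).
  split; last by move=> x _; rewrite le_min ler01/= mulr_ge0// dist_to_ge0.
  apply: within_min; first exact: within_cst.
  apply: within_mul; first exact: within_cst.
  by apply: continuous_subspaceT; exact: dist_to_continuous.
have chi1 N x : chi N x <= 1 by rewrite ge_min lexx.
have Cchi' N : continuous_ge0 ((fun=> 1) \- chi N).
  split; last by move=> x _; rewrite subr_ge0.
  by apply: within_sub; [exact: within_cst|case: (Cchi N)].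
have chi_nd N x : chi N x <= chi N.+1 x.
  rewrite le_min chi1/= ge_min; apply/orP; right.
  by rewrite ler_wpM2r ?dist_to_ge0// ler_nat.
have chiU N x : ~ U x -> chi N x = 0.
  move=> nUx; have d0 : dist_to (~` U) x = 0.
    apply/eqP; rewrite eq_le dist_to_ge0// andbT.
    by rewrite (le_trans (dist_to_le CU0 x nUx))// subrr normr0.
  by rewrite /chi d0 mulr0 min_r.
have chi_ev x : U x -> exists N, forall M, (N <= M)%N -> chi M x = 1.
  move=> Ux; have dx0 : 0 < dist_to (~` U) x.
    by apply: dist_to_gt0 => //; rewrite setCK.
  exists (Num.trunc (dist_to (~` U) x)^-1).+1 => M NM; rewrite /chi min_l//.
  rewrite -ler_pdivrMr// mul1r (le_trans (ltW (truncnS_gt _)))//.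
  by rewrite ler_nat.
apply: outer_content_ge => c [g [Cg g_nd gc g1]].
(* With [chi N] frozen, [g] goes on increasing and covers the part outside [U], where [chi N]
   vanishes. Starting at stage [N] reserves [Lam (g N \* chi N)] of the budget [c] for the part
   inside. *)
have split_le N : Lam (g N \* chi N) + outer_content (X `&` ~` U) <= c.
  rewrite -lerBrDl; apply: outer_content_le.
  exists (fun N' => g (maxn N N') \* ((fun=> 1) \- chi N)); split.
  - by move=> N'; exact: continuous_ge0M.
  - move=> N' x Ox /=; rewrite ler_wpM2r ?subr_ge0//.
    by apply: nd_cover => //; rewrite geq_max leq_maxl/= (leq_trans (leqnSn _))// leq_maxr.
  - move=> N'; rewrite lerBrDl.
    apply: (@le_trans _ _ (Lam (g (maxn N N') \* chi N) +
        Lam (g (maxn N N') \* ((fun=> 1) \- chi N)))).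
      rewrite lerD2r le_functional//; [exact: continuous_ge0M..|].
      move=> x Ox /=; rewrite ler_wpM2r//; first by have [_ ->] := Cchi N.
      by apply: nd_cover => //; exact: leq_maxl.
    rewrite -LamD; [|exact: continuous_ge0M..].
    rewrite (_ : _ \+ _ = g (maxn N N'))//.
    by apply/funext => x /=; rewrite -mulrDr addrC subrK mulr1.
  - move=> x Ox [Xx nUx]; have [N' gN'] := g1 x Ox Xx; exists N' => /=.
    rewrite chiU// subr0 mulr1 (le_trans gN')//; apply: nd_cover => //.
    exact: leq_maxr.
rewrite -lerBrDr; apply: outer_content_le.
exists (fun N => g N \* chi N); split.
- by move=> N; exact: continuous_ge0M.
- move=> N x Ox /=; apply: ler_pM => //; last exact: g_nd.
    by have [_ ->] := Cg N.
  by have [_ ->] := Cchi N.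
- by move=> N; rewrite lerBrDr.
- move=> x Ox [Xx Ux]; have [N gN] := g1 x Ox Xx.
  have [M chiM] := chi_ev x Ux; exists (maxn N M) => /=.
  rewrite chiM ?leq_maxr// mulr1 (le_trans gN)//.
  by apply: nd_cover => //; exact: leq_maxl.
Qed.

(** A Dini argument proves the nontrivial inequality: the functions of a cover increase and reach 1
    at each point, so by compactness one of them is at least [1 - e] on all of [Omega]. *)
Lemma outer_content_Omega : outer_content Omega = Lam (fun=> 1).
Proof.
have C1 : continuous_ge0 (fun=> 1) by exact: continuous_ge0_cst.
apply/eqP; rewrite eq_le; apply/andP; split.
  by apply: outer_content_le; exact: covered_const.
apply: outer_content_ge => c [g [Cg g_nd gc g1]].
suff key e : 0 < e -> e < 1 -> (1 - e) * Lam (fun=> 1) <= c.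
  apply/ler_addgt0Pr => e e0.
  have L0 : 0 <= Lam (fun=> 1) by exact: Lam_ge0.
  pose r := Num.min (2^-1) (e / (Lam (fun=> 1) + 1)).
  have r0 : 0 < r by rewrite lt_min invr_gt0 ltr0n/= divr_gt0// ltr_wpDl.
  have r1 : r < 1 by rewrite gt_min invf_lt1 ?ltr1n.
  have rL : r * Lam (fun=> 1) <= e.
    rewrite (@le_trans _ _ (r * (Lam (fun=> 1) + 1)))//.
      by rewrite ler_pM2l// lerDl.
    by rewrite -ler_pdivlMr ?ltr_wpDl// ge_min lexx orbT.
  have := key _ r0 r1; rewrite mulrBl mul1r; lra.
move=> e0 e1; suff [N gN] : exists N, forall x, Omega x -> 1 - e <= g N x.
  rewrite (le_trans _ (gc N))// -LamZ ?subr_ge0 ?(ltW e1)//.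
  apply: le_functional => //; last by move=> x Ox; rewrite mulr1; exact: gN.
  by apply: continuous_ge0M => //; apply: continuous_ge0_cst; rewrite subr_ge0 ltW.
(* Otherwise points [y N] with [g N (y N) < 1 - e] cluster at some [x]. A stage [M] with
   [1 <= g M x] exceeds [1 - e] near [x], against monotonicity at a later [y N] close to [x]. *)
apply: contrapT => /forallNP nN.
have /choice[y yP] N : exists x, Omega x /\ g N x < 1 - e.
  have /existsNP[x /not_implyP[Ox /negP]] := nN N.
  by rewrite -ltNge => gx; exists x.
have [|x [Ox clx]] := cOmega (F := y @ \oo) _.
  by exists 0%N => // k _ /=; have [] := yP k.
have [M gM] := g1 x Ox Ox.
have [cgM _] := Cg M.
have [r r0 rg] := (within_continuousP _ _).1 cgM x Ox _ e0.
have Fy : (y @ \oo) [set y N | N in [set N | (M <= N)%N]].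
  by exists M => // k /= Mk; exists k.
have [_ [[N /= MN <-]]] := clx _ _ Fy (nbhsx_ballx x r r0).
rewrite -ball_normE/= => /(rg _ (yP N).1).
have := nd_cover g_nd (yP N).1 MN; have := (yP N).2.
by rewrite ltr_norml => ? ? /andP[]; lra.
Qed.

(** The measure is the Caratheodory restriction of [outer_content]. The integral is at most [Lam] by
    slicing [f] into layers; applied to [M - f], this gives the converse, because
    [outer_content_Omega] makes constants exact. *)
Theorem riesz_positive : exists m : {measure set Rd -> \bar R},
  [/\ (m setT < +oo)%E,
    forall A, measurable A -> A `&` Omega = set0 -> m A = 0%E &
    forall f, continuous_ge0 f -> \int[m]_(x in Omega) f x = Lam f].
Proof.
have oc0 A : 0 <= outer_content A by apply: outer_content_ge => c; exact: covered_ge0.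
pose phi (A : set Rd) : \bar R := (outer_content A)%:E.
have phi0 : phi set0 = 0%E by rewrite /phi outer_content0// set0I.
have phi_ge0 A : (0 <= phi A)%E by rewrite lee_fin.
have phi_le : {homo phi : A B / A `<=` B >-> (A <= B)%E}.
  move=> A B AB; rewrite lee_fin; apply: outer_content_ge => c Bc.
  by apply: outer_content_le; exact: covered_subset Bc.
pose phi_mixin := isOuterMeasure.Build R Rd phi phi0 phi_ge0 phi_le
  outer_content_subadditive.
pose mu : {outer_measure set Rd -> \bar R} := HB.pack phi phi_mixin.
(* Open sets are Caratheodory measurable, so pushing forward along the identity restricts the
   measure to Borel sets. *)
have mid : measurable_fun [set: caratheodory_type mu]
    (id : caratheodory_type mu -> Rd).
  apply: (@measurability _ _ _ _ _ _ (@open Rd)) => //.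
  move=> _ [U oU <-]; rewrite setTI; apply: le_caratheodory_measurable => X.
  by rewrite /= /phi -EFinD lee_fin; exact: open_outer_content_split.
pose m : {measure set Rd -> \bar R} :=
  measure_function_pushforward__canonical__measure_function_Measure
    (mu : set (caratheodory_type mu) -> \bar R) mid.
have mE A : m A = (outer_content A)%:E by [].
have mO := compact_measurable_rV cOmega.
have moo A : (m A < +oo)%E by rewrite mE ltry.
have bint f : {within Omega, continuous f} -> m.-integrable Omega (EFin \o f).
  move=> cf; apply: measurable_bounded_integrable => //.
    exact: within_continuous_measurable_rV.
  have [M M0 fM] := within_continuous_bounded cOmega cf.
  exists M; split; rewrite ?num_real// => r Mr x Ox /=.
  exact: le_trans (fM _ Ox) (ltW Mr).
have upper f : continuous_ge0 f -> \int[m]_(x in Omega) f x <= Lam f.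
  move=> [cf f0]; apply/ler_addgt0Pr => e e0.
  have L0 : 0 <= Lam (fun=> 1) by apply: Lam_ge0; exact: continuous_ge0_cst.
  pose r := e / (Lam (fun=> 1) + 1).
  have r0 : 0 < r by rewrite divr_gt0// ltr_wpDl.
  have [M M0 fM] := within_continuous_bounded cOmega cf.
  pose K := (Num.trunc (M / r)).+1.
  have fK x : Omega x -> f x <= K%:R * r.
    move=> Ox; rewrite (le_trans (ler_norm _))// (le_trans (fM _ Ox))//.
    by rewrite -ler_pdivrMr// ltW// truncnS_gt.
  (* Layers of height [r]. The increment [t j.+1 \- t j] equals [r] on [A j], so its [Lam] bounds
     [r * m (A j)]; these [Lam] values add up to at most [Lam f]. Conversely [f] is at most [r] plus
     the sum of [r * \1_(A j)], and the extra [r] costs [r * Lam 1 <= e]. *)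
  pose t (j : nat) x := Num.min (f x) (j%:R * r).
  have Ct j : continuous_ge0 (t j).
    split; first by apply: within_min => //; exact: within_cst.
    by move=> x Ox; rewrite le_min f0//= mulr_ge0// ltW.
  have t_nd j x : t j x <= t j.+1 x.
    by rewrite le_min !ge_min lexx/=; apply/orP; right; rewrite ler_wpM2r ?ler_nat// ltW.
  have Cdt j : continuous_ge0 (t j.+1 \- t j).
    split; first by apply: within_sub; [case: (Ct j.+1)|case: (Ct j)].
    by move=> x _; rewrite subr_ge0.
  pose A j := Omega `&` [set x | j.+1%:R * r <= f x].
  have mA j : measurable (A j).
    rewrite (_ : A j = Omega `&` f @^-1` `[j.+1%:R * r, +oo[%classic); last first.
      by apply/seteqP; split => x [Ox /=]; rewrite in_itv/= andbT.
    exact: (within_continuous_measurable_rV mO cf).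
  have step x k : Omega x ->
      t k.+1 x <= r + \sum_(j < k) r * \1_(A j) x.
    move=> Ox; elim: k => [|k IH].
      by rewrite big_ord0 addr0 /t ge_min mul1r lexx orbT.
    rewrite big_ord_recr/= addrA; have [kf|kf] := leP (k.+1%:R * r) (f x).
      rewrite indicE mem_set//= mulr1 (le_trans _ (lerD IH (lexx r)))//.
      rewrite /t (min_r kf) (@le_trans _ _ (k.+2%:R * r)) ?ge_min ?lexx ?orbT//.
      by rewrite -[k.+2%:R]natr1 mulrDl mul1r.
    rewrite (le_trans _ (le_trans IH _))//.
      by rewrite /t (min_l (ltW kf)) ge_min lexx.
    by rewrite lerDl mulr_ge0 ?indicE// ltW.
  have mAle j : r * fine (m (A j)) <= Lam (t j.+1 \- t j).
    suff : outer_content (A j) <= Lam (fun x => r^-1 * (t j.+1 \- t j) x).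
      by rewrite LamZ ?invr_ge0 ?(ltW r0)// ler_pdivlMl// mE.
    apply: outer_content_le; apply: covered_const.
      by apply: continuous_ge0M => //; apply: continuous_ge0_cst; rewrite invr_ge0 ltW.
    move=> x Ox [_ /= fx]; rewrite /t (min_r fx) min_r; last first.
      by rewrite (le_trans _ fx)// ler_wpM2r ?ler_nat// ltW.
    by rewrite -mulrBl -natrB// subSnn mul1r mulVf// gt_eqF.
  have LtK k : \sum_(j < k) Lam (t j.+1 \- t j) <= Lam (t k).
    elim: k => [|k IH]; first by rewrite big_ord0 Lam_ge0.
    rewrite big_ord_recr/= (le_trans (lerD IH (lexx _)))// -LamD//.
    by rewrite (_ : _ \+ _ = t k.+1)//; apply/funext => x /=; rewrite addrC subrK.
  have tK : Lam (t K) = Lam f.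
    apply/eqP; rewrite eq_le; apply/andP; split; apply: le_functional => // x Ox.
      by rewrite ge_min lexx.
    by rewrite le_min lexx fK.
  apply: (@le_trans _ _ (r * Lam (fun=> 1) + Lam f)); last first.
    rewrite addrC lerD2l (@le_trans _ _ (r * (Lam (fun=> 1) + 1)))//.
      by rewrite ler_pM2l// lerDl.
    by rewrite divfK// gt_eqF// ltr_wpDl.
  have mAr j : measurable_fun Omega (fun x => (r * \1_(A j) x)%:E).
    by apply/measurable_EFinP; apply: measurable_funM => //; exact: measurable_indic.
  have int_le : (\int[m]_(x in Omega) (f x)%:E <=
      \int[m]_(x in Omega) (r%:E + \sum_(j < K) (r * \1_(A j) x)%:E))%E.
    apply: ge0_le_integral => //.
    - by apply/measurable_EFinP; exact: within_continuous_measurable_rV.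
    - apply: emeasurable_funD => //; exact: emeasurable_sum.
    - move=> x Ox; rewrite sumEFin -EFinD lee_fin.
      apply: le_trans (step x K Ox).
      rewrite le_min lexx/= (le_trans (fK _ Ox))// ler_wpM2r ?ler_nat//.
      exact: ltW.
  rewrite -lee_fin /Rintegral fineK; last first.
    by apply: integrable_fin_num => //; exact: bint.
  rewrite (le_trans int_le)// ge0_integralD//; last 3 first.
  - by move=> x _; rewrite lee_fin ltW.
  - by move=> x _; apply: sume_ge0 => j _; rewrite lee_fin mulr_ge0 ?indicE// ltW.
  - exact: emeasurable_sum.
  rewrite integral_cst// mE outer_content_Omega EFinD -EFinM leeD2l//.
  rewrite ge0_integral_sum//; last first.
    by move=> j x _; rewrite lee_fin mulr_ge0 ?indicE// ltW.
  rewrite -tK (le_trans _ (_ : (\sum_(j < K) Lam (t j.+1 \- t j))%:E <= _)%E) ?lee_fin//.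
  rewrite -sumEFin; apply: lee_sum => j _.
  rewrite (_ : \int[m]_(x in Omega) _ = (r * fine (m (A j)))%:E)%E ?lee_fin//.
  under eq_integral do rewrite EFinM.
  rewrite ge0_integralZl//; last 2 first.
  - by apply/measurable_EFinP; exact: measurable_indic.
  - by rewrite lee_fin ltW.
  rewrite integral_indic// (_ : A j `&` Omega = A j) ?mE -?EFinM//.
  by apply/setIidPl => x [].
exists m; split => //.
  by move=> A mA AO; rewrite mE outer_content0.
move=> f [cf f0]; apply/eqP; rewrite eq_le upper//=.
have [M M0 fM] := within_continuous_bounded cOmega cf.
have CM : continuous_ge0 (fun=> M) by exact: continuous_ge0_cst.
have CMf : continuous_ge0 ((fun=> M) \- f).
  split; first by apply: within_sub => //; exact: within_cst.
  by move=> x Ox; rewrite subr_ge0 (le_trans (ler_norm _))// fM.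
have LM : Lam (fun=> M) = Lam f + Lam ((fun=> M) \- f).
  rewrite -LamD//; congr Lam; apply/funext => x /=.
  by rewrite addrC subrK.
have LM1 : Lam (fun=> M) = M * Lam (fun=> 1).
  by rewrite -LamZ//; [congr Lam; apply/funext => x; rewrite mulr1|exact: continuous_ge0_cst].
have := upper _ CMf; rewrite RintegralB//; [|apply: bint; exact: within_cst|exact: bint].
rewrite Rintegral_cst// mE outer_content_Omega/=; lra.
Qed.

End positive_functional.

Section bounded_functional.
Variables (L : (Rd -> R) -> R) (W : R).
Hypotheses (LD : forall f g, {within Omega, continuous f} -> {within Omega, continuous g} ->
    L (f \+ g) = L f + L g)
  (LZ : forall (a : R) f, {within Omega, continuous f} ->
    L (fun x => a * f x) = a * L f)
  (LW : forall f c, {within Omega, continuous f} ->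
    (forall x, Omega x -> `|f x| <= c) -> L f <= W * c).

(** The Riesz-Kantorovich formula for the positive part of [L] in the order dual. *)
Definition positive_part (f : Rd -> R) : R :=
  sup [set L g | g in [set g | continuous_ge0 g /\ forall x, Omega x -> g x <= f x]].

Lemma positive_part_has_sup f : continuous_ge0 f ->
  has_sup [set L g | g in [set g | continuous_ge0 g /\ forall x, Omega x -> g x <= f x]].
Proof.
move=> [cf f0]; split; first by exists (L f), f.
have [M M0 fM] := within_continuous_bounded cOmega cf.
exists (W * M) => _ [g [[cg g0] gf] <-]; apply: LW => // x Ox.
by rewrite ger0_norm ?g0// (le_trans (gf _ Ox))// (le_trans (ler_norm _))// fM.
Qed.

Lemma positive_part_ge f g : continuous_ge0 f -> continuous_ge0 g ->
  (forall x, Omega x -> g x <= f x) -> L g <= positive_part f.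
Proof.
by move=> Cf Cg gf; apply: ub_le_sup; [case: (positive_part_has_sup Cf)|exists g].
Qed.

Lemma positive_part_le f c : continuous_ge0 f ->
  (forall g, continuous_ge0 g -> (forall x, Omega x -> g x <= f x) -> L g <= c) ->
  positive_part f <= c.
Proof.
move=> Cf H; apply: ge_sup; first by case: (positive_part_has_sup Cf).
by move=> _ [g [Cg gf] <-]; exact: H.
Qed.

Lemma positive_part_ge0 f : continuous_ge0 f -> 0 <= positive_part f.
Proof.
move=> Cf; have C0 := continuous_ge0_cst (lexx 0).
apply: le_trans (positive_part_ge Cf C0 _); last by case: Cf.
by have := LZ 0 (@within_cst R Rd Omega 0); rewrite !mul0r => ->.
Qed.

(** A competitor [h] for [f \+ g] splits into [h \min f], below [f], and the remainder, below [g].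
    The other inequality adds competitors. *)
Lemma positive_partD f g : continuous_ge0 f -> continuous_ge0 g ->
  positive_part (f \+ g) = positive_part f + positive_part g.
Proof.
move=> Cf Cg; apply/eqP; rewrite eq_le; apply/andP; split.
- apply: positive_part_le; first exact: continuous_ge0D.
  move=> h [ch h0] hfg; have [[cf f0] [cg g0]] := (Cf, Cg).
  have Cm : continuous_ge0 (h \min f).
    by split; [exact: within_min|move=> x Ox; rewrite le_min h0// f0].
  have Cd : continuous_ge0 (h \- (h \min f)).
    by split; [exact: within_sub Cm.1|move=> x Ox /=; rewrite subr_ge0 ge_min lexx].
  rewrite (_ : h = (h \min f) \+ (h \- (h \min f))); last first.
    by apply/funext => x /=; rewrite addrC subrK.
  rewrite LD; [|by case: Cm|by case: Cd].
  apply: lerD; apply: positive_part_ge => // x Ox /=.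
    by rewrite ge_min lexx orbT.
  rewrite lerBlDr -lerBlDl le_min lerBlDr lerDl g0//=.
  by rewrite lerBlDr hfg.
- rewrite -lerBrDr; apply: positive_part_le => // h Ch hf.
  rewrite lerBrDl -lerBrDr; apply: positive_part_le => // k Ck kg.
  rewrite lerBrDr -LD; [|by case: Ck|by case: Ch].
  apply: positive_part_ge; [exact: continuous_ge0D|exact: continuous_ge0D|].
  by move=> x Ox /=; rewrite addrC lerD ?hf ?kg.
Qed.

Lemma positive_partZ (a : R) f : 0 <= a -> continuous_ge0 f ->
  positive_part (fun x => a * f x) = a * positive_part f.
Proof.
move=> a0 Cf; have CZ b g : 0 <= b -> continuous_ge0 g -> continuous_ge0 (fun x => b * g x).
  by move=> b0 Cg; apply: continuous_ge0M => //; exact: continuous_ge0_cst.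
have [->|an0] := eqVneq a 0.
  rewrite mul0r; apply/eqP; rewrite eq_le positive_part_ge0 ?andbT; last exact: CZ.
  apply: positive_part_le; first exact: CZ.
  move=> g [cg g0] gf; rewrite -(mulr0 W); apply: LW => // x Ox.
  by rewrite ger0_norm ?g0// (le_trans (gf _ Ox))// mul0r.
have {an0}a0' : 0 < a by rewrite lt0r an0.
apply/eqP; rewrite eq_le; apply/andP; split.
- apply: positive_part_le; first exact: CZ.
  move=> g Cg gf; rewrite -ler_pdivrMl// -LZ; last by case: Cg.
  apply: positive_part_ge => //; first by apply: CZ => //; rewrite invr_ge0.
  by move=> x Ox; rewrite ler_pdivrMl// gf.
- rewrite -ler_pdivlMl//; apply: positive_part_le => // g Cg gf.
  rewrite ler_pdivlMl// -LZ; last by case: Cg.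
  by apply: positive_part_ge; [exact: CZ|exact: CZ|move=> x Ox; rewrite ler_pM2l// gf].
Qed.

(** [positive_part] and [positive_part - L] are both positive, and their difference is [L]. The
    representation passes from nonnegative functions to all continuous ones by adding a constant [M]
    that bounds [|f|]. *)
Theorem riesz_bounded : exists nu : {charge set Rd -> \bar R},
  (forall A, measurable A -> A `&` Omega = set0 -> nu A = 0%E) /\
  forall f, {within Omega, continuous f} -> charge_integral nu Omega f = L f.
Proof.
have [m1 [m1T m10 m1E]] := riesz_positive positive_partD positive_partZ positive_part_ge0.
have [||f Cf|m2 [m2T m20 m2E]] := riesz_positive (Lam := fun f => positive_part f - L f).
- move=> f g Cf Cg; rewrite positive_partD// LD; [ring|by case: Cf|by case: Cg].
- by move=> a f a0 Cf; rewrite positive_partZ// LZ; [ring|case: Cf].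
- by rewrite subr_ge0; exact: positive_part_ge.
pose n1 := charge_of_finite_measure (mfrestr measurableT m1T).
pose n2 := charge_of_finite_measure (mfrestr measurableT m2T).
have n1E A : n1 A = m1 A by rewrite /n1 /charge_of_finite_measure /= /mfrestr /mrestr setIT.
have n2E A : n2 A = m2 A by rewrite /n2 /charge_of_finite_measure /= /mfrestr /mrestr setIT.
have nE A : cadd n1 (copp n2) A = (m1 A - m2 A)%E by rewrite -n1E -n2E.
exists (cadd n1 (copp n2)); split.
  by move=> A mA AO; rewrite [LHS]nE m10// m20// sube0.
move=> f cf; have [M M0 fM] := within_continuous_bounded cOmega cf.
have mO := compact_measurable_rV cOmega.
rewrite (@charge_integralE _ _ _ _ m1 m2 _ _ M)//; last 2 first.
  exact: (within_continuous_measurable_rV mO cf).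
  by move=> A _; exact: nE.
have CfM : continuous_ge0 (f \+ (fun=> M)).
  split; first by apply: within_add => //; exact: within_cst.
  by move=> x Ox /=; have := fM x Ox; rewrite ler_norml => /andP[]; lra.
have CM : continuous_ge0 (fun=> M) by exact: continuous_ge0_cst.
have bint (m : {measure set Rd -> \bar R}) g : (m setT < +oo)%E ->
    {within Omega, continuous g} -> m.-integrable Omega (EFin \o g).
  move=> mT cg; apply: measurable_bounded_integrable => //.
  - by rewrite (le_lt_trans _ mT)// le_measure ?inE.
  - exact: within_continuous_measurable_rV.
  have [N N0 gN] := within_continuous_bounded cOmega cg.
  exists N; split; rewrite ?num_real// => r Nr x Ox /=.
  exact: le_trans (gN _ Ox) (ltW Nr).
have E (m : {measure set Rd -> \bar R}) : (m setT < +oo)%E ->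
    \int[m]_(x in Omega) f x =
    \int[m]_(x in Omega) (f \+ (fun=> M)) x - \int[m]_(x in Omega) (fun=> M) x.
  move=> mT; rewrite -RintegralB//; [|by apply: bint => //; case: CfM|by apply: bint => //; case: CM].
  by apply: eq_Rintegral => x _ /=; rewrite addrK.
rewrite !E// m1E// m1E// m2E// m2E// LD; [ring|by []|by case: CM].
Qed.

End bounded_functional.
End riesz_representation.

(** * Continuous functions with Euclidean values *)

Section dot_product.
Variables (R : realType) (V : normedModType R) (dot : {dot V for idfun}).
Implicit Types (u v w : V) (a b : R).

Lemma dotC u v : dot u v = dot v u.
Proof. by rewrite hermC expr0 mul1r. Qed.

Lemma dotDl u v w : dot (u + v) w = dot u w + dot v w.
Proof. exact: linearDl. Qed.

Lemma dotBl u v w : dot (u - v) w = dot u w - dot v w.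
Proof. exact: linearBl. Qed.

Lemma dotZl a u v : dot (a *: u) v = a * dot u v.
Proof. exact: linearZl_LR. Qed.

Lemma dot0l v : dot 0 v = 0.
Proof. exact: linear0l. Qed.

Lemma dotDr u v w : dot u (v + w) = dot u v + dot u w.
Proof. by rewrite !(dotC u) dotDl. Qed.

Lemma dotBr u v w : dot u (v - w) = dot u v - dot u w.
Proof. by rewrite !(dotC u) dotBl. Qed.

Lemma dotZr a u v : dot u (a *: v) = a * dot u v.
Proof. by rewrite !(dotC u) dotZl. Qed.

Lemma dot_suml I (r : seq I) (P : pred I) (f : I -> V) v :
  dot (\sum_(i <- r | P i) f i) v = \sum_(i <- r | P i) dot (f i) v.
Proof.
elim/big_rec2 : _ => [|i x y _ <-]; first by rewrite dot0l.
by rewrite dotDl.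
Qed.

Lemma dot_sumr I (r : seq I) (P : pred I) (f : I -> V) v :
  dot v (\sum_(i <- r | P i) f i) = \sum_(i <- r | P i) dot v (f i).
Proof. by rewrite dotC dot_suml; under eq_bigr do rewrite dotC. Qed.

(** The common core of the Cauchy-Schwarz inequalities for [dot] and [vdot]. *)
Lemma discriminant_le (x y z : R) : 0 <= x -> 0 <= z ->
  (forall t, 0 <= x - 2 * t * y + t ^+ 2 * z) -> y <= Num.sqrt x * Num.sqrt z.
Proof.
move=> x0 z0 H; rewrite -sqrtrM// (le_trans (ler_norm y))// -sqrtr_sqr ler_wsqrtr//.
have [z0'|zn0] := eqVneq z 0.
  have [->|y0] := eqVneq y 0; first by rewrite expr0n/= mulr_ge0.
  (* For [z = 0] the expression is affine in [t], and this [t] gives it the value -1. *)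
  have := H ((x + 1) / (2 * y)); rewrite z0' mulr0 addr0.
  have -> : 2 * ((x + 1) / (2 * y)) * y = x + 1 by field.
  lra.
have zp : 0 < z by rewrite lt0r zn0.
have := H (y / z).
have -> : x - 2 * (y / z) * y + (y / z) ^+ 2 * z = x - y ^+ 2 / z by field.
by rewrite subr_ge0 ler_pdivrMr.
Qed.

Hypothesis hn : norm_of_dot dot.

Lemma dot_normsq v : dot v v = `|v| ^+ 2.
Proof. by rewrite hn. Qed.

Lemma dot_abs_le u v : `|dot u v| <= `|u| ^+ 2 + `|v| ^+ 2.
Proof.
have := sqr_ge0 `|u - v|; have := sqr_ge0 `|u + v|.
have := sqr_ge0 `|u|; have := sqr_ge0 `|v|.
rewrite -!dot_normsq dotBl dotDl !dotBr !dotDr (dotC v u) => *.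
by rewrite ler_norml; apply/andP; split; lra.
Qed.

Lemma dot_cauchy u v : dot u v <= `|u| * `|v|.
Proof.
have := @discriminant_le (`|u| ^+ 2) (dot u v) (`|v| ^+ 2).
rewrite !sqrtr_sqr !normr_id; apply; rewrite ?sqr_ge0// => t.
have := sqr_ge0 `|u - t *: v|.
rewrite -!dot_normsq dotBl !dotBr !dotZl !dotZr (dotC v u); lra.
Qed.

Variables (n : nat) (e : 'I_n -> V).
Hypothesis he : orthonormal_basis dot e.

Lemma basis_expand v : v = \sum_i dot v (e i) *: e i.
Proof. by case: he. Qed.

Lemma dot_basis u v : dot u v = \sum_i dot u (e i) * dot v (e i).
Proof.
rewrite {1}(basis_expand v) dot_sumr; apply: eq_bigr => i _.
by rewrite dotZr mulrC.
Qed.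

Lemma dot_basis_comb (c : 'I_n -> R) i : dot (\sum_j c j *: e j) (e i) = c i.
Proof.
have [eij _] := he; rewrite dot_suml (bigD1 i)//= dotZl eij eqxx mulr1.
by rewrite big1 ?addr0// => j /negbTE ji; rewrite dotZl eij ji mulr0.
Qed.

Lemma norm_basis i : `|e i| = 1.
Proof.
apply/eqP; rewrite -(@eqrXn2 _ 2)// expr1n -dot_normsq.
by have [-> _] := he; rewrite eqxx.
Qed.

Lemma coef_le_norm v i : `|dot v (e i)| <= `|v|.
Proof.
have := dot_cauchy v (e i); have := dot_cauchy (- v) (e i).
rewrite -scaleN1r dotZl mulN1r scaleN1r normrN norm_basis mulr1 => *.
by rewrite ler_norml; apply/andP; split; lra.
Qed.

Lemma norm_le_coef v (c : R) : (forall i, `|dot v (e i)| <= c) -> `|v| <= n%:R * c.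
Proof.
move=> vc; rewrite (basis_expand v) (le_trans (ler_norm_sum _ _ _))//.
rewrite (@le_trans _ _ (\sum_(i < n) c))//.
  by apply: ler_sum => i _; rewrite normrZ norm_basis mulr1.
by rewrite sumr_const card_ord mulr_natl.
Qed.

Section vector_fields.
Variable d : nat.
Implicit Types (x y : 'I_d -> V).

Lemma vdot_ge0 x : 0 <= vdot dot x x.
Proof. by apply: sumr_ge0 => l _; rewrite dot_normsq sqr_ge0. Qed.

Lemma vnorm_ge0 x : 0 <= vnorm dot x.
Proof. exact: sqrtr_ge0. Qed.

Lemma vnorm_sqr x : vnorm dot x ^+ 2 = vdot dot x x.
Proof. by rewrite sqr_sqrtr// vdot_ge0. Qed.

Lemma vdot_lin x y (t : R) : vdot dot (fun l => x l - t *: y l) (fun l => x l - t *: y l) =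
  vdot dot x x - 2 * t * vdot dot x y + t ^+ 2 * vdot dot y y.
Proof.
rewrite /vdot !mulr_sumr -sumrB -big_split/=; apply: eq_bigr => l _.
by rewrite dotBl !dotBr !dotZl !dotZr (dotC (y l) (x l)); ring.
Qed.

Lemma vdot_cauchy x y : vdot dot x y <= vnorm dot x * vnorm dot y.
Proof.
apply: discriminant_le; rewrite ?vdot_ge0// => t.
by rewrite -vdot_lin vdot_ge0.
Qed.

Lemma vnormZ (a : R) x : vnorm dot (fun l => a *: x l) = `|a| * vnorm dot x.
Proof.
rewrite /vnorm -sqrtr_sqr -sqrtrM ?sqr_ge0//; congr Num.sqrt.
by rewrite /vdot mulr_sumr; apply: eq_bigr => l _; rewrite dotZl dotZr mulrA.
Qed.

Lemma vnormD x y : vnorm dot (fun l => x l + y l) <= vnorm dot x + vnorm dot y.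
Proof.
rewrite -(@ler_pXn2r _ 2)// ?nnegrE ?vnorm_ge0 ?addr_ge0 ?vnorm_ge0//.
have := vdot_cauchy x y; rewrite sqrrD !vnorm_sqr.
have -> : vdot dot (fun l => x l + y l) (fun l => x l + y l) =
    vdot dot x x + 2 * vdot dot x y + vdot dot y y.
  rewrite /vdot mulr_sumr -!big_split/=; apply: eq_bigr => l _.
  by rewrite dotDl !dotDr (dotC (y l) (x l)); ring.
lra.
Qed.

Lemma norm_le_vnorm x l : `|x l| <= vnorm dot x.
Proof.
rewrite -(@ler_pXn2r _ 2)// ?nnegrE ?vnorm_ge0// vnorm_sqr /vdot (bigD1 l)//=.
rewrite dot_normsq lerDl; apply: sumr_ge0 => k _.
by rewrite dot_normsq sqr_ge0.
Qed.

End vector_fields.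
End dot_product.

Section continuous_on_theory.
Variables (R : realType) (d n : nat) (V : normedModType R).
Variables (dot : {dot V for idfun}) (e : 'I_n -> V) (Omega : set 'rV[R]_d).
Hypotheses (hn : norm_of_dot dot) (he : orthonormal_basis dot e).
Local Notation Rd := 'rV[R]_d.
Implicit Types phi psi : Rd -> V.

Lemma dot_continuous v : continuous (fun u => dot u v : R).
Proof.
move=> u; apply/cvgrPdist_lt => r r0.
have v1 : 0 < `|v| + 1 by rewrite ltr_wpDl.
near=> w; rewrite -dotBl.
have uw : `|u - w| < r / (`|v| + 1).
  by near: w; apply: (@cvgr_dist_lt _ _ _ _ _ id u cvg_id); rewrite divr_gt0.
rewrite ltr_pdivlMr// in uw; apply: le_lt_trans uw.
have H1 := dot_cauchy hn (u - w) v; have := dot_cauchy hn (- (u - w)) v.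
rewrite -scaleN1r dotZl mulN1r scaleN1r normrN => H2.
have H3 : `|u - w| * `|v| <= `|u - w| * (`|v| + 1) by rewrite ler_wpM2l// lerDl.
by rewrite ler_norml; apply/andP; split; lra.
Unshelve. all: by end_near. Qed.

Lemma continuous_on_dot phi v : continuous_on Omega phi ->
  {within Omega, continuous (fun x => dot (phi x) v)}.
Proof.
move=> cphi x; apply: (@continuous_comp _ _ _ (from_subspace Omega phi) (fun u => dot u v)).
  exact: cphi.
exact: dot_continuous.
Qed.

Lemma continuous_onD phi psi : continuous_on Omega phi -> continuous_on Omega psi ->
  continuous_on Omega (fun x => phi x + psi x).
Proof. by move=> cf cg x; apply: cvgD; [exact: cf|exact: cg]. Qed.

Lemma continuous_onZ (a : R) phi : continuous_on Omega phi ->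
  continuous_on Omega (fun x => a *: phi x).
Proof. by move=> cf x; apply: cvgZr; exact: cf. Qed.

Lemma continuous_onB phi psi : continuous_on Omega phi -> continuous_on Omega psi ->
  continuous_on Omega (fun x => phi x - psi x).
Proof. by move=> cf cg x; apply: cvgB; [exact: cf|exact: cg]. Qed.

Lemma continuous_on0 : continuous_on Omega (fun=> 0 : V).
Proof. by move=> x; exact: cvg_cst. Qed.

Lemma continuous_on_scale (f : Rd -> R) (v : V) : {within Omega, continuous f} ->
  continuous_on Omega (fun x => f x *: v).
Proof. by move=> cf x; apply: cvgZl; exact: cf. Qed.

Lemma continuous_on_sum I (r : seq I) (f : I -> Rd -> V) :
  (forall i, continuous_on Omega (f i)) -> continuous_on Omega (fun x => \sum_(i <- r) f i x).
Proof.
move=> cf; elim: r => [|i r IH].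
  by under eq_fun do rewrite big_nil; exact: continuous_on0.
by under eq_fun do rewrite big_cons; exact: continuous_onD.
Qed.

Lemma continuous_on_comb (f : 'I_n -> Rd -> R) :
  (forall i, {within Omega, continuous (f i)}) ->
  continuous_on Omega (fun x => \sum_i f i x *: e i).
Proof. by move=> cf; apply: continuous_on_sum => i; exact: continuous_on_scale. Qed.

Lemma within_sum I (r : seq I) (f : I -> Rd -> R) :
  (forall i, {within Omega, continuous (f i)}) ->
  {within Omega, continuous (fun x => \sum_(i <- r) f i x)}.
Proof.
move=> cf; elim: r => [|i r IH].
  by under eq_fun do rewrite big_nil; exact: within_cst.
by under eq_fun do rewrite big_cons; exact: within_add.
Qed.

Lemma within_dot phi psi : continuous_on Omega phi -> continuous_on Omega psi ->
  {within Omega, continuous (fun x => dot (phi x) (psi x))}.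
Proof.
move=> cphi cpsi; under eq_fun do rewrite (dot_basis he).
by apply: within_sum => i; apply: within_mul; exact: continuous_on_dot.
Qed.

Lemma within_vnorm (psi : 'I_d -> Rd -> V) : (forall l, continuous_on Omega (psi l)) ->
  {within Omega, continuous (fun x => vnorm dot (psi ^~ x))}.
Proof.
move=> cpsi x; apply: (@continuous_comp _ _ _ (from_subspace Omega
  (fun x => vdot dot (psi ^~ x) (psi ^~ x))) (@Num.sqrt R)).
  by apply: within_sum => l; exact: within_dot.
exact: sqrt_continuous.
Qed.

End continuous_on_theory.

(** * Densities and square-integrable functions *)

Section charge_with_density.
Context dsp (T : measurableType dsp) (R : realType) (mu : {measure set T -> \bar R}).

Lemma integrable_patch (D A : set T) (u : T -> R) : measurable D -> measurable A ->
  mu.-integrable D (EFin \o u) -> mu.-integrable A (fun x => ((u \_ D) x)%:E).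
Proof.
move=> mD mA iu; apply: (integrableS measurableT) => //.
rewrite (_ : (fun x => _) = (EFin \o u) \_ D).
  by apply/integrable_restrict => //; rewrite setTI.
by apply/funext => x; rewrite !patchE; case: ifP.
Qed.

Lemma measure_with_density (h : T -> R) : mu.-integrable setT (EFin \o h) ->
  (forall x, 0 <= h x) -> exists m : {measure set T -> \bar R},
  (m setT < +oo)%E /\ forall A, m A = (\int[mu]_(x in A) (h x)%:E)%E.
Proof.
move=> ih h0; have pos A : (0 <= induced_charge ih A)%E.
  by apply: integral_ge0 => x _; rewrite lee_fin.
exists (measure_of_charge (induced_charge ih) pos); split => //.
rewrite /measure_of_charge /induced_charge.
have /integrableP[_] := ih; apply: le_lt_trans.
rewrite le_eqVlt; apply/orP; left; apply/eqP.
by apply: eq_integral => x _; rewrite /= ger0_norm.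
Qed.

(** The positive and negative parts of [f] are densities of two finite measures whose difference is
    [nu], so [charge_integralE] applies. Both parts are treated together by [part], where [s] is
    either truncation. *)
Lemma charge_integral_density (nu : {charge set T -> \bar R}) (D : set T)
    (f g : T -> R) (M : R) :
  measurable D -> mu.-integrable D (EFin \o f) -> measurable_fun D g ->
  0 <= M -> (forall x, D x -> `|g x| <= M) ->
  (forall A, measurable A -> nu A = \int[mu]_(x in A) (f \_ D x)%:E)%E ->
  charge_integral nu D g = \int[mu]_(x in D) (g x * f x).
Proof.
move=> mD intf mg M0 gM nuE.
have mf : measurable_fun D f by move/integrableP: intf => [/measurable_EFinP].
have part (s : R -> R) : measurable_fun setT s -> (forall r, 0 <= s r <= `|r|) ->
    [/\ mu.-integrable D (EFin \o (s \o f)),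
        mu.-integrable D (EFin \o (fun x => g x * s (f x))) &
     exists m : {measure set T -> \bar R}, [/\ (m setT < +oo)%E,
       forall A, m A = (\int[mu]_(x in A) ((s \o f) \_ D x)%:E)%E &
       \int[m]_(x in D) g x = \int[mu]_(x in D) (g x * s (f x))]].
  move=> ms s0; have msf : measurable_fun D (s \o f).
    by apply: (@measurable_comp _ _ _ _ _ _ setT).
  have ips : mu.-integrable D (EFin \o (s \o f)).
    apply: le_integrable intf => //; first exact/measurable_EFinP.
    move=> x _; rewrite /= lee_fin; have /andP[sf0 sf] := s0 (f x).
    by rewrite ger0_norm.
  have igs (h : T -> R) (c : R) : measurable_fun D h -> (forall x, D x -> `|h x| <= c) ->
      mu.-integrable D (EFin \o (fun x => h x * s (f x))).
    move=> mh hc.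
    have icf : mu.-integrable D (EFin \o (fun x => c * f x)).
      by have := integrableZl mD c intf.
    apply: le_integrable icf => //; first by apply/measurable_EFinP; exact: measurable_funM.
    move=> x Dx; rewrite /= lee_fin !normrM; have /andP[sf0 sf] := s0 (f x).
    by rewrite ler_pM ?(ger0_norm sf0)// (le_trans (hc _ Dx))// ler_norm.
  have igs1 := igs g M mg gM.
  split => //.
  have h0 x : 0 <= ((s \o f) \_ D) x.
    by rewrite patchE; case: ifP => // _ /=; have /andP[] := s0 (f x).
  have ih : mu.-integrable setT (EFin \o ((s \o f) \_ D)).
    exact: integrable_patch.
  have [m [mT mE]] := measure_with_density ih h0; exists m; split => //.
  have mDE A : measurable A -> A `<=` D -> m A = (\int[mu]_(x in A) (s (f x))%:E)%E.
    move=> mA AD; rewrite mE; apply: eq_integral => x /set_mem Ax.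
    by rewrite patchE mem_set//; exact: AD.
  have dens (h : T -> R) : measurable_fun D h -> (forall x, D x -> 0 <= h x) ->
      \int[m]_(x in D) h x = \int[mu]_(x in D) (h x * s (f x)).
    move=> mh h0'; rewrite /Rintegral; congr fine.
    apply: ge0_integral_density => // x _; by have /andP[] := s0 (f x).
  have ibd (h : T -> R) (c : R) : measurable_fun D h -> (forall x, D x -> `|h x| <= c) ->
      m.-integrable D (EFin \o h).
    move=> mh hc; apply: measurable_bounded_integrable => //.
      by rewrite (le_lt_trans _ mT)// le_measure ?inE.
    by exists c; split; rewrite ?num_real// => r cr x Dx /=; exact: le_trans (hc _ Dx) (ltW cr).
  have gMb x : D x -> `|g x + M| <= M + M.
    by move=> Dx; rewrite (le_trans (ler_normD _ _))// (ger0_norm M0) lerD2r gM.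
  have mgM : measurable_fun D (fun x => g x + M) by exact: measurable_funD.
  (* [ge0_integral_density] asks for a nonnegative integrand, hence the shift of [g] by [M]. *)
  transitivity (\int[m]_(x in D) (g x + M) - \int[m]_(x in D) M).
    rewrite -RintegralB//.
    - by apply: eq_Rintegral => x _; rewrite addrK.
    - exact: ibd gMb.
    - by apply: (ibd (fun=> M) M) => // x _; rewrite ger0_norm.
  rewrite dens//; last first.
    by move=> x /gM; rewrite ler_norml => /andP[? _]; lra.
  rewrite (dens (fun=> M))// -RintegralB//.
  - by apply: eq_Rintegral => x _; ring.
  - exact: igs gMb.
  - by apply: (igs (fun=> M) M) => // x _; rewrite ger0_norm.
have [|r|ifp igp [m1 [m1T m1E m1g]]] := part (fun r => Num.max r 0).
- by apply: measurable_maxr.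
- by rewrite le_max lexx orbT/= ge_max normr_ge0 ler_norm.
have [|r|ifn ign [m2 [m2T m2E m2g]]] := part (fun r => Num.max (- r) 0).
- by apply: measurable_maxr => //; exact: measurable_funN.
- by rewrite le_max lexx orbT/= ge_max normr_ge0 -normrN ler_norm.
have posneg (r : R) : Num.max r 0 - Num.max (- r) 0 = r.
  have [r0|/ltW r0] := leP 0 r; first by rewrite max_r ?oppr_le0// subr0.
  by rewrite max_l ?oppr_ge0// opprK add0r.
rewrite (@charge_integralE _ _ _ _ m1 m2 _ _ M)//; last first.
  move=> A mA; rewrite nuE// m1E m2E -integralB//; [|exact: integrable_patch..].
  apply: eq_integral => x _; rewrite !patchE; case: ifP => _; last by rewrite sube0.
  by rewrite /= -EFinB posneg.
rewrite m1g m2g -RintegralB//; apply: eq_Rintegral => x _.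
by rewrite -mulrBr posneg.
Qed.

End charge_with_density.

Section L2_theory.
Variables (R : realType) (d n : nat) (V : normedModType R).
Variables (dot : {dot V for idfun}) (e : 'I_n -> V) (Omega : set 'rV[R]_d).
Hypotheses (hn : norm_of_dot dot) (he : orthonormal_basis dot e).
Hypothesis cOmega : compact Omega.
Local Notation Rd := 'rV[R]_d.
Local Notation leb := (@lebesgue_rV R d).
Local Notation L2 := (L2 dot e Omega).
Implicit Types f g h phi : Rd -> V.

Let mO : measurable Omega := compact_measurable_rV cOmega.
Let fO : (leb Omega < +oo)%E := compact_lebesgue_fin cOmega.

Definition inner f g : R := \int[leb]_(x in Omega) dot (f x) (g x).

Lemma bounded_integrable_rV (u : Rd -> R) (M : R) : measurable_fun Omega u ->
  (forall x, Omega x -> `|u x| <= M) -> leb.-integrable Omega (EFin \o u).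
Proof.
move=> mu uM; apply: measurable_bounded_integrable => //.
by exists M; split; rewrite ?num_real// => r Mr x Ox /=; exact: le_trans (uM _ Ox) (ltW Mr).
Qed.

Lemma within_integrable_rV (u : Rd -> R) : {within Omega, continuous u} ->
  leb.-integrable Omega (EFin \o u).
Proof.
move=> cu; have [M _ uM] := within_continuous_bounded cOmega cu.
by apply: bounded_integrable_rV uM; exact: within_continuous_measurable_rV.
Qed.

Lemma dot_measurable f g : (forall i, measurable_fun Omega (fun x => dot (f x) (e i))) ->
  (forall i, measurable_fun Omega (fun x => dot (g x) (e i))) ->
  measurable_fun Omega (fun x => dot (f x) (g x)).
Proof.
move=> mf mg; under eq_fun do rewrite (dot_basis he).
by apply: measurable_sum => i; exact: measurable_funM.
Qed.

Lemma L2_sqr_integrable f : L2 f -> leb.-integrable Omega (fun x => (`|f x| ^+ 2)%:E).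
Proof.
move=> [mf Ef]; apply/integrableP; split.
  apply/measurable_EFinP; under eq_fun do rewrite -(dot_normsq hn).
  exact: dot_measurable.
by under eq_integral do rewrite gee0_abs ?lee_fin ?sqr_ge0//.
Qed.

Lemma L2_of_le f (u : Rd -> R) : (forall i, measurable_fun Omega (fun x => dot (f x) (e i))) ->
  leb.-integrable Omega (EFin \o u) -> (forall x, Omega x -> `|f x| ^+ 2 <= u x) -> L2 f.
Proof.
move=> mf /integrableP[mu iu] fu; split => //; apply: le_lt_trans iu.
apply: ge0_le_integral => //.
- apply/measurable_EFinP; under eq_fun do rewrite -(dot_normsq hn).
  exact: dot_measurable.
- exact: measurableT_comp.
- by move=> x Ox; rewrite /= lee_fin (le_trans (fu _ Ox))// ler_norm.
Qed.

Lemma L2_dot_integrable f g : L2 f -> L2 g ->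
  leb.-integrable Omega (EFin \o (fun x => dot (f x) (g x))).
Proof.
move=> Lf Lg.
have := integrableD mO (L2_sqr_integrable Lf) (L2_sqr_integrable Lg).
apply: le_integrable => //.
  by apply/measurable_EFinP; case: Lf => mf _; case: Lg => mg _; exact: dot_measurable.
by move=> x _; rewrite /= lee_fin (le_trans (dot_abs_le hn _ _))// ler_norm.
Qed.

Lemma L2_energyE f : L2 f -> L2_energy Omega f = (inner f f)%:E.
Proof.
move=> Lf; rewrite /inner /Rintegral fineK.
  by apply: eq_integral => x _; rewrite dot_normsq.
by apply: integrable_fin_num => //; exact: L2_dot_integrable.
Qed.

Lemma L2D f g : L2 f -> L2 g -> L2 (fun x => f x + g x).
Proof.
move=> Lf Lg; apply: (@L2_of_le _ (fun x => 2 * (`|f x| ^+ 2 + `|g x| ^+ 2))).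
- move=> i; under eq_fun do rewrite dotDl.
  by case: Lf => mf _; case: Lg => mg _; exact: measurable_funD.
- have := integrableZl mO 2 (integrableD mO (L2_sqr_integrable Lf) (L2_sqr_integrable Lg)).
  by [].
- move=> x _; have := sqr_ge0 `|f x - g x|.
  by rewrite -!(dot_normsq hn) dotBl dotDl !dotBr !dotDr; lra.
Qed.

Lemma L2Z (a : R) f : L2 f -> L2 (fun x => a *: f x).
Proof.
move=> Lf; apply: (@L2_of_le _ (fun x => a ^+ 2 * `|f x| ^+ 2)).
- move=> i; under eq_fun do rewrite dotZl.
  by case: Lf => mf _; exact: measurable_funM.
- by have := integrableZl mO (a ^+ 2) (L2_sqr_integrable Lf).
- by move=> x _; rewrite normrZ exprMn real_normK ?num_real.
Qed.

Lemma L2B f g : L2 f -> L2 g -> L2 (fun x => f x - g x).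
Proof.
move=> Lf Lg; have := L2D Lf (L2Z (-1) Lg).
by under eq_fun do rewrite scaleN1r.
Qed.

Lemma L2_continuous_on phi : continuous_on Omega phi -> L2 phi.
Proof.
move=> cphi; apply: (@L2_of_le _ (fun x => dot (phi x) (phi x))).
- move=> i; apply: within_continuous_measurable_rV => //; exact: continuous_on_dot.
- by apply: within_integrable_rV; apply: (within_dot hn he).
- by move=> x _; rewrite dot_normsq.
Qed.

Lemma innerC f g : inner f g = inner g f.
Proof. by apply: eq_Rintegral => x _; rewrite dotC. Qed.

Lemma innerDl f g h : L2 f -> L2 g -> L2 h ->
  inner (fun x => f x + g x) h = inner f h + inner g h.
Proof.
move=> Lf Lg Lh; rewrite /inner -RintegralD//; [|exact: L2_dot_integrable..].
by apply: eq_Rintegral => x _; rewrite dotDl.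
Qed.

Lemma innerZl (a : R) f g : L2 f -> L2 g -> inner (fun x => a *: f x) g = a * inner f g.
Proof.
move=> Lf Lg; rewrite /inner -RintegralZl//; last exact: L2_dot_integrable.
by apply: eq_Rintegral => x _; rewrite dotZl.
Qed.

Lemma innerBl f g h : L2 f -> L2 g -> L2 h ->
  inner (fun x => f x - g x) h = inner f h - inner g h.
Proof.
move=> Lf Lg Lh; rewrite /inner -RintegralB//; [|exact: L2_dot_integrable..].
by apply: eq_Rintegral => x _; rewrite dotBl.
Qed.

Lemma innerDr f g h : L2 f -> L2 g -> L2 h ->
  inner h (fun x => f x + g x) = inner h f + inner h g.
Proof. by move=> Lf Lg Lh; rewrite innerC innerDl// !(innerC h). Qed.

Lemma innerZr (a : R) f g : L2 f -> L2 g -> inner g (fun x => a *: f x) = a * inner g f.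
Proof. by move=> Lf Lg; rewrite innerC innerZl// (innerC g). Qed.

Lemma innerBr f g h : L2 f -> L2 g -> L2 h ->
  inner h (fun x => f x - g x) = inner h f - inner h g.
Proof. by move=> Lf Lg Lh; rewrite innerC innerBl// !(innerC h). Qed.

Lemma inner_ge0 f : 0 <= inner f f.
Proof. by apply: Rintegral_ge0 => x _; rewrite dot_normsq// sqr_ge0. Qed.

Lemma eq_inner f g f' g' : (forall x, Omega x -> f x = f' x) ->
  (forall x, Omega x -> g x = g' x) -> inner f g = inner f' g'.
Proof.
by move=> ff gg; apply: eq_Rintegral => x /set_mem Ox; rewrite ff// gg.
Qed.

Lemma inner_sqrE f : \int[leb]_(x in Omega) `|f x| ^+ 2 = inner f f.
Proof. by apply: eq_Rintegral => x _; rewrite dot_normsq. Qed.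

Lemma L2_component_integrable f i : L2 f ->
  leb.-integrable Omega (EFin \o (fun x => dot (f x) (e i))).
Proof.
move=> Lf; apply: (@L2_dot_integrable f (fun=> e i)) => //.
by apply: L2_continuous_on => x; exact: cvg_cst.
Qed.

Lemma densityE f i A : L2 f -> measurable A ->
  (density dot e Omega f i A = \int[leb]_(x in A) (((fun x => dot (f x) (e i)) \_ Omega) x)%:E)%E.
Proof.
move=> Lf mA; rewrite /density; case: pselect => [intf|nint]; last first.
  exfalso; apply: nint; apply/integrable_restrict => //; rewrite setTI.
  exact: L2_component_integrable.
rewrite /induced_charge; apply: eq_integral => x _.
by rewrite !patchE; case: ifP.
Qed.

(** Stated for every [m] with the values of a density, so that it serves both [density] and the
    difference of two densities in [W1]. *)
Lemma pairing_L2 (m : vmeasure R d n) f phi : L2 f -> continuous_on Omega phi ->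
  (forall i A, measurable A ->
    (m i A = \int[leb]_(x in A) (((fun x => dot (f x) (e i)) \_ Omega) x)%:E)%E) ->
  pairing dot e Omega phi m = inner phi f.
Proof.
move=> Lf cphi mE; rewrite /pairing /inner.
have cphii i : {within Omega, continuous (fun x => dot (phi x) (e i))}.
  exact: continuous_on_dot.
transitivity (\sum_i \int[leb]_(x in Omega) (dot (phi x) (e i) * dot (f x) (e i))).
  apply: eq_bigr => i _; have [M M0 phiM] := within_continuous_bounded cOmega (cphii i).
  apply: charge_integral_density phiM _ => //.
  - exact: L2_component_integrable.
  - exact: within_continuous_measurable_rV.
  - exact: mE.
have ii i : leb.-integrable Omega (EFin \o (fun x => dot (phi x) (e i) * dot (f x) (e i))).
  have [M M0 phiM] := within_continuous_bounded cOmega (cphii i).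
  have := integrableZl mO M (L2_component_integrable i Lf).
  apply: le_integrable => //.
    apply/measurable_EFinP; apply: measurable_funM; last by case: Lf.
    exact: within_continuous_measurable_rV.
  by move=> x Ox; rewrite /= lee_fin !normrM ler_wpM2r// (le_trans (phiM _ Ox))// ler_norm.
rewrite (_ : (fun x => dot (phi x) (f x)) =
    (fun x => \sum_i dot (phi x) (e i) * dot (f x) (e i))); last first.
  by apply/funext => x; rewrite (dot_basis he).
rewrite /Rintegral; under eq_integral do rewrite -sumEFin.
rewrite integral_sum//.
rewrite (_ : (\sum_(i < n) _)%E = (\sum_i fine (\int[leb]_(x in Omega)
  (dot (phi x) (e i) * dot (f x) (e i))%:E)%E)%:E)//.
rewrite -sumEFin; apply: eq_bigr => i _; rewrite fineK//.
by apply: integrable_fin_num => //; exact: ii.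
Qed.

Lemma pairing_density f phi : L2 f -> continuous_on Omega phi ->
  pairing dot e Omega phi (density dot e Omega f) = inner phi f.
Proof. by move=> Lf cphi; apply: pairing_L2 => // i A mA; exact: densityE. Qed.

Lemma pairing_density_sub f g phi : L2 f -> L2 g -> continuous_on Omega phi ->
  pairing dot e Omega phi
    (vmeasure_sub (density dot e Omega f) (density dot e Omega g)) =
  inner phi (fun x => f x - g x).
Proof.
move=> Lf Lg cphi; apply: pairing_L2 => //; first exact: L2B.
move=> i A mA.
transitivity (density dot e Omega f i A - density dot e Omega g i A)%E => //.
rewrite !densityE// -integralB//; [|exact: integrable_patch (L2_component_integrable _ _)..].
apply: eq_integral => x _; rewrite !patchE; case: ifP => _; last by rewrite sube0.
by rewrite dotBl EFinB.
Qed.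

End L2_theory.

(** * Mollification *)

Section preliminaries.
Variable R : realType.

Lemma convex_comb (M : lmodType R) (A : set M) (x y : M) (t : R) :
  convex_set A -> A x -> A y -> 0 <= t -> t <= 1 -> A (t *: x + (1 - t) *: y).
Proof.
move=> cA Ax Ay t0 t1; have := cA x y (Itv01 t0 t1) (mem_set Ax) (mem_set Ay).
by rewrite inE.
Qed.

Lemma uniformly_continuous_compact (U W : normedModType R) (A : set U) (f : U -> W) :
  compact A -> {within A, continuous f} -> forall e, 0 < e ->
  exists2 r : R, 0 < r & forall x y, A x -> A y -> `|x - y| < r -> `|f x - f y| < e.
Proof.
move=> cA /within_continuousP cf e e0; apply: contrapT => /forall2NP H.
have Hk (k : nat) : exists p : U * U, [/\ A p.1, A p.2, `|p.1 - p.2| < k.+1%:R^-1 &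
    e <= `|f p.1 - f p.2|].
  have k0 : 0 < k.+1%:R^-1 :> R by rewrite invr_gt0.
  have [//|] := H k.+1%:R^-1.
  move=> /existsNP[x /existsNP[y /not_implyP[Ax /not_implyP[Ay /not_implyP[xy /negP]]]]].
  by rewrite -leNgt => fxy; exists (x, y).
have {Hk}/choice[p pP] := Hk.
have FA : (fst \o p @ \oo) A by exists 0%N => // k _; have [] := pP k.
have [x [Ax clx]] := cA _ _ FA.
have e2 : 0 < e / 2 by rewrite divr_gt0.
have [r r0 rf] := cf x Ax _ e2.
have r2 : 0 < r / 2 by rewrite divr_gt0.
have := @near_infty_natSinv_lt R (PosNum r2) => -[N _ NP].
have FN : (fst \o p @ \oo) [set (p k).1 | k in [set k | (N <= k)%N]].
  by exists N => // k /= Nk; exists k.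
have [_ [[k /= Nk <-]]] := clx _ _ FN (nbhsx_ballx x _ r2).
rewrite -ball_normE/= => xk; have [A1 A2 p12 fp] := pP k.
have x1 : `|x - (p k).1| < r by lra.
have x2 : `|x - (p k).2| < r.
  rewrite (le_lt_trans (ler_distD (p k).1 _ _))// (splitr r) ltrD//.
  exact: lt_trans p12 (NP k Nk).
have := rf _ A1 x1; have := rf _ A2 x2.
have := ler_distD (f x) (f (p k).1) (f (p k).2).
rewrite (distrC (f (p k).1) (f x)); lra.
Qed.

Lemma lipschitz_continuous (U W : normedModType R) (f : U -> W) (C : R) : 0 <= C ->
  (forall x y, `|f x - f y| <= C * `|x - y|) -> continuous f.
Proof.
move=> C0 lip x; apply/cvgrPdist_lt => e e0.
have D0 : 0 < C + 1 by rewrite ltr_wpDl.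
near=> y; apply: le_lt_trans (lip _ _) _.
have xy : `|x - y| < e / (C + 1).
  near: y; apply: (@cvgr_dist_lt _ _ _ _ _ id x cvg_id); exact: divr_gt0.
rewrite ltr_pdivlMr// in xy; apply: le_lt_trans xy.
by rewrite mulrC ler_wpM2l// lerDl.
Unshelve. all: by end_near. Qed.

Lemma MVT_unit (h dh : R -> R) (M : R) :
  (forall t : R, is_derive t (1 : R) h (dh t)) ->
  (forall t, 0 <= t -> t <= 1 -> `|dh t| <= M) -> `|h 1 - h 0| <= M.
Proof.
move=> hdh dhM; have ch : {within `[0, 1], continuous h}.
  apply: continuous_subspaceT => x; apply: differentiable_continuous.
  by apply/derivable1_diffP; have [] := hdh x.
have [c] := MVT_segment ler01 (fun x _ => hdh x) ch.
rewrite in_itv/= => /andP[c0 c1] ->.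
by rewrite subr0 mulr1; exact: dhM.
Qed.

Lemma is_derive_scalel (U W : normedModType R) (g : U -> R) (w : W) x v dg :
  is_derive x v g dg -> is_derive x v (fun y => g y *: w) (dg *: w).
Proof.
move=> [/cvg_ex[l gl] dgE].
have H : h^-1 *: (((fun y => g y *: w) \o shift x) (h *: v) - g x *: w)
    @[h --> 0^'] --> dg *: w.
  rewrite (_ : (fun h => _) = (fun h => (h^-1 *: ((g \o shift x) (h *: v) - g x)) *: w)).
    apply: cvgZl; rewrite -dgE /derive; rewrite (cvg_lim _ gl)//.
  by apply/funext => h; rewrite /= -scalerBl scalerA.
split; first by apply/cvg_ex; exists (dg *: w).
exact: cvg_lim.
Qed.

End preliminaries.

Section mollifier.
Variables (R : realType) (d : nat) (beta : R -> R) (s : R).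
Hypotheses (s0 : 0 < s) (dbeta : forall k, differentiable_upto k beta)
  (beta_ge0 : forall t, 0 <= beta t) (beta_supp : forall t, s <= `|t| -> beta t = 0)
  (beta1 : forall a, (\int[@lebesgue_measure R]_t (beta (a - t))%:E = 1)%E).
Local Notation Rd := 'rV[R]_d.
Local Notation leb := (@lebesgue_rV R d).
Local Notation B := (derivatives beta).
#[local] Arguments derivatives : simpl never.
Implicit Types (y z a v : Rd) (k : 'I_d -> nat).

(* The derivative with respect to [z], of order [k i] in the [i]-th coordinate,
   of the product mollifier centred at [z]. *)
Definition bkernel k z y : R := \prod_i B (k i) (z 0 i - y 0 i).

Definition order0 : 'I_d -> nat := fun=> 0%N.

Definition incr k (l : 'I_d) : 'I_d -> nat := fun i => (k i + (i == l))%N.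

Lemma derivatives_continuous j : continuous (B j).
Proof.
move=> t; apply: differentiable_continuous; apply/derivable1_diffP.
by have [] := is_derive_derivatives dbeta j t.
Qed.

Lemma derivatives_bounded j : exists2 C, 0 <= C & forall t, `|B j t| <= C.
Proof.
have [M M0 BM] := within_continuous_bounded (@segment_compact _ (- s) s)
  (continuous_subspaceT (@derivatives_continuous j)).
exists M => // t; have [ts|ts] := leP `|t| s.
  by apply: BM; rewrite /= in_itv/= -ler_norml.
by rewrite (derivatives_eq0 _ dbeta beta_supp ts) normr0.
Qed.

Lemma kernel_bounded k : exists2 C, 0 <= C & forall z y, `|bkernel k z y| <= C.
Proof.
have /choice[C CP] j : exists C, 0 <= C /\ forall t, `|B j t| <= C.
  by have [C ? ?] := derivatives_bounded j; exists C.
exists (\prod_i C (k i)); first by apply: prodr_ge0 => i _; have [] := CP (k i).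
move=> z y; rewrite /bkernel normr_prod; apply: ler_prod => i _.
by rewrite normr_ge0/=; have [_] := CP (k i); exact.
Qed.

Lemma kernel_eq0 k z y : s < `|z - y| -> bkernel k z y = 0.
Proof.
move=> szy; have [i si] : exists i, s < `|z 0 i - y 0 i|.
  apply: contrapT => /forallNP H; move: szy; rewrite ltNge => /negP; apply.
  apply: norm_le_coord => [|i]; first exact: ltW.
  by rewrite leNgt; apply/negP; rewrite !mxE; exact: H.
by rewrite /bkernel (bigD1 i)//= (derivatives_eq0 _ dbeta beta_supp si) mul0r.
Qed.

Lemma kernel0_ge0 z y : 0 <= bkernel order0 z y.
Proof. by apply: prodr_ge0 => i _; exact: beta_ge0. Qed.

Lemma prod_continuous (I : Type) (r : seq I) (f : I -> Rd -> R) :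
  (forall i, continuous (f i)) -> continuous (fun y => \prod_(i <- r) f i y).
Proof.
move=> cf; elim: r => [|i r IH].
  by under eq_fun do rewrite big_nil; exact: cst_continuous.
under eq_fun do rewrite big_cons.
by move=> y; exact: (continuousM (cf i y) (IH y)).
Qed.

Lemma kernel_continuous k z : continuous (bkernel k z).
Proof.
apply: prod_continuous => i y.
apply: (@continuous_comp _ _ _ (fun y : Rd => z 0 i - y 0 i) (B (k i))).
  apply: (@lipschitz_continuous _ _ _ _ 1) => // a b.
  have -> : z 0 i - a 0 i - (z 0 i - b 0 i) = - ((a - b) 0 i) by rewrite !mxE; ring.
  by rewrite normrN mul1r coord_le_norm.
exact: derivatives_continuous.
Qed.

(** The direction [v] is arbitrary because partial derivatives need coordinate directions, while
    Lipschitz bounds need segments. *)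
Lemma is_derive_kernel k a v y (t : R) :
  is_derive t (1 : R) (fun t : R => bkernel k (a + t *: v) y)
    (\sum_l v 0 l * bkernel (incr k l) (a + t *: v) y).
Proof.
pose P (r : seq 'I_d) k (t : R) := \prod_(i <- r) B (k i) ((a + t *: v) 0 i - y 0 i).
(* Product rule by induction over lists of coordinates; since these are distinct, [incr k l] changes
   the factor of [l] alone. *)
suff H (r : seq 'I_d) : uniq r -> is_derive t (1 : R) (P r k)
    (\sum_(l <- r) v 0 l * P r (incr k l) t).
  exact: (H _ (index_enum_uniq _)).
have dB j i : is_derive t (1 : R) (fun t : R => B j ((a + t *: v) 0 i - y 0 i))
    (v 0 i * B j.+1 ((a + t *: v) 0 i - y 0 i)).
  have dl : is_derive t (1 : R) (fun t : R => (a + t *: v) 0 i - y 0 i) (v 0 i).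
    rewrite (_ : (fun t => _) = (cst (a 0 i - y 0 i) + (v 0 i) \*: (id : R -> R))); last first.
      by apply/funext => u; rewrite !fctE/= !mxE /GRing.scale/= mulrC; ring.
    have := is_deriveD (is_derive_cst (a 0 i - y 0 i) t 1) (is_deriveZ (v 0 i) (is_derive_id t 1)).
    by rewrite add0r /GRing.scale/= mulr1.
  rewrite mulrC.
  exact: (is_derive1_comp (is_derive_derivatives dbeta j _) dl).
elim: r => [_|i r IH /= /andP[ir ur]].
  rewrite big_nil (_ : P [::] k = cst 1); first exact: is_derive_cst.
  by apply/funext => u; rewrite /P big_nil.
have E : P (i :: r) k = (fun t : R => B (k i) ((a + t *: v) 0 i - y 0 i)) * P r k.
  by apply/funext => u; rewrite /P big_cons.
rewrite E.
have := is_deriveM (dB (k i) i) (IH ur).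
congr is_derive; rewrite big_cons [RHS]addrC; congr (_ + _); last first.
  rewrite /GRing.scale/= mulrC -mulrA; congr (_ * _); rewrite /P big_cons; congr (_ * _).
    by rewrite /incr eqxx addn1.
  apply: eq_big_seq => j jr; rewrite /incr; case: eqP => [ji|]; last by rewrite addn0.
  by move: ir; rewrite -ji jr.
rewrite /GRing.scale/= mulr_sumr; apply: eq_big_seq => l lr.
rewrite mulrCA; congr (_ * _); rewrite /P big_cons; congr (_ * _).
rewrite /incr; case: eqP => [il|]; last by rewrite addn0.
by move: ir; rewrite il lr.
Qed.

(** The kernel depends on [z - y] only, so derivatives in [y] are those in [z] with the opposite
    direction. *)
Lemma kernel_shift k z y v (t : R) : bkernel k z (y + t *: v) = bkernel k (z + t *: (- v)) y.
Proof.
apply: eq_bigr => i _; congr (B _ _); rewrite !mxE; ring.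
Qed.

Lemma is_derive_kernel_right k z y l :
  is_derive y (delta_mx 0 l : Rd) (bkernel k z) (- bkernel (incr k l) z y).
Proof.
apply: line_is_derive; under eq_fun do rewrite kernel_shift.
have := is_derive_kernel k z (- delta_mx 0 l) y 0.
congr is_derive; rewrite scale0r addr0 (bigD1 l)//= !mxE !eqxx/= mulN1r.
by rewrite big1 ?addr0// => j jl; rewrite !mxE eqxx/= (negbTE jl) oppr0 mul0r.
Qed.

Lemma integral_kernel z : (\int[leb]_y (bkernel order0 z y)%:E = 1)%E.
Proof.
rewrite /bkernel (ge0_integral_prod_rV (g := fun i t => B 0%N (z 0 i - t)) (c := fun=> 1))//.
- by rewrite big1.
- move=> i; apply: continuous_measurable_fun => t.
  apply: continuous_comp; last exact: derivatives_continuous.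
  by apply: cvgB; [exact: cvg_cst|exact: cvg_id].
Qed.

Section mollify.
Variables (Omega : set Rd) (cOmega : compact Omega) (f : Rd -> R).
Hypothesis cf : {within Omega, continuous f}.
Let mO : measurable Omega := compact_measurable_rV cOmega.

(** Smooth in [z] everywhere, but for [k = order0] a true average of [f] is guaranteed only where
    the ball of radius [s] about [z] lies in [Omega]. *)
Definition mollify k z : R := \int[leb]_(y in Omega) (f y * bkernel k z y).

Lemma mollify_integrable k z : leb.-integrable Omega (EFin \o (fun y => f y * bkernel k z y)).
Proof.
apply: within_integrable_rV => //; apply: within_mul => //.
by apply: continuous_subspaceT; exact: kernel_continuous.
Qed.

(** Differentiation under the integral sign; the dominating function [G] is constant, hence
    integrable on the compact [Omega]. *)
Lemma is_derive_mollify k a v (t : R) :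
  is_derive t (1 : R) (fun t : R => mollify k (a + t *: v))
    (\sum_l v 0 l * mollify (incr k l) (a + t *: v)).
Proof.
pose F (t : R) y := f y * bkernel k (a + t *: v) y.
have [M M0 fM] := within_continuous_bounded cOmega cf.
have /choice[C CP] k' : exists C, 0 <= C /\ forall z y, `|bkernel k' z y| <= C.
  by have [C ? ?] := kernel_bounded k'; exists C.
have dF y (u : R) : is_derive u (1 : R) (F ^~ y)
    (f y * \sum_l v 0 l * bkernel (incr k l) (a + u *: v) y).
  exact: (is_deriveZ (f y) (is_derive_kernel k a v y u)).
pose G (y : Rd) : R := M * \sum_l `|v 0 l| * C (incr k l).
have tt : t \in `]t - 1, t + 1[ by rewrite in_itv/=; apply/andP; split; lra.
have G0 y : 0 <= G y.
  rewrite mulr_ge0// sumr_ge0// => l _; rewrite mulr_ge0//.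
  by have [] := CP (incr k l).
have intF (x : R) : x \in `]t - 1, t + 1[ -> leb.-integrable Omega (EFin \o F x).
  by move=> _; exact: mollify_integrable.
have derF (x : R) y : x \in `]t - 1, t + 1[ -> Omega y -> derivable (F ^~ y) x 1.
  by move=> _ _; have [] := dF y x.
have intG : leb.-integrable Omega (EFin \o G).
  by apply: within_integrable_rV => //; exact: within_cst.
have ubG (x : R) y : x \in `]t - 1, t + 1[ -> Omega y -> `|partial1of2 F x y| <= G y.
  move=> _ Oy; rewrite partial1of2E; have [_ ->] := dF y x.
  rewrite normrM ler_pM// ?fM// (le_trans (ler_norm_sum _ _ _))// ler_sum// => l _.
  rewrite normrM ler_wpM2l//; have [_] := CP (incr k l); exact.
have H := cvg_differentiation_under_integral mO tt intF derF G0 intG ubG.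
have E : \int[leb]_(y in Omega) partial1of2 F t y =
    \sum_l v 0 l * mollify (incr k l) (a + t *: v).
  under eq_Rintegral => y _.
    rewrite partial1of2E; have [_ ->] := dF y t; rewrite mulr_sumr.
    over.
  rewrite /Rintegral; under eq_integral do rewrite -sumEFin.
  rewrite integral_sum//; last first.
    move=> l; have := integrableZl mO (v 0 l) (mollify_integrable (incr k l) (a + t *: v)).
    by apply: eq_integrable => // y _; rewrite /= -EFinM mulrCA.
  have El l : (\int[leb]_(y in Omega) (f y * (v 0 l * bkernel (incr k l) (a + t *: v) y))%:E)%E =
      (v 0 l * mollify (incr k l) (a + t *: v))%:E.
    rewrite EFinM /mollify /Rintegral fineK; last first.
      by apply: integrable_fin_num => //; exact: mollify_integrable.
    rewrite -integralZl//; last exact: mollify_integrable.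
    by apply: eq_integral => y _; rewrite -EFinM mulrCA.
  by under eq_bigr do rewrite El; rewrite sumEFin.
have H' : h^-1 *: (((fun t : R => mollify k (a + t *: v)) \o shift t) (h *: (1 : R)) -
    mollify k (a + t *: v)) @[h --> 0^'] --> (\sum_l v 0 l * mollify (incr k l) (a + t *: v)).
  by rewrite -E; under eq_fun do rewrite /= scaler1.
split; first by apply/cvg_ex; eexists; exact: H'.
exact: cvg_lim H'.
Qed.

Lemma mollify_bounded k : exists2 C, 0 <= C & forall z, `|mollify k z| <= C.
Proof.
have [M M0 fM] := within_continuous_bounded cOmega cf.
have [C C0 kC] := kernel_bounded k.
exists (M * C * fine (leb Omega)); first by rewrite !mulr_ge0// fine_ge0.
move=> z; rewrite (le_trans (le_normr_Rintegral mO (mollify_integrable k z)))//.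
rewrite -Rintegral_cst// le_Rintegral//.
- by have /integrable_abse := mollify_integrable k z.
- by apply: within_integrable_rV => //; exact: within_cst.
- by move=> y Oy; rewrite normrM ler_pM// fM.
Qed.

(** The derivatives of the next order are bounded, which makes it Lipschitz. *)
Lemma mollify_continuous k : continuous (mollify k).
Proof.
have /choice[C CP] l : exists C, 0 <= C /\ forall z, `|mollify (incr k l) z| <= C.
  by have [C ? ?] := mollify_bounded (incr k l); exists C.
have C0 : 0 <= \sum_l C l by apply: sumr_ge0 => l _; have [] := CP l.
have lip z z' : `|mollify k z - mollify k z'| <= (\sum_l C l) * `|z - z'|.
  have := @MVT_unit R _ _ ((\sum_l C l) * `|z - z'|) (is_derive_mollify k z' (z - z')).
  rewrite scale1r scale0r addr0 (addrC z') subrK; apply => t _ _.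
  rewrite (le_trans (ler_norm_sum _ _ _))// mulr_suml ler_sum// => l _.
  rewrite normrM mulrC ler_pM//; last exact: coord_le_norm.
  by have [_] := CP l; exact.
exact: lipschitz_continuous C0 lip.
Qed.

Lemma integral_kernel_in z : (forall y, `|z - y| <= s -> Omega y) ->
  \int[leb]_(y in Omega) bkernel order0 z y = 1.
Proof.
move=> zO; rewrite /Rintegral -[RHS]/(fine 1%E) -(integral_kernel z); congr fine.
rewrite integral_mkcond; apply: eq_integral => y _; rewrite patchE.
case: ifPn => // /negP; rewrite inE => nOy; rewrite kernel_eq0// ltNge.
by apply/negP => /zO.
Qed.

Lemma mollify_approx z (c e : R) : 0 <= e -> (forall y, `|z - y| <= s -> Omega y /\ `|f y - c| <= e) ->
  `|mollify order0 z - c| <= e.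
Proof.
move=> e0 zO.
have kO := integral_kernel_in (fun y zy => (zO y zy).1).
have ik (c' : R) : leb.-integrable Omega (EFin \o (fun y => c' * bkernel order0 z y)).
  apply: within_integrable_rV => //; apply: within_mul; first exact: within_cst.
  by apply: continuous_subspaceT; exact: kernel_continuous.
have kint (c' : R) : \int[leb]_(y in Omega) (c' * bkernel order0 z y) = c'.
  rewrite RintegralZl ?kO ?mulr1//.
  by have := ik 1; apply: eq_integrable => // y _; rewrite /= mul1r.
rewrite -[X in _ - X]kint /mollify -RintegralB//; last exact: mollify_integrable.
have idiff := integrableB mO (mollify_integrable order0 z) (ik c).
rewrite (le_trans (le_normr_Rintegral mO _))//.
rewrite -[leRHS]kint le_Rintegral//.
- by have /integrable_abse := idiff.
- move=> y Oy; rewrite -mulrBl normrM (ger0_norm (kernel0_ge0 _ _)).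
  have [zy|zy] := leP `|z - y| s; last by rewrite kernel_eq0// !mulr0.
  by rewrite ler_wpM2r ?kernel0_ge0//; have [] := zO y zy.
Qed.

End mollify.
End mollifier.

(** * Approximation and regularity of admissible potentials *)

Lemma continuous_scaler (R : realType) (U : topologicalType) (V : normedModType R)
  (f : U -> R) c (w : V) : continuous f -> continuous (fun y => (c * f y) *: w).
Proof. by move=> cf y; apply: cvgZr_tmp; apply: cvgMl_tmp; exact: cf. Qed.

Section admissible_potentials.
Variables (R : realType) (d n : nat) (V : normedModType R).
Variables (dot : {dot V for idfun}) (e : 'I_n -> V) (Omega : set 'rV[R]_d).
Hypotheses (hn : norm_of_dot dot) (he : orthonormal_basis dot e).
Hypotheses (cOmega : compact Omega) (convO : convex_set Omega).
Local Notation Rd := 'rV[R]_d.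
Local Notation leb := (@lebesgue_rV R d).
Implicit Types (phi psi : Rd -> V) (x y z : Rd).

Let mO : measurable Omega := compact_measurable_rV cOmega.

Section kernel_fields.
Variables (beta : R -> R) (s : R).
Hypotheses (s0 : 0 < s) (dbeta : forall k, differentiable_upto k beta)
  (beta_ge0 : forall t, 0 <= beta t) (beta_supp : forall t, s <= `|t| -> beta t = 0)
  (beta1 : forall a, (\int[@lebesgue_measure R]_t (beta (a - t))%:E = 1)%E).
Local Notation kern := (bkernel beta).

Lemma is_derive_kernel_field k (c : R) z (w : V) y l :
  is_derive y (delta_mx 0 l : Rd) (fun y => (c * kern k z y) *: w)
    ((- c * kern (incr k l) z y) *: w).
Proof.
apply: is_derive_scalel; rewrite mulNr -mulrN.
exact: (is_deriveZ c (is_derive_kernel_right dbeta k z y l)).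
Qed.

Lemma smooth_kernel_field z (w : V) : smooth (fun y => kern (@order0 d) z y *: w).
Proof.
(* Every iterated partial derivative stays in this class, each one flipping the sign of [c] and
   raising one entry of [k]. *)
move=> r g; have [c [k gE]] : exists c k, g = fun y => (c * kern k z y) *: w.
  rewrite {}/g; elim: r => [|l r [c [k IH]]] /=.
    by exists 1, (@order0 d); apply/funext => y; rewrite mul1r.
  exists (- c), (incr k l); apply/funext => y; rewrite IH.
  by have [_ ->] := is_derive_kernel_field k c z w y l.
rewrite {}gE; split; last by move=> l y; have [] := is_derive_kernel_field k c z w y l.
by apply: continuous_scaler; exact: kernel_continuous.
Qed.

Definition kernel_field z (w : 'I_d -> V) (l : 'I_d) y : V := kern (@order0 d) z y *: w l.

Lemma test_field_kernel z w : (forall y, `|z - y| <= s -> Omega° y) ->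
  test_field Omega (kernel_field z w).
Proof.
move=> zO; split; first by move=> l; exact: smooth_kernel_field.
exists [set y | `|z - y| <= s]; split => //.
- apply: bounded_closed_compact.
    exists (`|z| + s); split; rewrite ?num_real// => M sM y /= zy.
    rewrite (le_trans _ (ltW sM))// -[y](subrK z) addrC (le_trans (ler_normD _ _))//.
    by rewrite lerD2l distrC.
  rewrite (_ : [set y | _] = (fun y => `|z - y|) @^-1` [set t | t <= s])//.
  apply: closed_comp; last exact: closed_le.
  move=> y _; apply: (@lipschitz_continuous _ _ _ (fun y : Rd => `|z - y|) 1) => // a b.
  rewrite mul1r (le_trans (ler_dist_dist _ _))//.
  by rewrite opprB addrC addrA subrK distrC.
- move=> l y /= zy; rewrite /kernel_field (kernel_eq0 s0 dbeta beta_supp) ?scale0r//.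
  by rewrite ltNge; apply/negP.
Qed.

Lemma divergence_kernel_field z w y :
  divergence (kernel_field z w) y = \sum_l (- kern (incr (@order0 d) l) z y) *: w l.
Proof.
apply: eq_bigr => l _; have := is_derive_kernel_field (@order0 d) 1 z (w l) y l.
under [X in is_derive _ _ X]eq_fun do rewrite mul1r.
by rewrite mulN1r => -[].
Qed.

(** The derivatives fall on the kernel, so [phi] itself need only be continuous. *)
Definition mollify_grad phi z (l : 'I_d) : V :=
  \sum_i mollify beta Omega (fun y => dot (phi y) (e i)) (incr (@order0 d) l) z *: e i.

(* [mollify_grad phi z] is paired with a unit vector [w] by testing [phi] against
   the field with constant direction [w] and the mollifier as its modulus. *)
Lemma mollify_grad_le1 phi z : admissible dot Omega phi ->
  (forall y, `|z - y| <= s -> Omega° y) -> vnorm dot (mollify_grad phi z) <= 1.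
Proof.
move=> [cphi gphi] zO; have zO' y : `|z - y| <= s -> Omega y.
  by move=> /zO; exact: interior_subset.
have cphii i : {within Omega, continuous (fun x => dot (phi x) (e i))}.
  exact: continuous_on_dot.
(* The minus sign arises because the divergence acts on [y] and the mollified gradient on the centre
   [z]. Taking for [w] the negative of the normalised gradient then gives the claim. *)
have key w : vnorm dot w <= 1 -> - vdot dot w (mollify_grad phi z) <= 1.
  move=> w1; rewrite -lee_fin; apply: le_trans gphi.
  apply: ereal_sup_ubound; exists (kernel_field z w).
    split; first exact: test_field_kernel.
    rewrite (eq_integral (fun y => (vnorm dot w)%:E * (kern (@order0 d) z y)%:E)%E); last first.
      move=> y _; rewrite -EFinM /kernel_field vnormZ// ger0_norm 1?mulrC//.
      exact: kernel0_ge0.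
    rewrite ge0_integralZl//; last 3 first.
      apply/measurable_EFinP; apply: measurable_funTS.
      by apply: continuous_measurable_rV; exact: kernel_continuous.
      by move=> y _; rewrite lee_fin kernel0_ge0.
      by rewrite lee_fin vnorm_ge0.
    have := integral_kernel_in s0 dbeta beta_ge0 beta_supp beta1 zO'.
    rewrite /Rintegral => /eqP; rewrite -eqe fineK => [/eqP ->|]; first by rewrite mule1 lee_fin.
    apply: integrable_fin_num => //; apply: within_integrable_rV => //.
    by apply: continuous_subspaceT; exact: kernel_continuous.
  congr EFin; rewrite /vdot -sumrN.
  have E y : dot (phi y) (divergence (kernel_field z w) y) =
      \sum_l \sum_i - (dot (w l) (e i) * (dot (phi y) (e i) * kern (incr (@order0 d) l) z y)).
    rewrite divergence_kernel_field dot_sumr; apply: eq_bigr => l _.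
    rewrite dotZr (dot_basis he) mulr_sumr; apply: eq_bigr => i _; ring.
  under eq_Rintegral do rewrite E.
  have ii l i : leb.-integrable Omega (EFin \o (fun y => - (dot (w l) (e i) *
      (dot (phi y) (e i) * kern (incr (@order0 d) l) z y)))).
    apply: within_integrable_rV => //; rewrite (_ : (fun y => _) =
      (fun=> - dot (w l) (e i)) \* ((fun y => dot (phi y) (e i)) \* kern (incr (@order0 d) l) z)); last first.
      by apply/funext => y /=; rewrite mulNr.
    apply: within_mul; first exact: within_cst.
    apply: within_mul => //; apply: continuous_subspaceT; exact: kernel_continuous.
  rewrite /Rintegral; under eq_integral do (rewrite -sumEFin; under eq_bigr do rewrite -sumEFin).
  rewrite integral_sum//; last by move=> l; apply: integrable_sum => // i _; exact: ii.
  have El l : (\int[leb]_(y in Omega) (\sum_i (- (dot (w l) (e i) *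
      (dot (phi y) (e i) * kern (incr (@order0 d) l) z y)))%:E) =
      (- dot (w l) (mollify_grad phi z l))%:E)%E.
    rewrite integral_sum//; last by move=> i; exact: ii.
    rewrite /mollify_grad dot_sumr -sumrN -sumEFin; apply: eq_bigr => i _.
    rewrite dotZr [X in - X]mulrC -mulNr.
    rewrite /mollify -RintegralZl//; last first.
      exact: (mollify_integrable dbeta cOmega (cphii i)).
    rewrite /Rintegral fineK; last first.
      apply: integrable_fin_num => //; have := ii l i.
      by apply: eq_integrable => // y _; rewrite /= mulNr.
    by apply: eq_integral => y _; rewrite mulNr.
  by under eq_bigr do rewrite El; rewrite sumEFin.
have [//|g1] := leP (vnorm dot (mollify_grad phi z)) 1.
set g := mollify_grad phi z in key g1 *; have g0 : 0 < vnorm dot g by exact: lt_trans g1.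
have := key (fun l => (- (vnorm dot g)^-1) *: g l).
rewrite vnormZ// normrN ger0_norm ?invr_ge0 ?(ltW g0)// mulVf ?gt_eqF// => /(_ (lexx _)).
rewrite [X in - X](_ : _ = - (vnorm dot g)^-1 * vdot dot g g); last first.
  by rewrite /vdot mulr_sumr; apply: eq_bigr => l _; rewrite dotZl.
by rewrite -vnorm_sqr// mulNr opprK expr2 mulKf ?gt_eqF// leNgt g1.
Qed.

End kernel_fields.

Variables (x0 : Rd) (r : R).
Hypotheses (r0 : 0 < r) (x0r : forall y, `|x0 - y| < r -> Omega y).

Let shrink (t : R) x : Rd := x + t *: (x0 - x).

(** A point within [t * r] of [shrink t x] is a convex combination, with weights [t] and [1 - t], of
    a point of the ball about [x0] and of [x]. Halving the radius leaves a neighbourhood, hence the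
    interior. *)
Lemma shrink_interior (t : R) x y : 0 < t -> t <= 1 -> Omega x ->
  `|shrink t x - y| <= t * r / 2 -> Omega° y.
Proof.
move=> t0 t1 Ox zy; have H w : `|shrink t x - w| < t * r -> Omega w.
  move=> zw; have -> : w = t *: (x0 - t^-1 *: (shrink t x - w)) + (1 - t) *: x.
    rewrite scalerBr scalerA divff ?gt_eqF// scale1r /shrink.
    rewrite scalerBr scalerBl scale1r opprB !opprD opprK.
    by apply/rowP => i; rewrite !mxE; ring.
  apply: convex_comb => //; last exact: ltW.
  apply: x0r; rewrite opprB addrC subrK normrZ gtr0_norm ?invr_gt0//.
  by rewrite ltr_pdivrMl.
rewrite /interior/= ; apply/nbhs_ballP; exists (t * r / 2) => /=.
  by rewrite !mulr_gt0.
move=> w; rewrite -ball_normE/= => yw; apply: H.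
rewrite (le_lt_trans (ler_distD y _ _))// [ltRHS]splitr.
exact: ler_ltD.
Qed.

Lemma shrink_near : exists2 D, 0 < D & forall t x y, 0 < t -> Omega x ->
  `|shrink t x - y| <= t * r / 2 -> `|x - y| <= t * D.
Proof.
have [N N0 ON] := compact_norm_bounded cOmega.
exists (r + (`|x0| + N)); first by rewrite addr_gt0// ltr_wpDl.
move=> t x y t0 Ox zy; rewrite (le_trans (ler_distD (shrink t x) _ _))//.
have -> : x - shrink t x = - (t *: (x0 - x)) by rewrite /shrink opprD addNKr.
rewrite normrN normrZ gtr0_norm// mulrDr addrC lerD//.
  by rewrite (le_trans zy)// ler_pdivrMr// ler_peMr ?ler1n// mulr_ge0// ltW.
rewrite ler_pM2l// (le_trans (ler_normB _ _))// lerD2l.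
exact: ON.
Qed.

(* Contracting [Omega] towards an interior point makes room for the mollifier. *)
Theorem admissible_approximation phi (eps : R) : admissible dot Omega phi -> 0 < eps ->
  exists psi G, [/\ C1_with_gradient Omega psi G,
    forall x, Omega x -> vnorm dot (G ^~ x) <= 1,
    forall x, Omega x -> `|psi x - phi x| <= eps &
    forall x y, Omega x -> Omega y -> `|psi x - psi y| <= n%:R * (d%:R * `|x - y|)].
Proof.
move=> aphi eps0; have [cphi gphi] := aphi.
have cphii i : {within Omega, continuous (fun x => dot (phi x) (e i))}.
  exact: continuous_on_dot.
(* [norm_le_coef] loses a factor [n]; the added 1 covers [n = 0]. *)
pose eta := eps / (n%:R + 1).
have eta0 : 0 < eta by rewrite divr_gt0// ltr_wpDl.
have [rho rho0 phirho] := uniformly_continuous_compact cOmega cphi eta0.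
have [D D0 HD] := shrink_near.
(* [t * D < rho] puts all points averaged at [shrink t x] within [rho] of [x], where [phi] varies by
   less than [eta]. *)
pose t := Num.min (2^-1) (rho / (2 * D)).
have t0 : 0 < t by rewrite lt_min invr_gt0 ltr0n divr_gt0// mulr_gt0.
have t1 : t < 1 by rewrite gt_min invf_lt1 ?ltr1n.
have tD : t * D < rho.
  have : t <= rho / (2 * D) by rewrite /t ge_min lexx orbT.
  rewrite ler_pdivlMr ?mulr_gt0// => tD; apply: lt_le_trans tD.
  by rewrite mulrCA ltr_pMl ?ltr1n// mulr_gt0.
pose s := t * r / 2; have s0 : 0 < s by rewrite !mulr_gt0.
have [beta [dbeta beta_ge0 beta_supp beta1]] := bump_exists s0.
have intz x y : Omega x -> `|shrink t x - y| <= s -> Omega° y.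
  by move=> Ox; apply: shrink_interior => //; exact: ltW.
pose m i k z := mollify beta Omega (fun y => dot (phi y) (e i)) k z.
pose psi x := \sum_i m i (@order0 d) (shrink t x) *: e i.
pose G l x := (1 - t) *: mollify_grad beta phi (shrink t x) l.
have g1 x : Omega x -> vnorm dot (mollify_grad beta phi (shrink t x)) <= 1.
  by move=> Ox; apply: (mollify_grad_le1 s0 dbeta beta_ge0 beta_supp beta1 aphi) => y; exact: intz.
have cshrink : continuous (shrink t).
  apply: (@lipschitz_continuous _ _ _ _ (1 - t)); first by rewrite subr_ge0 ltW.
  move=> x y; rewrite (_ : shrink t x - shrink t y = (1 - t) *: (x - y)).
    by rewrite normrZ ger0_norm// subr_ge0 ltW.
  by rewrite /shrink; apply/rowP => i; rewrite !mxE; ring.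
have cm i k : continuous (fun x => m i k (shrink t x)).
  move=> x; apply: continuous_comp; first exact: cshrink.
  exact: (mollify_continuous dbeta beta_supp cOmega (cphii i)).
(* Used twice: with [y - x] a coordinate vector and [u = 0] for the gradient, and on segments inside
   [Omega] for the Lipschitz bound. *)
have dline x y (u : R) i : is_derive u (1 : R)
    (fun u : R => m i (@order0 d) (shrink t (x + u *: (y - x))))
    ((1 - t) * \sum_l (y - x) 0 l * m i (incr (@order0 d) l) (shrink t (x + u *: (y - x)))).
  have E (u' : R) : shrink t (x + u' *: (y - x)) = shrink t x + u' *: ((1 - t) *: (y - x)).
    by rewrite /shrink; apply/rowP => j; rewrite !mxE; ring.
  under [X in is_derive _ _ X]eq_fun do rewrite E.
  have := is_derive_mollify dbeta beta_supp cOmega (cphii i) (@order0 d)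
    (shrink t x) ((1 - t) *: (y - x)) u.
  congr is_derive; rewrite mulr_sumr; apply: eq_bigr => l _.
  by rewrite E mxE mulrA.
exists psi, G; split.
- split; first by apply: continuous_on_comb => i; exact: continuous_subspaceT.
  move=> l; split.
    apply: continuous_onZ; apply: continuous_on_comb => i.
    by apply: continuous_subspaceT; exact: cm.
  move=> x _; apply: line_is_derive.
  have dl i : is_derive (0 : R) (1 : R)
      (fun u : R => m i (@order0 d) (shrink t (x + u *: (delta_mx 0 l : Rd))))
      ((1 - t) * m i (incr (@order0 d) l) (shrink t x)).
    have := dline x (x + delta_mx 0 l) 0 i.
    rewrite (_ : x + delta_mx 0 l - x = delta_mx 0 l); last by rewrite addrAC subrr add0r.
    congr is_derive; congr (_ * _); rewrite scale0r addr0.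
    rewrite (bigD1 l)//= mxE !eqxx mul1r big1 ?addr0// => j jl.
    by rewrite mxE (negbTE jl) mul0r.
  have := is_derive_sum (fun i => is_derive_scalel (e i) (dl i)).
  rewrite (_ : \sum_(i < n) _ = (fun u : R => psi (x + u *: (delta_mx 0 l : Rd)))); last first.
    by apply/funext => u; rewrite fct_sumE.
  congr is_derive; rewrite /G /mollify_grad scaler_sumr; apply: eq_bigr => i _.
  by rewrite scalerA.
- move=> x Ox; rewrite /G vnormZ// ger0_norm ?subr_ge0 ?(ltW t1)//.
  rewrite mulr_ile1 ?subr_ge0 ?(ltW t1) ?vnorm_ge0 ?g1//.
  by rewrite lerBlDr lerDl ltW.
- move=> x Ox; apply: (@le_trans _ _ (n%:R * eta)); last first.
    rewrite /eta mulrCA ler_piMr ?(ltW eps0)// ler_pdivrMr ?ltr_wpDl//.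
    by rewrite mul1r lerDl.
  apply: (norm_le_coef hn he) => i; rewrite dotBl (dot_basis_comb he).
  apply: (mollify_approx s0 dbeta beta_ge0 beta_supp beta1 cOmega (cphii i)); first exact: ltW.
  move=> y zy; have Oy : Omega y by apply: interior_subset; exact: intz zy.
  split => //; rewrite -dotBl (le_trans (coef_le_norm hn he _ _))//.
  by rewrite ltW// distrC phirho// (le_lt_trans (HD _ _ _ t0 Ox zy)).
- move=> x y Ox Oy; apply: (norm_le_coef hn he) => i; rewrite dotBl !(dot_basis_comb he).
  have := @MVT_unit R _ _ (d%:R * `|x - y|) (fun u => dline y x u i).
  rewrite scale1r scale0r addr0 (addrC y) subrK; apply => u u0 u1.
  have Oxy : Omega (y + u *: (x - y)).
    rewrite (_ : _ + _ = u *: x + (1 - u) *: y); first exact: convex_comb.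
    by apply/rowP => j; rewrite !mxE; ring.
  rewrite normrM ger0_norm ?subr_ge0 ?(ltW t1)//.
  apply: (@le_trans _ _ (1 * (\sum_(l < d) `|x - y|))); last first.
    by rewrite mul1r sumr_const card_ord mulr_natl.
  apply: ler_pM => //; first by rewrite subr_ge0 ltW.
    by rewrite lerBlDr lerDl ltW.
  rewrite (le_trans (ler_norm_sum _ _ _))// ler_sum// => l _.
  rewrite normrM -[leRHS]mulr1 ler_pM ?coord_le_norm//.
  rewrite (le_trans _ (g1 _ Oxy))//.
  apply: le_trans (norm_le_vnorm hn _ l).
  have := coef_le_norm hn he (mollify_grad beta phi (shrink t (y + u *: (x - y))) l) i.
  by rewrite (dot_basis_comb he).
Qed.

(** The Lipschitz constant of the approximations does not depend on [eps], so it passes to the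
    limit. *)
Lemma admissible_lipschitz phi x y : admissible dot Omega phi -> Omega x -> Omega y ->
  `|phi x - phi y| <= n%:R * (d%:R * `|x - y|).
Proof.
move=> aphi Ox Oy; apply/ler_addgt0Pr => eps eps0.
have eps2 : 0 < eps / 2 by rewrite divr_gt0.
have [psi [G [_ _ psiphi lip]]] := admissible_approximation aphi eps2.
have := lip x y Ox Oy; have := psiphi x Ox; have := psiphi y Oy.
have -> : phi x - phi y = (psi x - psi y) + ((psi y - phi y) - (psi x - phi x)).
  by rewrite opprB addrA subrKA addrC subrKA.
move=> H1 H2 H3; rewrite (le_trans (ler_normD _ _))// lerD//.
by rewrite (le_trans (ler_normB _ _))// (splitr eps) lerD.
Qed.

(** If [|g x| > eps], then [|g| >= eps / 2] on the ball of radius [s] about [shrink t x]. It lies in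
    [Omega] and its radius does not depend on [x], which bounds the L^2 norm from below
    uniformly. *)
Lemma lipschitz_uniform_of_L2 (C eps : R) : 0 <= C -> 0 < eps ->
  exists2 eta : R, 0 < eta & forall g, continuous_on Omega g ->
    (forall x y, Omega x -> Omega y -> `|g x - g y| <= C * `|x - y|) ->
    inner dot Omega g g <= eta -> forall x, Omega x -> `|g x| <= eps.
Proof.
move=> C0 eps0; have [D D0 HD] := shrink_near.
pose t := Num.min (2^-1) (eps / (2 * D * (C + 1))).
have C1 : 0 < C + 1 by rewrite ltr_wpDl.
have t0 : 0 < t by rewrite lt_min invr_gt0 ltr0n divr_gt0// !mulr_gt0.
have t1 : t < 1 by rewrite gt_min invf_lt1 ?ltr1n.
have tD : C * (t * D) <= eps / 2.
  have : t <= eps / (2 * D * (C + 1)) by rewrite /t ge_min lexx orbT.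
  rewrite ler_pdivlMr ?mulr_gt0// => tD.
  rewrite ler_pdivlMr// (le_trans _ tD)//.
  have : 0 <= t * D by rewrite mulr_ge0// ltW.
  nra.
pose s := t * r / 2; have s0 : 0 < s by rewrite !mulr_gt0.
have [beta [dbeta beta_ge0 beta_supp beta1]] := bump_exists s0.
have [M M0 kM] := kernel_bounded dbeta beta_supp (@order0 d).
(* [M] bounds a kernel of integral 1 supported in that ball; comparing [|g|^2] with this kernel
   avoids computing the volume of the ball. *)
exists ((eps / 2) ^+ 2 / (M + 1)); first by rewrite divr_gt0 ?exprn_gt0 ?divr_gt0// ltr_wpDl.
move=> g cg glip gg x Ox; rewrite leNgt; apply/negP => gx.
pose z := shrink t x.
have zO y : `|z - y| <= s -> Omega y.
  by move=> zy; apply: interior_subset; apply: shrink_interior zy => //; exact: ltW.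
have gy y : `|z - y| <= s -> eps / 2 <= `|g y|.
  move=> zy; have Oy := zO _ zy; have := glip x y Ox Oy.
  have := ler_wpM2l C0 (HD t x y t0 Ox zy); have := ler_normB (g x) (g x - g y).
  rewrite subKr => *.
  have := ler_distD 0 (g x) (g y); rewrite subr0 sub0r normrN => _.
  have : `|g x| <= `|g y| + `|g x - g y|.
    by rewrite -{1}[g x](subrK (g y)) addrC (le_trans (ler_normD _ _)).
  lra.
have kint := integral_kernel_in s0 dbeta beta_ge0 beta_supp beta1 zO.
have ck : {within Omega, continuous (bkernel beta (@order0 d) z)}.
  by apply: continuous_subspaceT; exact: kernel_continuous.
have cgg : {within Omega, continuous (fun x => dot (g x) (g x))} by exact: (within_dot hn he).
have : (eps / 2) ^+ 2 <= M * inner dot Omega g g.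
  have -> : (eps / 2) ^+ 2 = (eps / 2) ^+ 2 * \int[leb]_(y in Omega) bkernel beta (@order0 d) z y.
    by rewrite kint mulr1.
  rewrite /inner -!RintegralZl//; [|exact: within_integrable_rV..].
  rewrite le_Rintegral//.
  - apply: within_integrable_rV => //.
    by apply: within_mul => //; exact: within_cst.
  - apply: within_integrable_rV => //.
    by apply: within_mul => //; exact: within_cst.
  - move=> y Oy; have [zy|zy] := leP `|z - y| s; last first.
      by rewrite (kernel_eq0 s0 dbeta beta_supp)// mulr0 mulr_ge0// dot_normsq// sqr_ge0.
    rewrite mulrC ler_pM ?kernel0_ge0 ?sqr_ge0//.
      by rewrite (le_trans (ler_norm _))// kM.
    by rewrite dot_normsq// ler_pXn2r ?nnegrE ?gy// divr_ge0// ltW.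
apply/negP; rewrite -ltNge (le_lt_trans (ler_wpM2l M0 gg))//.
rewrite mulrCA -[ltRHS]mulr1 ltr_pM2l ?exprn_gt0 ?divr_gt0//.
by rewrite ltr_pdivrMr ?ltr_wpDl// mul1r ltrDl.
Qed.

End admissible_potentials.

(** * Integration by parts *)

Section integration_by_parts.
Variables (R : realType) (d n : nat) (V : normedModType R).
Variables (dot : {dot V for idfun}) (e : 'I_n -> V) (Omega : set 'rV[R]_d).
Hypotheses (hn : norm_of_dot dot) (he : orthonormal_basis dot e).
Hypotheses (cOmega : compact Omega).
Local Notation Rd := 'rV[R]_d.
Local Notation leb := (@lebesgue_rV R d).

Let mO : measurable Omega := compact_measurable_rV cOmega.

Lemma near_notin_compact (K : set Rd) x : compact K -> ~ K x -> \forall y \near x, ~ K y.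
Proof.
move=> cK Kx; have oK : open (~` K).
  by rewrite openC; apply: compact_closed => //; exact: norm_hausdorff.
exact: open_nbhs_nbhs.
Qed.

(** The integrand below is known to be continuous within [Omega] only, while
    [integral_partial_derivative0] runs along whole lines. *)
Lemma continuous_of_support (W : normedModType R) (K : set Rd) (f : Rd -> W) :
  compact K -> K `<=` Omega° -> {within Omega, continuous f} ->
  (forall x, ~ K x -> f x = 0) -> continuous f.
Proof.
move=> cK KO cf fK x; have [Kx|Kx] := pselect (K x).
  have : {within Omega°, continuous f} by exact: continuous_subspaceW (@interior_subset _ _) cf.
  rewrite continuous_open_subspace; last exact: open_interior.
  by apply; apply/mem_set; exact: KO.
rewrite /continuous_at (fK _ Kx); apply: (@cvg_near_cst _ _ 0 f (nbhs x)).
by apply: filterS (near_notin_compact cK Kx) => y; exact: fK.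
Qed.

Lemma is_derive_near0 (W : normedModType R) (f : Rd -> W) x u :
  (\forall y \near x, f y = 0) -> is_derive x u f 0.
Proof.
move=> f0; have H : is_derive x u (cst (0 : W)) (0 : W) by exact: is_derive_cst.
by apply: near_eq_is_derive H; apply: filterS f0 => y ->.
Qed.

Lemma is_derive_dotl (f : Rd -> V) (v : V) x u df :
  is_derive x u f df -> is_derive x u (fun y => dot (f y) v : R) (dot df v).
Proof.
move=> [/cvg_ex[l fl] dfE].
have H : h^-1 *: (((fun y => dot (f y) v : R) \o shift x) (h *: u) - dot (f x) v)
    @[h --> 0^'] --> (dot df v : R).
  rewrite (_ : (fun h => _) = (fun h => dot (h^-1 *: ((f \o shift x) (h *: u) - f x)) v)).
    have fdf : h^-1 *: ((f \o shift x) (h *: u) - f x) @[h --> 0^'] --> df.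
      by rewrite -dfE /derive (cvg_lim _ fl).
    have cv : continuous (fun w => dot w v : R) by exact: dot_continuous.
    exact: (continuous_cvg _ (cv df) fdf).
  by apply/funext => h; rewrite /= dotZl dotBl.
split; first by apply/cvg_ex; exists (dot df v).
exact: cvg_lim.
Qed.

Lemma is_derive_dot (f g : Rd -> V) x u df dg : is_derive x u f df -> is_derive x u g dg ->
  is_derive x u (fun y => dot (f y) (g y) : R) (dot df (g x) + dot (f x) dg).
Proof.
move=> hf hg.
have := is_derive_sum (fun i => is_deriveM (is_derive_dotl (e i) hf) (is_derive_dotl (e i) hg)).
rewrite (_ : \sum_(i < n) _ = (fun y => dot (f y) (g y) : R)); last first.
  by apply/funext => y; rewrite fct_sumE (dot_basis he).
congr is_derive; rewrite addrC !(dot_basis he) -big_split/=; apply: eq_bigr => i _.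
by rewrite [X in _ = _ + X]mulrC.
Qed.

(* [dot (phi x) (psi l x)] is supported in the interior, so that its partial
   derivative in direction [l] integrates to zero. *)
Lemma C1_integration_by_parts phi G psi : C1_with_gradient Omega phi G -> test_field Omega psi ->
  \int[leb]_(x in Omega) dot (phi x) (divergence psi x) =
  - \int[leb]_(x in Omega) vdot dot (G ^~ x) (psi ^~ x).
Proof.
move=> [cphi CG] [spsi [K [cK KO psi0]]].
pose D l x := 'D_(delta_mx 0 l : Rd) (psi l) x.
have cpsi l : continuous (psi l) by have [] := spsi l [::].
have dpsi l x : is_derive x (delta_mx 0 l : Rd) (psi l) (D l x).
  by apply: DeriveDef => //; have [_] := spsi l [::]; exact.
have cD l : continuous (D l) by have [] := spsi l [:: l].
have D0 l x : ~ K x -> D l x = 0.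
  move=> Kx; have [_ <-] : is_derive x (delta_mx 0 l : Rd) (psi l) 0.
    by apply: is_derive_near0; apply: filterS (near_notin_compact cK Kx) => y; exact: psi0.
  by [].
pose F l x := dot (G l x) (psi l x) + dot (phi x) (D l x).
have cG l : continuous_on Omega (G l) by have [] := CG l.
have wpsi l : continuous_on Omega (psi l) by exact: continuous_subspaceT.
have wD l : continuous_on Omega (D l) by exact: continuous_subspaceT.
have wGpsi l : {within Omega, continuous (fun x => dot (G l x) (psi l x))}.
  exact: (within_dot hn he).
have wphiD l : {within Omega, continuous (fun x => dot (phi x) (D l x))}.
  exact: (within_dot hn he).
have wF l : {within Omega, continuous (F l)} by exact: within_add.
have F0 l x : ~ K x -> F l x = 0.
  by move=> Kx; rewrite /F psi0// D0// !(dotC dot _ 0) !dot0l addr0.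
have cF l : continuous (F l) by exact: continuous_of_support (F0 l).
have [N N0 KN] := compact_norm_bounded cK.
have NK y : N < `|y| -> ~ K y by move=> Ny /KN; rewrite leNgt Ny.
have iF l : \int[leb]_(x in Omega) F l x = 0.
  have [M M0 FM] := within_continuous_bounded cK (continuous_subspaceT (A := K) (cF l)).
  rewrite /Rintegral integral_mkcond.
  rewrite (eq_integral (fun x => (F l x)%:E)); last first.
    move=> x _; rewrite patchE; case: ifPn => // /negP Ox; rewrite F0// => /KO Kx.
    by apply: Ox; apply/mem_set; exact: interior_subset Kx.
  rewrite (_ : \int[leb]_x _ = 0)%E//.
  apply: (@integral_partial_derivative0 R d (fun x => dot (phi x) (psi l x)) (F l) l M N) => //.
  - move=> y; have [Ky|Ky] := pselect (K y).
      by apply: is_derive_dot => //; have [_] := CG l; apply; exact: KO.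
    rewrite F0//; apply: is_derive_near0; apply: filterS (near_notin_compact cK Ky) => z Kz.
    by rewrite psi0// dotC dot0l.
  - move=> y; have [Ky|Ky] := pselect (K y); first exact: FM.
    by rewrite F0// normr0.
  - by move=> y /NK Ky; rewrite F0// psi0// dotC dot0l.
have iOn (u : Rd -> R) : {within Omega, continuous u} -> leb.-integrable Omega (EFin \o u).
  exact: within_integrable_rV.
have wdiv : {within Omega, continuous (fun x => dot (phi x) (divergence psi x))}.
  by apply: (within_dot hn he) => //; apply: continuous_on_sum.
have wv : {within Omega, continuous (fun x => vdot dot (G ^~ x) (psi ^~ x))}.
  exact: within_sum.
apply/eqP; rewrite -addr_eq0 -RintegralD//; [|exact: iOn..].
have E x : dot (phi x) (divergence psi x) + vdot dot (G ^~ x) (psi ^~ x) = \sum_l F l x.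
  by rewrite big_split/= addrC /divergence dot_sumr.
under eq_Rintegral do rewrite E.
rewrite /Rintegral; under eq_integral do rewrite -sumEFin.
rewrite integral_sum//; last by move=> l; exact: iOn.
rewrite big1// => l _; have := iF l; rewrite /Rintegral => /eqP; rewrite -eqe fineK => [/eqP//|].
by apply: integrable_fin_num => //; exact: iOn.
Qed.

(** After integration by parts, Cauchy-Schwarz under the integral. A bound in the interior suffices
    because test fields vanish elsewhere. *)
Lemma C1_admissible phi G : C1_with_gradient Omega phi G ->
  (forall x, Omega° x -> vnorm dot (G ^~ x) <= 1) -> admissible dot Omega phi.
Proof.
move=> C1 G1; split; first by case: C1.
apply: ge_ereal_sup => _ [psi [tpsi psi1] <-]; rewrite lee_fin.
rewrite (C1_integration_by_parts C1 tpsi).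
have [spsi [K [cK KO psi0]]] := tpsi; have [_ CG] := C1.
have wpsi l : continuous_on Omega (psi l).
  by apply: continuous_subspaceT; have [] := spsi l [::].
have wv : {within Omega, continuous (fun x => vdot dot (G ^~ x) (psi ^~ x))}.
  by apply: within_sum => l; apply: (within_dot hn he) => //; have [] := CG l.
have wn : {within Omega, continuous (fun x => vnorm dot (psi ^~ x))}.
  exact: (within_vnorm hn he).
have le1 : \int[leb]_(x in Omega) vnorm dot (psi ^~ x) <= 1.
  rewrite -lee_fin /Rintegral fineK//.
  by apply: integrable_fin_num => //; exact: within_integrable_rV.
apply: le_trans le1; rewrite -mulN1r -RintegralZl//; last exact: within_integrable_rV.
apply: le_Rintegral => //.
- apply: within_integrable_rV => //.
  by apply: within_mul => //; exact: within_cst.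
- exact: within_integrable_rV.
- move=> x Ox; have [Kx|Kx] := pselect (K x); last first.
    by rewrite /vdot big1 ?mulr0 ?vnorm_ge0// => l _; rewrite psi0// dotC dot0l.
  have := vdot_cauchy hn (G ^~ x) (fun l => - 1 *: psi l x).
  rewrite vnormZ// normrN normr1 mul1r => H.
  rewrite (_ : _ * _ = vdot dot (G ^~ x) (fun l => - 1 *: psi l x)); last first.
    by rewrite /vdot mulr_sumr; apply: eq_bigr => l _; rewrite dotZr.
  by rewrite (le_trans H)// ler_piMl ?vnorm_ge0// G1//; exact: KO.
Qed.

End integration_by_parts.

(** * The dual problem *)

Section dual_problem.
Variables (R : realType) (d n : nat) (V : normedModType R).
Variables (dot : {dot V for idfun}) (e : 'I_n -> V) (Omega : set 'rV[R]_d).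
Hypotheses (hn : norm_of_dot dot) (he : orthonormal_basis dot e).
Hypotheses (cOmega : compact Omega) (convO : convex_set Omega) (intO : Omega° !=set0).
Local Notation Rd := 'rV[R]_d.
Local Notation leb := (@lebesgue_rV R d).
Local Notation L2 := (L2 dot e Omega).
Local Notation inner := (inner dot Omega).
Local Notation admissible := (admissible dot Omega).
Implicit Types (f g phi psi : Rd -> V) (x y : Rd).

Let mO : measurable Omega := compact_measurable_rV cOmega.

(** [C] is the integral of [1 + |f|^2], which dominates [|f|]; an L^1 bound is enough here. *)
Lemma inner_le_sup f : L2 f -> exists2 C, 0 <= C & forall g (eps : R), L2 g ->
  (forall x, Omega x -> `|g x| <= eps) -> inner g f <= eps * C.
Proof.
move=> Lf; pose u x := 1 + dot (f x) (f x).
have iu : leb.-integrable Omega (EFin \o u).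
  have i1 : leb.-integrable Omega (EFin \o (fun=> 1 : R)).
    by apply: within_integrable_rV => //; exact: within_cst.
  by have := integrableD mO i1 (L2_dot_integrable hn he cOmega Lf Lf).
exists (\int[leb]_(x in Omega) u x).
  by apply: Rintegral_ge0 => x _; rewrite addr_ge0// dot_normsq// sqr_ge0.
move=> g eps Lg geps; rewrite -RintegralZl//; apply: le_Rintegral => //.
- exact: (L2_dot_integrable hn he cOmega).
- by have := integrableZl mO eps iu.
- move=> x Ox; rewrite (le_trans (dot_cauchy hn _ _))// /u dot_normsq//.
  have := geps x Ox; have := normr_ge0 (f x); have := normr_ge0 (g x).
  move=> a0 b0 ab; apply: ler_pM => //.
  by have := sqr_ge0 (`|f x| - 2^-1); nra.
Qed.

Lemma L2_divergence (psi : 'I_d -> Rd -> V) : test_field Omega psi -> L2 (divergence psi).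
Proof.
move=> [spsi _]; apply: (L2_continuous_on hn he cOmega).
apply: continuous_on_sum => l; apply: continuous_subspaceT.
by have [] := spsi l [:: l].
Qed.

(** Replaces a supremum in [\bar R] by real inequalities linear in [phi], from which convexity and
    closedness follow. *)
Lemma admissibleP phi : continuous_on Omega phi -> admissible phi <->
  forall psi : 'I_d -> Rd -> V, test_field Omega psi ->
    (\int[leb]_(x in Omega) (vnorm dot (psi ^~ x))%:E <= 1)%E -> inner phi (divergence psi) <= 1.
Proof.
move=> cphi; split=> [[_ g1] psi tpsi psi1|H].
  by rewrite -lee_fin; apply: le_trans g1; apply: ereal_sup_ubound; exists psi.
by split => //; apply: ge_ereal_sup => _ [psi [tpsi psi1] <-]; rewrite lee_fin; exact: H.
Qed.

Lemma admissible0 : admissible (fun=> 0).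
Proof.
apply/admissibleP; first exact: continuous_on0.
move=> psi _ _; rewrite /inner /Rintegral integral0_eq// => x _.
by rewrite dot0l.
Qed.

Lemma admissible_L2 phi : admissible phi -> L2 phi.
Proof. by move=> [cphi _]; exact: (L2_continuous_on hn he cOmega). Qed.

Lemma admissible_conv (t : R) phi psi : 0 <= t -> t <= 1 -> admissible phi -> admissible psi ->
  admissible (fun x => t *: phi x + (1 - t) *: psi x).
Proof.
move=> t0 t1 aphi apsi; have [[cphi _] [cpsi _]] := (aphi, apsi).
have cc : continuous_on Omega (fun x => t *: phi x + (1 - t) *: psi x).
  by apply: continuous_onD; exact: continuous_onZ.
apply/(admissibleP cc) => f tf f1; have Lf := L2_divergence tf.
have [Lphi Lpsi] := (admissible_L2 aphi, admissible_L2 apsi).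
rewrite (innerDl hn he cOmega)//; [|exact: (L2Z hn he cOmega)..].
rewrite !(innerZl hn he cOmega)//.
have := (admissibleP cphi).1 aphi f tf f1; have := (admissibleP cpsi).1 apsi f tf f1.
nra.
Qed.

Lemma admissible_closed phi : continuous_on Omega phi ->
  (forall eps : R, 0 < eps -> exists2 psi, admissible psi &
    forall x, Omega x -> `|psi x - phi x| <= eps) -> admissible phi.
Proof.
move=> cphi H; apply/(admissibleP cphi) => f tf f1; have Lf := L2_divergence tf.
have [C C0 HC] := inner_le_sup Lf; have Lphi := L2_continuous_on hn he cOmega cphi.
apply/ler_addgt0Pr => eps eps0; have C1 : 0 < C + 1 by rewrite ltr_wpDl.
have [psi apsi psiphi] := H (eps / (C + 1)) (divr_gt0 eps0 C1).
have Lpsi := admissible_L2 apsi; have [cpsi _] := apsi.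
have := HC (fun x => phi x - psi x) (eps / (C + 1)) (L2B hn he cOmega Lphi Lpsi).
rewrite (innerBl hn he cOmega)// => le1.
have {}le1 : inner phi (divergence f) - inner psi (divergence f) <= eps / (C + 1) * C.
  by apply: le1 => x Ox; rewrite distrC psiphi.
have := (admissibleP cpsi).1 apsi f tf f1.
have : eps / (C + 1) * C <= eps.
  by rewrite -mulrA ler_piMr ?(ltW eps0)// ler_pdivrMl// mulr1 lerDl.
lra.
Qed.

(** [V] comes without a completeness assumption, so limits are taken coefficientwise in the basis,
    at the cost of a factor [n]. *)
Lemma uniform_limit (F : nat -> Rd -> V) :
  (forall k, continuous_on Omega (F k)) ->
  (forall eps : R, 0 < eps -> exists N, forall k m, (N <= k)%N -> (N <= m)%N ->
    forall x, Omega x -> `|F k x - F m x| <= eps) ->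
  exists2 f, continuous_on Omega f & forall eps : R, 0 < eps -> exists N, forall k, (N <= k)%N ->
    forall x, Omega x -> `|F k x - f x| <= eps.
Proof.
move=> cF uF; pose u i x : R^nat := fun k => dot (F k x) (e i).
have cu i x : Omega x -> cvgn (u i x).
  move=> Ox; apply/cauchy_cvgP; apply/cauchyP => eps eps0.
  have [N NP] := uF _ (divr_gt0 eps0 (ltr0Sn R 1)); exists (u i x N); exists N => // k Nk.
  rewrite -ball_normE/= /u -dotBl (le_lt_trans (coef_le_norm hn he _ _))//.
  by rewrite (le_lt_trans (NP _ _ (leqnn N) Nk x Ox))// gtr_pMr// invf_lt1// ltr1n.
pose f x := \sum_i limn (u i x) *: e i.
have Ff (eps : R) : 0 < eps -> exists N, forall k, (N <= k)%N ->
    forall x, Omega x -> `|F k x - f x| <= eps.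
  move=> eps0; have n1 : 0 < n%:R + 1 :> R by rewrite ltr_wpDl.
  have [N NF] := uF _ (divr_gt0 eps0 n1); exists N => k Nk x Ox.
  apply: (@le_trans _ _ (n%:R * (eps / (n%:R + 1)))); last first.
    by rewrite mulrCA ler_piMr ?(ltW eps0)// ler_pdivrMr// mul1r lerDl.
  apply: (norm_le_coef hn he) => i; rewrite dotBl (dot_basis_comb he).
  apply/ler_addgt0Pr => r r0.
  have /cvgrPdist_lt/(_ _ r0)[N' _ N'P] := cu i x Ox; pose m := maxn N N'.
  have := N'P m (leq_maxr _ _); rewrite distrC => /= H2.
  rewrite (le_trans (ler_distD (u i x m) _ _))// lerD ?(ltW H2)//.
  by rewrite /u -dotBl (le_trans (coef_le_norm hn he _ _))// NF// leq_maxl.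
exists f => //; apply/within_continuousP => x Ox eps eps0.
have eps3 : 0 < eps / 4 by rewrite divr_gt0.
have [N NF] := Ff _ eps3.
have /within_continuousP/(_ x Ox _ eps3)[r r0 Hr] := cF N.
exists r => // y Oy xy.
have := Hr y Oy xy; have := NF N (leqnn _) x Ox; have := NF N (leqnn _) y Oy.
have := ler_distD (F N x) (f x) (f y); have := ler_distD (F N y) (F N x) (f y).
rewrite (distrC (f x) (F N x)); lra.
Qed.

Variables (w : Rd -> V) (c : R).
Hypotheses (Lw : L2 w) (c0 : 0 < c).
Let D phi := inner phi w - c * inner phi phi.

(** The linear term is affine along the segment, so the gain at the midpoint comes from the
    quadratic term alone. The weights have the shape of [admissible_conv]. *)
Lemma objective_parallelogram phi psi : L2 phi -> L2 psi ->
  D (fun x => 2^-1 *: phi x + (1 - 2^-1) *: psi x) =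
  2^-1 * (D phi + D psi) + c / 4 * inner (fun x => phi x - psi x) (fun x => phi x - psi x).
Proof.
move=> Lphi Lpsi; rewrite /D.
have LZ (a : R) f : L2 f -> L2 (fun x => a *: f x) by exact: (L2Z hn he cOmega).
have LB := L2B hn he cOmega Lphi Lpsi.
have LD := L2D hn he cOmega (LZ 2^-1 _ Lphi) (LZ (1 - 2^-1) _ Lpsi).
have [L1 L2'] := (LZ 2^-1 _ Lphi, LZ (1 - 2^-1) _ Lpsi).
rewrite (innerDl hn he cOmega L1 L2' Lw) (innerDl hn he cOmega L1 L2' LD).
rewrite (innerBl hn he cOmega Lphi Lpsi LB).
rewrite (innerBr hn he cOmega Lphi Lpsi Lphi) (innerBr hn he cOmega Lphi Lpsi Lpsi).
rewrite (innerDr hn he cOmega L1 L2' L1) (innerDr hn he cOmega L1 L2' L2').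
rewrite !(innerZr hn he cOmega)// !(innerZl hn he cOmega)// (innerC dot Omega psi phi).
by field.
Qed.

(** Completing the square around [(2 * c)^-1 *: w], the maximizer without the gradient
    constraint. *)
Lemma objective_bounded phi : L2 phi -> D phi <= (4 * c)^-1 * inner w w.
Proof.
move=> Lphi; pose a := (2 * c)^-1.
have La := L2Z hn he cOmega a Lw; have LB := L2B hn he cOmega Lphi La.
have := inner_ge0 Omega hn (fun x => phi x - a *: w x).
rewrite (innerBl hn he cOmega Lphi La LB).
rewrite (innerBr hn he cOmega Lphi La Lphi) (innerBr hn he cOmega Lphi La La).
rewrite !(innerZr hn he cOmega)// !(innerZl hn he cOmega)// (innerC dot Omega w phi).
move=> H; have {H} := mulr_ge0 (ltW c0) H; rewrite /D -subr_ge0.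
move=> H; rewrite -subr_ge0; apply: le_trans H _; rewrite subr0 le_eqVlt; apply/orP; left.
apply/eqP; rewrite /a; field.
by rewrite gt_eqF.
Qed.

(** A Lipschitz constant for the difference of two admissible potentials. *)
Let lip : R := n%:R * d%:R + n%:R * d%:R.

Lemma admissible_uniform_of_L2 (eps : R) : 0 < eps ->
  exists2 eta : R, 0 < eta & forall phi psi, admissible phi -> admissible psi ->
    inner (fun x => phi x - psi x) (fun x => phi x - psi x) <= eta ->
    forall x, Omega x -> `|phi x - psi x| <= eps.
Proof.
move=> eps0; have [x0 /nbhs_ballP[r r0 x0r]] := intO.
have {}x0r y : `|x0 - y| < r -> Omega y.
  by move=> xy; apply: x0r; rewrite -ball_normE.
have lip0 : 0 <= lip by rewrite addr_ge0// mulr_ge0.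
have [eta eta0 H] := lipschitz_uniform_of_L2 hn he cOmega convO r0 x0r lip0 eps0.
exists eta => // phi psi aphi apsi phipsi; apply: H phipsi.
  by case: aphi => ? _; case: apsi => ? _; exact: continuous_onB.
move=> x y Ox Oy.
have -> : phi x - psi x - (phi y - psi y) = (phi x - phi y) - (psi x - psi y).
  by rewrite !opprB addrACA [RHS]addrACA (addrC (- psi x)).
rewrite (le_trans (ler_normB _ _))// mulrDl -!mulrA lerD//.
  exact: (admissible_lipschitz hn he cOmega convO r0 x0r).
exact: (admissible_lipschitz hn he cOmega convO r0 x0r).
Qed.

Theorem dual_unique phi psi : admissible phi -> admissible psi ->
  (forall f, admissible f -> D f <= D phi) -> D phi = D psi ->
  forall x, Omega x -> phi x = psi x.
Proof.
move=> aphi apsi maxphi DE x Ox; apply/eqP; rewrite -subr_eq0 -normr_le0.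
apply/ler_addgt0Pr => eps eps0; rewrite add0r.
have [eta eta0 H] := admissible_uniform_of_L2 eps0; apply: H => //.
have h0 : 0 <= 2^-1 :> R by rewrite invr_ge0.
have h1 : 2^-1 <= 1 :> R by rewrite invf_le1// ler1n.
have := maxphi _ (admissible_conv h0 h1 aphi apsi).
rewrite objective_parallelogram; [|exact: admissible_L2..].
rewrite -DE; set q := inner _ _ => H.
have : c / 4 * q <= 0 by lra.
rewrite pmulr_rle0 ?divr_gt0// => q0.
by rewrite (le_trans q0)// ltW.
Qed.

Theorem dual_max : exists2 phi, admissible phi & forall f, admissible f -> D f <= D phi.
Proof.
pose S := [set D f | f in admissible].
have supS : has_sup S.
  split; first by exists (D (fun=> 0)), (fun=> 0) => //; exact: admissible0.
  exists ((4 * c)^-1 * inner w w) => _ [f af <-]; apply: objective_bounded.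
  exact: admissible_L2.
have DS f : admissible f -> D f <= sup S by move=> af; apply: sup_upper_bound => //; exists f.
have /choice[F FP] (k : nat) : exists f, admissible f /\ sup S - k.+1%:R^-1 < D f.
  have k0 : 0 < k.+1%:R^-1 :> R by rewrite invr_gt0.
  by have [_ [f af <-] Df] := sup_adherent k0 supS; exists f.
have aF k : admissible (F k) by have [] := FP k.
have h0 : 0 <= 2^-1 :> R by rewrite invr_ge0.
have h1 : 2^-1 <= 1 :> R by rewrite invf_le1// ler1n.
have smallN (eps : R) : 0 < eps -> exists N, forall k, (N <= k)%N -> k.+1%:R^-1 <= eps.
  move=> eps0; have := @near_infty_natSinv_lt R (PosNum eps0) => -[N _ NP].
  by exists N => k Nk; exact/ltW/NP.
have uF (eps : R) : 0 < eps -> exists N, forall k m, (N <= k)%N -> (N <= m)%N ->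
    forall x, Omega x -> `|F k x - F m x| <= eps.
  move=> eps0; have [eta eta0 H] := admissible_uniform_of_L2 eps0.
  (* If both values are within [c / 4 * eta] of the supremum, the gain [c / 4 * q] at the midpoint
     cannot exceed this amount. *)
  have e0 : 0 < c / 4 * eta by rewrite !mulr_gt0.
  have [N NP] := smallN _ e0; exists N => k m Nk Nm; apply: H => //.
  have := DS _ (admissible_conv h0 h1 (aF k) (aF m)).
  rewrite objective_parallelogram; [|exact: admissible_L2..].
  have [_ Dk] := FP k; have [_ Dm] := FP m; have := NP _ Nk; have := NP _ Nm.
  move: Dk Dm; set q := inner _ _; move: (D (F k)) (D (F m)) (k.+1%:R^-1) (m.+1%:R^-1) (sup S).
  move=> *; have : c / 4 * q <= c / 4 * eta by lra.
  by rewrite ler_pM2l// divr_gt0.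
have [phi cphi Fphi] := uniform_limit (fun k => (aF k).1) uF.
have aphi : admissible phi.
  apply: admissible_closed => // eps eps0; have [N NP] := Fphi _ eps0.
  by exists (F N) => //; exact: NP.
exists phi => // f af; rewrite (le_trans (DS f af))//; apply/ler_addgt0Pr => eps eps0.
have Lphi := admissible_L2 aphi.
have [Cw Cw0 HCw] := inner_le_sup Lw; have [Cp Cp0 HCp] := inner_le_sup Lphi.
(* By convexity [- |F N|^2 <= - |phi|^2 + 2 <phi - F N, phi>], so [D (F N) - D phi] is at most
   [t * Cw + 2 * c * (t * Cp)], with constants independent of [N]. The other half of [eps] pays for
   [sup S - D (F N)]. *)
pose t := eps / 2 / (Cw + 2 * c * Cp + 1).
have C1 : 0 < Cw + 2 * c * Cp + 1 by rewrite ltr_wpDl// addr_ge0// !mulr_ge0// ltW.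
have t0 : 0 < t by rewrite !divr_gt0.
have [N1 N1P] := smallN _ (divr_gt0 eps0 (ltr0Sn R 1)).
have [N2 N2P] := Fphi _ t0; pose N := maxn N1 N2.
have LN := admissible_L2 (aF N); have LB := L2B hn he cOmega LN Lphi.
have LB' := L2B hn he cOmega Lphi LN.
have Nt x : Omega x -> `|F N x - phi x| <= t by apply: N2P; exact: leq_maxr.
have := HCw _ t LB Nt; rewrite (innerBl hn he cOmega LN Lphi Lw) => H1.
have := HCp (fun x => phi x - F N x) t LB'; rewrite (innerBl hn he cOmega Lphi LN Lphi) => H2.
have {}H2 := H2 (fun x Ox => eq_ind _ (fun a => a <= t) (Nt x Ox) _ (distrC _ _)).
have := inner_ge0 Omega hn (fun x => F N x - phi x).
rewrite (innerBl hn he cOmega LN Lphi LB).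
rewrite (innerBr hn he cOmega LN Lphi LN) (innerBr hn he cOmega LN Lphi Lphi).
rewrite (innerC dot Omega phi (F N)) => H3.
have tC : t * Cw + 2 * c * (t * Cp) <= eps / 2.
  rewrite (_ : _ + _ = t * (Cw + 2 * c * Cp)); last by ring.
  rewrite /t -mulrA ler_piMr ?divr_ge0 ?(ltW eps0)// ler_pdivrMl// mulr1.
  by rewrite lerDl.
have [_ DN] := FP N; have := N1P N (leq_maxl _ _).
have := mulr_ge0 (ltW c0) H3; have := ler_wpM2l (ltW c0) H2; move: DN H1 tC; rewrite /D.
clearbody t; move: (sup S) (N.+1%:R^-1) => s r; lra.
Qed.

(** [w - 2 * c * phi] is the gradient of [D] at [phi]. Optimality at parameter [t] of the segment
    towards [psi] leaves the error [t * (c * |psi - phi|^2)], and [t] tends to 0. *)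
Theorem dual_first_order phi psi : admissible phi -> admissible psi ->
  (forall f, admissible f -> D f <= D phi) ->
  inner psi (fun x => w x - (2 * c) *: phi x) <= inner phi (fun x => w x - (2 * c) *: phi x).
Proof.
move=> aphi apsi maxphi; have [Lphi Lpsi] := (admissible_L2 aphi, admissible_L2 apsi).
have LZ (a : R) f : L2 f -> L2 (fun x => a *: f x) by exact: (L2Z hn he cOmega).
have L2c := LZ (2 * c) _ Lphi.
rewrite (innerBr hn he cOmega Lw L2c Lpsi) (innerBr hn he cOmega Lw L2c Lphi).
rewrite !(innerZr hn he cOmega)//.
pose h := fun x => psi x - phi x.
set A := inner psi w; set B := inner psi phi; set A' := inner phi w; set B' := inner phi phi.
pose C := inner psi psi - 2 * B + B'.
have C0 : 0 <= C.
  have := inner_ge0 Omega hn (fun x => psi x - phi x).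
  have LB := L2B hn he cOmega Lpsi Lphi.
  rewrite (innerBl hn he cOmega Lpsi Lphi LB).
  rewrite (innerBr hn he cOmega Lpsi Lphi Lpsi) (innerBr hn he cOmega Lpsi Lphi Lphi).
  by rewrite (innerC dot Omega phi psi) -/A -/B -/B' /C => H; lra.
have key (t : R) : 0 < t -> t <= 1 -> A - 2 * c * B - (A' - 2 * c * B') <= t * (c * C).
  move=> t0 t1; have := maxphi _ (admissible_conv (ltW t0) t1 apsi aphi).
  have [L1 L2'] := (LZ t _ Lpsi, LZ (1 - t) _ Lphi).
  have LD := L2D hn he cOmega L1 L2'.
  rewrite /D (innerDl hn he cOmega L1 L2' Lw) (innerDl hn he cOmega L1 L2' LD).
  rewrite (innerDr hn he cOmega L1 L2' L1) (innerDr hn he cOmega L1 L2' L2').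
  rewrite !(innerZr hn he cOmega)// !(innerZl hn he cOmega)// (innerC dot Omega phi psi).
  rewrite -/A -/B -/A' -/B' => H; rewrite -(ler_pM2l t0) -subr_ge0.
  move: H; rewrite -subr_ge0 => H; apply: le_trans H _; rewrite /C le_eqVlt; apply/orP; left.
  by apply/eqP; ring.
have cC0 : 0 <= c * C by rewrite mulr_ge0// ltW.
rewrite -subr_le0; apply/ler_addgt0Pr => eps eps0; rewrite add0r.
(* The parameter [eps / (c * C)] is usable only if it is at most 1; otherwise [t = 1] suffices. *)
have [le1|lt1] := leP (c * C) eps.
  by rewrite (le_trans (key 1 _ _))// mul1r.
have cC : 0 < c * C by exact: lt_trans lt1.
rewrite (le_trans (key (eps / (c * C)) _ _))//.
- by rewrite divr_gt0.
- by rewrite ler_pdivrMr// mul1r ltW.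
- by rewrite divfK// gt_eqF.
Qed.

End dual_problem.

(** * Flows *)

Section flows.
Variables (R : realType) (d n : nat) (V : normedModType R).
Variables (dot : {dot V for idfun}) (e : 'I_n -> V) (Omega : set 'rV[R]_d).
Hypotheses (hn : norm_of_dot dot) (he : orthonormal_basis dot e).
Hypotheses (cOmega : compact Omega) (convO : convex_set Omega) (intO : Omega° !=set0).
Local Notation Rd := 'rV[R]_d.
Local Notation leb := (@lebesgue_rV R d).
Local Notation L2 := (L2 dot e Omega).
Local Notation inner := (inner dot Omega).
Local Notation admissible := (admissible dot Omega).
Local Notation field := ('I_d -> Rd -> V).
Implicit Types (phi : Rd -> V) (G H : field) (x y : Rd).

Lemma C1_with_gradient0 : C1_with_gradient Omega (fun=> 0 : V) (fun _ _ => 0).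
Proof.
split; first exact: continuous_on0.
move=> l; split; first exact: continuous_on0.
by move=> x _; exact: is_derive_cst.
Qed.

Lemma C1_with_gradientD phi1 phi2 G1 G2 :
  C1_with_gradient Omega phi1 G1 -> C1_with_gradient Omega phi2 G2 ->
  C1_with_gradient Omega (fun x => phi1 x + phi2 x) (fun l x => G1 l x + G2 l x).
Proof.
move=> [c1 d1] [c2 d2]; split; first exact: continuous_onD.
move=> l; have [[cG1 dG1] [cG2 dG2]] := (d1 l, d2 l); split; first exact: continuous_onD.
by move=> x Ox; exact: (is_deriveD (dG1 x Ox) (dG2 x Ox)).
Qed.

Lemma C1_with_gradientZ (a : R) phi G : C1_with_gradient Omega phi G ->
  C1_with_gradient Omega (fun x => a *: phi x) (fun l x => a *: G l x).
Proof.
move=> [c1 d1]; split; first exact: continuous_onZ.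
move=> l; have [cG dG] := d1 l; split; first exact: continuous_onZ.
by move=> x Ox; exact: (is_deriveZ a (dG x Ox)).
Qed.

Let continuous_field : set field := [set psi | forall l, continuous_on Omega (psi l)].

Let supnorm (psi : field) : R := sup [set vnorm dot (psi ^~ x) | x in Omega].

Lemma supnorm_ge (psi : field) x : continuous_field psi -> Omega x -> vnorm dot (psi ^~ x) <= supnorm psi.
Proof.
move=> cpsi Ox; apply: sup_upper_bound; last by exists x.
split; first by exists (vnorm dot (psi ^~ x)), x.
have [M _ HM] := within_continuous_bounded cOmega (within_vnorm hn he cpsi).
by exists M => _ [y Oy <-]; rewrite (le_trans (ler_norm _))// HM.
Qed.

Lemma supnorm_le (psi : field) (c : R) : (forall x, Omega x -> vnorm dot (psi ^~ x) <= c) ->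
  supnorm psi <= c.
Proof.
move=> H; apply: ge_sup; last by move=> _ [x Ox <-]; exact: H.
by have [x /interior_subset Ox] := intO; exists (vnorm dot (psi ^~ x)), x.
Qed.

Lemma supnorm_ge0 (psi : field) : continuous_field psi -> 0 <= supnorm psi.
Proof.
move=> cpsi; have [x /interior_subset Ox] := intO.
by apply: le_trans (supnorm_ge cpsi Ox); exact: vnorm_ge0.
Qed.

Lemma supnormZ_le (a : R) (psi : field) : continuous_field psi -> 0 < a ->
  supnorm (a *: psi) <= a * supnorm psi.
Proof.
move=> cpsi a0; apply: supnorm_le => x Ox.
rewrite (_ : _ ^~ x = fun l => a *: psi l x)// vnormZ// gtr0_norm// ler_pM2l//.
exact: supnorm_ge.
Qed.

Lemma continuous_fieldZ (a : R) (psi : field) : continuous_field psi -> continuous_field (a *: psi).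
Proof. by move=> cpsi l; exact: continuous_onZ. Qed.

Lemma continuous_fieldD (psi1 psi2 : field) : continuous_field psi1 -> continuous_field psi2 ->
  continuous_field (psi1 + psi2).
Proof. by move=> c1 c2 l; exact: continuous_onD. Qed.

(** Embeds a scalar function with the same pointwise norm, so a bounded functional on fields induces
    bounded scalar functionals, to which the Riesz theorem applies. *)
Let slot (l : 'I_d) (i : 'I_n) (f : Rd -> R) : field :=
  fun k x => if k == l then f x *: e i else 0.

Lemma slot_continuous l i f : {within Omega, continuous f} -> continuous_field (slot l i f).
Proof.
move=> cf k; rewrite /slot; case: (k == l); first exact: continuous_on_scale.
exact: continuous_on0.
Qed.

Lemma vnorm_slot l i f x : vnorm dot ((slot l i f) ^~ x) = `|f x|.
Proof.
rewrite /vnorm /vdot (bigD1 l)//= big1 ?addr0 => [|k /negbTE kl].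
  by rewrite /slot eqxx (dot_normsq hn) sqrtr_sqr normr_id normrZ (norm_basis hn he) mulr1.
by rewrite /slot kl dot0l.
Qed.

Lemma sum_slot (psi : field) : psi = \sum_l \sum_i slot l i (fun x => dot (psi l x) (e i)).
Proof.
apply/funext => k; apply/funext => x; rewrite !fct_sumE (bigD1 k)//= [X in _ + X]big1.
  rewrite addr0 !fct_sumE {1}(basis_expand he (psi k x)); apply: eq_bigr => i _.
  by rewrite /slot eqxx.
move=> l lk; rewrite !fct_sumE big1// => i _.
by rewrite /slot eq_sym (negbTE lk).
Qed.

(** The charges are built component by component, but the total variation is read off from the bound
    on the whole functional [L], so the constant [W] is not multiplied by the number of
    components. *)
Theorem flow_exists rho (W : R) : L2 rho ->
  (forall phi, admissible phi -> inner phi rho <= W) ->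
  exists sigma : 'I_d -> vmeasure R d n, [/\ forall l, on_Omega Omega (sigma l),
    forall phi G, C1_with_gradient Omega phi G -> vpairing dot e Omega G sigma = inner phi rho &
    (Defs.total_variation dot e Omega sigma <= W%:E)%E].
Proof.
move=> Lrho HW; have LC phi : continuous_on Omega phi -> L2 phi.
  exact: (L2_continuous_on hn he cOmega).
have W0 : 0 <= W.
  have := HW _ (admissible0 dot Omega); rewrite (_ : inner _ _ = 0)//.
  by rewrite /inner /Rintegral integral0_eq// => x _; rewrite dot0l.
pose p (psi : field) := W * supnorm psi.
have pD psi1 psi2 : continuous_field psi1 -> continuous_field psi2 ->
    p (psi1 + psi2) <= p psi1 + p psi2.
  move=> c1 c2; rewrite /p -mulrDr ler_wpM2l//; apply: supnorm_le => x Ox.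
  rewrite (_ : _ ^~ x = fun l => psi1 l x + psi2 l x)// (le_trans (vnormD hn _ _))//.
  by rewrite lerD// supnorm_ge.
have pZ (a : R) psi : 0 < a -> continuous_field psi -> p (a *: psi) = a * p psi.
  move=> a0 cpsi; rewrite /p mulrCA; congr (_ * _); apply/eqP; rewrite eq_le.
  rewrite supnormZ_le//= -ler_pdivlMl//.
  have := supnormZ_le (@continuous_fieldZ a psi cpsi) (_ : 0 < a^-1).
  by rewrite invr_gt0 scalerA mulVf ?gt_eqF// scale1r; apply.
(* Potentials differing by a constant share a gradient. That the value depends on the gradient only
   is not checked here: it follows from domination, as [p 0 = 0]. *)
pose G0 : set (field * R) := [set u | exists phi, C1_with_gradient Omega phi u.1 /\
  u.2 = inner phi rho].
have dom : dominated_graph continuous_field p G0.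
  split.
  - exists (fun=> 0); split; first exact: C1_with_gradient0.
    by rewrite /inner /Rintegral integral0_eq// => x _; rewrite dot0l.
  - move=> u v [phi1 [C1 u2]] [phi2 [C2 v2]]; exists (fun x => phi1 x + phi2 x).
    split; first exact: C1_with_gradientD.
    have [[c1 _] [c2 _]] := (C1, C2).
    by rewrite u2 v2 (innerDl hn he cOmega (LC _ c1) (LC _ c2)).
  - move=> a u [phi [C1 u2]]; exists (fun x => a *: phi x).
    split; first exact: C1_with_gradientZ.
    by have [c1 _] := C1; rewrite u2 (innerZl hn he cOmega a (LC _ c1)).
  - move=> [G r] [phi []] /= C1 ->; have [c1 cG] := C1.
    have cG' : continuous_field G by move=> l; have [] := cG l.
    split => //; apply/ler_addgt0Pr => eps eps0.
    have W1 : 0 < W + 1 by rewrite ltr_wpDl.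
    (* The second term allows division when [supnorm G] is 0, and costs at most [eps] after
       multiplication by [W]. *)
    pose c := supnorm G + eps / (W + 1).
    have c0 : 0 < c by rewrite ltr_wpDl ?supnorm_ge0// divr_gt0.
    have ac : admissible (fun x => c^-1 *: phi x).
      apply: (C1_admissible hn he cOmega (C1_with_gradientZ c^-1 C1)) => x /interior_subset Ox.
      rewrite vnormZ// gtr0_norm ?invr_gt0// ler_pdivrMl// mulr1.
      by rewrite (le_trans (supnorm_ge cG' Ox))// /c lerDl divr_ge0// ltW.
    have := HW _ ac; rewrite (innerZl hn he cOmega c^-1 (LC _ c1) Lrho) ler_pdivrMl// => H.
    rewrite (le_trans H)// /c mulrDl (mulrC (supnorm G)) lerD2l.
    by rewrite -mulrA ler_piMr ?(ltW eps0)// ler_pdivrMl// mulr1 lerDl.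
have [L [LD LZ Lp LG]] := hahn_banach_graph (@continuous_fieldD) (@continuous_fieldZ) pD pZ dom.
have L0 : L 0 = 0.
  have c0 : continuous_field 0 by move=> l; exact: continuous_on0.
  by rewrite -(scale0r (0 : field)) LZ// mul0r.
have Lsum I (r : seq I) (F : I -> field) : (forall i, continuous_field (F i)) ->
    continuous_field (\sum_(i <- r) F i) /\ L (\sum_(i <- r) F i) = \sum_(i <- r) L (F i).
  move=> cF; elim: r => [|i r [IH1 IH2]].
    by rewrite !big_nil; split => //; move=> l; exact: continuous_on0.
  by rewrite !big_cons LD// IH2; split => //; exact: continuous_fieldD.
have slotD l i f g : slot l i (f \+ g) = slot l i f + slot l i g.
  apply/funext => k; apply/funext => x; rewrite /slot /= !fctE.
  by case: ifP => _; rewrite ?addr0 ?scalerDl.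
have slotZ l i a f : slot l i (fun x => a * f x) = a *: slot l i f.
  apply/funext => k; apply/funext => x; rewrite /slot /= !fctE.
  by case: ifP => _; rewrite ?scaler0 ?scalerA.
have /choice[sigma sigmaP] (l : 'I_d) : exists s : vmeasure R d n, on_Omega Omega s /\
    forall i f, {within Omega, continuous f} -> charge_integral (s i) Omega f = L (slot l i f).
  have /choice[s sP] (i : 'I_n) : exists s : {charge set Rd -> \bar R},
      (forall A, measurable A -> A `&` Omega = set0 -> s A = 0%E) /\
      forall f, {within Omega, continuous f} -> charge_integral s Omega f = L (slot l i f).
    apply: (@riesz_bounded R d Omega cOmega (fun f => L (slot l i f)) W).
    - by move=> f g cf cg; rewrite slotD LD//; exact: slot_continuous.
    - by move=> a f cf; rewrite slotZ LZ//; exact: slot_continuous.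
    - move=> f c cf fc; rewrite (le_trans (Lp _ _))//; first exact: slot_continuous.
      by rewrite ler_wpM2l//; apply: supnorm_le => x Ox; rewrite vnorm_slot fc.
  by exists s; split => [i|i]; have [] := sP i.
have pairL psi : continuous_field psi -> vpairing dot e Omega psi sigma = L psi.
  move=> cpsi; have cs l i : continuous_field (slot l i (fun x => dot (psi l x) (e i))).
    by apply: slot_continuous; exact: continuous_on_dot.
  rewrite [in RHS](sum_slot psi).
  have H l := Lsum _ (index_enum 'I_n) _ (cs l).
  have [_ ->] := Lsum _ (index_enum 'I_d) _ (fun l => (H l).1).
  apply: eq_bigr => l _; rewrite (H l).2; apply: eq_bigr => i _.
  by have [_ ->] := sigmaP l; last exact: continuous_on_dot.
exists sigma; split.
- by move=> l; have [] := sigmaP l.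
- move=> phi G C1; have [_ cG] := C1.
  have cG' : continuous_field G by move=> l; have [] := cG l.
  by rewrite pairL//; apply: (LG (G, _)); exists phi.
- apply: ge_ereal_sup => _ [psi [cpsi psi1] <-]; rewrite lee_fin pairL//.
  by rewrite (le_trans (Lp _ cpsi))// /p ler_piMr//; exact: supnorm_le.
Qed.

Lemma flow_weak_duality rho sigma phi : L2 rho ->
  (forall psi G, C1_with_gradient Omega psi G -> vpairing dot e Omega G sigma = inner psi rho) ->
  admissible phi -> ((inner phi rho)%:E <= Defs.total_variation dot e Omega sigma)%E.
Proof.
move=> Lrho Hsigma aphi; have [C C0 HC] := inner_le_sup hn he cOmega Lrho.
have C1 : 0 < C + 1 by rewrite ltr_wpDl.
have [x0 /nbhs_ballP[r r0 x0r]] := intO.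
have {}x0r y : `|x0 - y| < r -> Omega y by move=> xy; apply: x0r; rewrite -ball_normE.
apply/lee_addgt0Pr => eps eps0.
have [psi [G [C1psi G1 psiphi _]]] :=
  admissible_approximation hn he cOmega convO r0 x0r aphi (divr_gt0 eps0 C1).
have [cpsi cG] := C1psi; have [cphi _] := aphi.
have Lphi := L2_continuous_on hn he cOmega cphi; have Lpsi := L2_continuous_on hn he cOmega cpsi.
apply: (@le_trans _ _ ((inner psi rho)%:E + eps%:E)%E); last first.
  rewrite leeD2r// -(Hsigma _ _ C1psi); apply: ereal_sup_ubound; exists G => //.
  by split => // l; have [] := cG l.
rewrite -EFinD lee_fin -lerBlDl -(innerBl hn he cOmega Lphi Lpsi Lrho).
apply: (@le_trans _ _ (eps / (C + 1) * C)).
  by apply: HC => [|x Ox]; [exact: (L2B hn he cOmega)|rewrite distrC psiphi].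
by rewrite -mulrA ler_piMr ?(ltW eps0)// ler_pdivrMl// mulr1 lerDl.
Qed.

End flows.

(** * Optimality *)

Section optimality.
Variables (R : realType) (d n : nat) (V : normedModType R).
Variables (dot : {dot V for idfun}) (e : 'I_n -> V) (Omega : set 'rV[R]_d).
Hypotheses (hn : norm_of_dot dot) (he : orthonormal_basis dot e) (cOmega : compact Omega).
Variables (lambda : R) (mu nu : 'rV[R]_d -> V).
Hypotheses (lambda0 : 0 < lambda) (Lmu : L2 dot e Omega mu) (Lnu : L2 dot e Omega nu).
Local Notation Rd := 'rV[R]_d.
Local Notation L2 := (L2 dot e Omega).
Local Notation inner := (inner dot Omega).
Local Notation admissible := (admissible dot Omega).
Implicit Types (phi delta : Rd -> V).

(** Unfolds to the functional [D] of the dual problem with [w = nu - mu] and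
    [c = (2 * lambda)^-1]. *)
Definition objective phi : R :=
  inner phi (fun x => nu x - mu x) - (2 * lambda)^-1 * inner phi phi.

Lemma dual_costE phi : continuous_on Omega phi ->
  dual_cost dot e Omega lambda mu nu phi = objective phi.
Proof.
move=> cphi; rewrite /dual_cost (inner_sqrE Omega hn) (pairing_density hn he cOmega)//.
exact: (L2B hn he cOmega).
Qed.

Lemma W1_densityE delta : L2 delta ->
  W1 dot e Omega (density dot e Omega (fun x => mu x + delta x)) (density dot e Omega nu) =
  ereal_sup [set (inner phi (fun x => nu x - (mu x + delta x)))%:E | phi in admissible].
Proof.
move=> Ldelta; congr ereal_sup; apply: eq_imagel => phi [cphi _].
by rewrite (pairing_density_sub hn he cOmega)//; exact: (L2D hn he cOmega).
Qed.

(* Young's inequality [<phi, delta> <= |phi|^2 / (2 lambda) + lambda / 2 |delta|^2]. *)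
Lemma objective_le phi delta : L2 phi -> L2 delta ->
  objective phi <= inner phi (fun x => nu x - (mu x + delta x)) + lambda / 2 * inner delta delta.
Proof.
move=> Lphi Ldelta; have Lw := L2B hn he cOmega Lnu Lmu.
pose a := lambda^-1; have La := L2Z hn he cOmega a Lphi; have LB := L2B hn he cOmega Ldelta La.
have := inner_ge0 Omega hn (fun x => delta x - a *: phi x).
rewrite (innerBl hn he cOmega Ldelta La LB).
rewrite (innerBr hn he cOmega Ldelta La Ldelta) (innerBr hn he cOmega Ldelta La La).
rewrite !(innerZr hn he cOmega)// !(innerZl hn he cOmega)// (innerC dot Omega delta phi) => H.
rewrite (_ : (fun x => nu x - (mu x + delta x)) = (fun x => (nu x - mu x) - delta x)); last first.
  by apply/funext => x; rewrite opprD addrA.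
rewrite (innerBr hn he cOmega Lw Ldelta Lphi) /objective -subr_ge0.
have {H} := mulr_ge0 (divr_ge0 (ltW lambda0) (ler0n R 2)) H.
move=> H; apply: le_trans H _; rewrite le_eqVlt; apply/orP; left; apply/eqP; rewrite /a.
by field; rewrite gt_eqF.
Qed.

Lemma primal_cost_ge phi delta : admissible phi -> L2 delta ->
  ((objective phi)%:E <= primal_cost dot e Omega lambda mu nu delta)%E.
Proof.
move=> aphi Ldelta; have Lphi := admissible_L2 hn he cOmega aphi.
rewrite /primal_cost W1_densityE// (L2_energyE hn he cOmega Ldelta).
apply: (@le_trans _ _ (inner phi (fun x => nu x - (mu x + delta x)) +
  lambda / 2 * inner delta delta)%:E); first by rewrite lee_fin objective_le.
by rewrite EFinD EFinM leeD2r//; apply: ereal_sup_ubound; exists phi.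
Qed.

End optimality.

Theorem theorem3p8 (R : realType) (d n : nat) (V : normedModType R)
    (dot : {dot V for idfun}) (e : 'I_n -> V) (Omega : set 'rV[R]_d)
    (lambda : R) (mu nu : 'rV[R]_d -> V) :
  norm_of_dot dot -> orthonormal_basis dot e ->
  compact Omega -> convex_set Omega -> Omega° !=set0 ->
  0 < lambda ->
  L2 dot e Omega mu -> L2 dot e Omega nu ->
  let T := T12 dot e Omega lambda mu nu in
  (exists2 delta, L2 dot e Omega delta &
     primal_cost dot e Omega lambda mu nu delta = T) /\
  is_max [set (dual_cost dot e Omega lambda mu nu phi)%:E |
            phi in admissible dot Omega] T /\
  is_min [set flow_cost dot e Omega lambda p |
            p in flow_admissible dot e Omega mu nu] T /\
  (forall phi1 phi2, admissible dot Omega phi1 -> admissible dot Omega phi2 ->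
     (dual_cost dot e Omega lambda mu nu phi1)%:E = T ->
     (dual_cost dot e Omega lambda mu nu phi2)%:E = T ->
     forall x, Omega x -> phi1 x = phi2 x).
Proof.
move=> hn he cOmega convO intO lambda0 Lmu Lnu T.
pose w x := nu x - mu x; have Lw : L2 dot e Omega w by exact: (L2B hn he cOmega).
pose c := (2 * lambda)^-1; have c0 : 0 < c by rewrite invr_gt0 mulr_gt0.
pose D := objective dot Omega lambda mu nu.
have [phi aphi maxphi] : exists2 phi, admissible dot Omega phi &
    forall f, admissible dot Omega f -> D f <= D phi.
  exact: (dual_max hn he cOmega convO intO Lw c0).
have Lphi := admissible_L2 hn he cOmega aphi.
(* [2 * c] is [lambda^-1], kept in this form so that [rho] is the gradient of the objective in
   [dual_first_order]. *)
pose delta x := (2 * c) *: phi x.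
have Ldelta : L2 dot e Omega delta by exact: (L2Z hn he cOmega).
pose rho x := nu x - (mu x + delta x).
have rhoE : rho = (fun x => w x - (2 * c) *: phi x).
  by apply/funext => x; rewrite /rho opprD addrA.
have first_order f : admissible dot Omega f -> inner dot Omega f rho <= inner dot Omega phi rho.
  by move=> af; rewrite rhoE; exact: (dual_first_order hn he cOmega Lw c0).
have Lrho : L2 dot e Omega rho.
  by apply: (L2B hn he cOmega) => //; exact: (L2D hn he cOmega).
(* The equality case of Young's inequality. *)
have valueE : inner dot Omega phi rho + lambda / 2 * inner dot Omega delta delta = D phi.
  rewrite rhoE (innerBr hn he cOmega Lw Ldelta Lphi) /delta.
  rewrite !(innerZr hn he cOmega)// (innerZl hn he cOmega)// /D /objective /c.
  by field; rewrite gt_eqF.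
have primalE : primal_cost dot e Omega lambda mu nu delta = (D phi)%:E.
  rewrite /primal_cost (W1_densityE hn he cOmega)// (L2_energyE hn he cOmega Ldelta).
  rewrite -valueE EFinD EFinM; congr (_ + _)%E; apply/eqP; rewrite eq_le; apply/andP; split.
    by apply: ge_ereal_sup => _ [f af <-]; rewrite lee_fin; exact: first_order.
  by apply: ereal_sup_ubound; exists phi.
have TE : T = (D phi)%:E.
  apply/eqP; rewrite eq_le; apply/andP; split.
    by rewrite -primalE; apply: ereal_inf_lbound; exists delta.
  by apply: le_ereal_inf_tmp => _ [f Lf <-]; exact: (primal_cost_ge hn he cOmega).
have dualE f : admissible dot Omega f -> dual_cost dot e Omega lambda mu nu f = D f.
  by move=> [cf _]; exact: (dual_costE hn he cOmega).
(* The minus sign of the weak divergence turns [mu - nu + f] into [nu - (mu + f)], the density that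
   also appears in [W1]. *)
have div_eqE (sigma : 'I_d -> vmeasure R d n) f : L2 dot e Omega f ->
    div_eq dot e Omega sigma (density dot e Omega (fun x => mu x - nu x + f x)) <->
    forall psi G, C1_with_gradient Omega psi G ->
      vpairing dot e Omega G sigma = inner dot Omega psi (fun x => nu x - (mu x + f x)).
  move=> Lf; pose g x := mu x - nu x + f x.
  have Lg : L2 dot e Omega g.
    by apply: (L2D hn he cOmega) => //; exact: (L2B hn he cOmega).
  have E psi : continuous_on Omega psi ->
      inner dot Omega psi (fun x => nu x - (mu x + f x)) =
      - pairing dot e Omega psi (density dot e Omega g).
    move=> cpsi; rewrite (pairing_density hn he cOmega)// -mulN1r.
    rewrite -(innerZr hn he cOmega)//; last exact: (L2_continuous_on hn he cOmega).
    by apply: eq_inner => // x _; rewrite scaleN1r /g !opprD opprK addrA [X in X - _]addrC.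
  split=> H psi G C1; have [cpsi _] := C1.
    by rewrite E// -(H _ _ C1) opprK.
  by rewrite (H _ _ C1) E// opprK.
have [sigma [sigmaO sigmaE sigmaTV]] := flow_exists hn he cOmega intO Lrho first_order.
have flow_ge p : flow_admissible dot e Omega mu nu p -> (T <= flow_cost dot e Omega lambda p)%E.
  move=> [pO Lp /(div_eqE _ _ Lp) pE]; rewrite TE /flow_cost (L2_energyE hn he cOmega Lp).
  apply: (@le_trans _ _ (inner dot Omega phi (fun x => nu x - (mu x + p.2 x)) +
    lambda / 2 * inner dot Omega p.2 p.2)%:E).
    by rewrite lee_fin; exact: (objective_le hn he cOmega).
  rewrite EFinD EFinM leeD2r//; apply: (flow_weak_duality hn he cOmega convO intO) => //.
  by apply: (L2B hn he cOmega) => //; exact: (L2D hn he cOmega).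
have flow_opt : flow_admissible dot e Omega mu nu (sigma, delta).
  by split => //; apply/(div_eqE _ _ Ldelta).
split; first by exists delta => //; rewrite TE.
split.
  split; first by exists phi => //; rewrite TE dualE.
  by move=> _ [f af <-]; rewrite TE lee_fin dualE//; exact: maxphi.
split.
  split; last by move=> _ [p ap <-]; exact: flow_ge.
  (* The total variation of [sigma] is at most [inner phi rho], so by [valueE] its cost is at most
     [D phi], which is [T]. *)
  exists (sigma, delta) => //; apply/eqP; rewrite eq_le flow_ge// andbT.
  rewrite TE -valueE /flow_cost (L2_energyE hn he cOmega Ldelta) EFinD EFinM.
  exact: leeD2r.
move=> phi1 phi2 a1 a2; rewrite TE !dualE// => -[D1] [D2].
apply: (dual_unique hn he cOmega convO intO Lw c0 a1 a2).
  by move=> f af; rewrite (le_trans (maxphi f af))// -D1.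
by rewrite -[LHS]/(D phi1) D1 -D2.
Qed.
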